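(* Fix $0<\xi<\omega_1$ and let $P=(\mathfrak{P},\mathcal{P})$ be a $\xi$-homogeneous probability block. Let $X$ be a Banach space and let $(g_n)_{n=1}^\infty$ be a seminormalized Schauder basis (of some Banach space). If for every weakly null $\varsigma\in\ell_\infty(X)$ there exists $M\in[\mathbb{N}]$ such that $\mathbb{E}^P_M\varsigma$ is dominated by $(g_n)_{n=1}^\infty$, then there exists a constant $C$ such that for any weakly null $\varsigma\in B_{\ell_\infty(X)}$ and $L\in[\mathbb{N}]$, there exists $M\in[L]$ such that for all $N\in[M]$, $\mathbb{E}^P_N\varsigma$ is $C$-dominated by $(g_n)_{n=1}^\infty$. Furthermore, if such a constant $C$ exists, then it depends only on $\xi$ and not on the particular $\xi$-homogeneous probability block, in the sense that the infimum of such constants is the same for every $\xi$-homogeneous probability block.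
   Context: Sets. $\mathbb{N}=\{1,2,\ldots\}$. For infinite $M\subset\mathbb{N}$, $[M]$ is the set of infinite subsets of $M$ and $[M]^{<\omega}$ the set of finite subsets. Subsets of $\mathbb{N}$ are identified with increasing sequences. $E\preceq F$ ($E\prec F$) means $E$ is an (a proper) initial segment of $F$; $E<F$ means $E=\varnothing$ or $F=\varnothing$ or $\max E<\min F$. Families. For $\mathcal{F}\subset[\mathbb{N}]^{<\omega}$, $MAX(\mathcal{F})$ is the set of $\preceq$-maximal members. $\mathcal{F}$ is spreading if $(m_i)_{i=1}^t\in\mathcal{F}$, $l_1<\cdots<l_t$, $m_i\leqslant l_i$ imply $(l_i)_{i=1}^t\in\mathcal{F}$; hereditary if closed under subsets; compact if compact in the product topology of $2^{\mathbb{N}}$; regular if all three. A regular $\mathcal{F}$ is nice if it contains all singletons and each $F\in\mathcal{F}$ is either in $MAX(\mathcal{F})$ or satisfies $F\cup\{n\}\in\mathcal{F}$ for all $n>F$. Derivatives of a hereditary $\mathcal{F}$: $\mathcal{F}^0=\mathcal{F}$, $\mathcal{F}^{\eta+1}=\mathcal{F}^\eta\setminus MAX(\mathcal{F}^\eta)$, intersections at limits; $\mathrm{rank}(\mathcal{F})$ is the least $\eta$ with $\mathcal{F}^\eta=\varnothing$. $M|\mathcal{F}$ is the maximal initial segment of $M$ belonging to $\mathcal{F}$. Probability blocks. For a probability measure $\mathbb{P}$ on $\mathbb{N}$ write $\mathbb{P}(i)=\mathbb{P}(\{i\})$ and $\mathrm{supp}(\mathbb{P})=\{i:\mathbb{P}(i)\neq0\}$.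 A probability block is a pair $(\mathfrak{P},\mathcal{P})$ with $\mathcal{P}$ nice and $\mathfrak{P}=\{\mathbb{P}_{M,n}:M\in[\mathbb{N}],n\in\mathbb{N}\}$ probability measures on $\mathbb{N}$ such that (i) $\mathrm{supp}(\mathbb{P}_{M,1})=M|\mathcal{P}$ for all $M$; (ii) if $M,N\in[\mathbb{N}]$ and $r\in\mathbb{N}$ satisfy $\mathrm{supp}(\mathbb{P}_{M,r})\prec N$, then $\mathbb{P}_{N,1}=\mathbb{P}_{M,r}$. It is understood that $(\mathrm{supp}(\mathbb{P}_{M,n}))_{n=1}^\infty$ is the unique partition of $M$ into successive members of $MAX(\mathcal{P})$. It is $\xi$-sufficient if for every regular $\mathcal{F}$ with $\mathrm{rank}(\mathcal{F})\leqslant\omega^\xi$, every $L\in[\mathbb{N}]$ and $\varepsilon>0$ there is $M\in[L]$ with $\sup\{\mathbb{P}_{N,1}(E):N\in[M],E\in\mathcal{F}\}\leqslant\varepsilon$; it is $\xi$-homogeneous if it is $\xi$-sufficient and $\mathrm{rank}(\mathcal{P})=\omega^\xi+1$. For $\varsigma=(x_n)_{n=1}^\infty\subset X$, $\mathbb{E}^P_M\varsigma$ is the sequence whose $n$-th term is $\sum_{i}\mathbb{P}_{M,n}(i)x_i$. $\ell_\infty(X)$ is the space of bounded sequences in $X$ with the sup norm and $B_{\ell_\infty(X)}$ its closed unit ball. A sequence $(x_n)$ is $C$-dominated by $(g_n)$ if $\|\sum a_nx_n\|\leqslant C\|\sum a_ng_n\|$ for all finitely supported scalar sequences $(a_n)$,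 and dominated if this holds for some $C$. Seminormalized: $0<\inf_n\|g_n\|\leqslant\sup_n\|g_n\|<\infty$. *)

(* Defs.v *)
From HB Require Import structures.
From mathcomp Require Import all_boot all_order all_algebra.
From mathcomp Require Import complex.
From mathcomp Require Import all_classical all_reals all_analysis.

Set Implicit Arguments.
Unset Strict Implicit.
Unset Printing Implicit Defensive.

Import Order.TTheory GRing.Theory Num.Theory.
Import numFieldNormedType.Exports.

Local Open Scope classical_set_scope.
Local Open Scope ring_scope.

(* The natural numbers 1, 2, ... are represented by [nat]: every notion below
   depends only on the order of the index set, so the n-th object of the usual
   indexing (P_{M,n}, x_n, g_n) is the one with index n.-1 here. *)

(* Brouwer notations: [OLim f] denotes sup_n (f n), with no monotonicity
   condition on f.  Every countable ordinal has a notation; two notations a, b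
   denote the same ordinal iff [ord_le a b] and [ord_le b a]. *)
Inductive ord : Type :=
| OZero : ord
| OSucc : ord -> ord
| OLim : (nat -> ord) -> ord.

Inductive ord_le : ord -> ord -> Prop :=
| ord_le_zero b : ord_le OZero b
| ord_le_succ a b : ord_le a b -> ord_le (OSucc a) (OSucc b)
| ord_le_sup a f n : ord_le a (f n) -> ord_le a (OLim f)
| ord_le_lub f b : (forall n, ord_le (f n) b) -> ord_le (OLim f) b.

Definition ord_lt (a b : ord) : Prop := ord_le (OSucc a) b.

Fixpoint ord_add (a b : ord) : ord :=
  match b with
  | OZero => a
  | OSucc b' => OSucc (ord_add a b')
  | OLim f => OLim (fun n => ord_add a (f n))
  end.

Fixpoint ord_mul (a b : ord) : ord :=
  match b with
  | OZero => OZero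
  | OSucc b' => ord_add (ord_mul a b') a
  | OLim f => OLim (fun n => ord_mul a (f n))
  end.

Definition omega : ord := OLim (fun n => iter n OSucc OZero).

Fixpoint omega_exp (b : ord) : ord :=
  match b with
  | OZero => OSucc OZero
  | OSucc b' => ord_mul (omega_exp b') omega
  | OLim f => OLim (fun n => omega_exp (f n))
  end.

Definition inf_subsets (M : set nat) : set (set nat) :=
  [set N | N `<=` M /\ infinite_set N].

Definition init_seg (E F : set nat) : Prop :=
  E `<=` F /\ forall m n, E n -> F m -> (m <= n)%N -> E m.

Definition proper_init_seg (E F : set nat) : Prop := init_seg E F /\ E <> F.

Definition set_before (E F : set nat) : Prop :=
  forall m n, E m -> F n -> (m < n)%N.

Definition MAX (F : set (set nat)) : set (set nat) :=
  [set E | F E /\ forall G, F G -> init_seg E G -> G = E].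

Definition spreading (F : set (set nat)) : Prop :=
  forall (t : nat) (m l : 'I_t -> nat),
    {homo m : i j / (i < j)%N} -> {homo l : i j / (i < j)%N} ->
    (forall i, (m i <= l i)%N) -> F (range m) -> F (range l).

Definition hereditary (F : set (set nat)) : Prop :=
  forall A B, F A -> B `<=` A -> F B.

Definition compact_family (F : set (set nat)) : Prop :=
  compact [set ((fun n => n \in A) : cantor_space) | A in F].

Definition regular (F : set (set nat)) : Prop :=
  [/\ F `<=` [set A | finite_set A],
      spreading F, hereditary F & compact_family F].

Definition nice (F : set (set nat)) : Prop :=
  [/\ regular F,
      forall n, F [set n]
    & forall A, F A ->
        MAX F A \/ forall n, set_before A [set n] -> F (A `|` [set n])].

(* The [OLim] clause covers non-strict suprema as well, because the
   derivatives decrease. *)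
Fixpoint derivative (F : set (set nat)) (eta : ord) : set (set nat) :=
  match eta with
  | OZero => F
  | OSucc eta' => derivative F eta' `\` MAX (derivative F eta')
  | OLim f => \bigcap_n derivative F (f n)
  end.

Definition is_rank (F : set (set nat)) (eta : ord) : Prop :=
  derivative F eta = set0 /\
  forall zeta, derivative F zeta = set0 -> ord_le eta zeta.

Definition rank_le (F : set (set nat)) (eta : ord) : Prop :=
  exists zeta, is_rank F zeta /\ ord_le zeta eta.

(* E = M|F *)
Definition is_restr (M : set nat) (F : set (set nat)) (E : set nat) : Prop :=
  [/\ init_seg E M, F E & forall G, init_seg G M -> F G -> init_seg G E].

Section Blocks.
Variable R : realType.
Local Open Scope ereal_scope.

Definition supp (p : probability nat R) : set nat := [set i | p [set i] != 0].

(* [block_meas M n] is only constrained, and only used, for infinite M. *)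
Record prob_block : Type := ProbBlock {
  block_meas : set nat -> nat -> probability nat R;
  block_fam : set (set nat);
  block_nice : nice block_fam;
  block_supp0 : forall M, infinite_set M ->
    is_restr M block_fam (supp (block_meas M 0));
  block_shift : forall M N r, infinite_set M -> infinite_set N ->
    proper_init_seg (supp (block_meas M r)) N ->
    block_meas N 0 =1 block_meas M r;
  block_partition : forall M, infinite_set M ->
    [/\ \bigcup_n supp (block_meas M n) = M,
        forall n, MAX block_fam (supp (block_meas M n))
      & forall n, set_before (supp (block_meas M n))
                             (supp (block_meas M n.+1))]
}.

Definition sufficient (xi : ord) (P : prob_block) : Prop :=
  forall F : set (set nat), regular F -> rank_le F (omega_exp xi) ->
  forall L : set nat, infinite_set L ->
  forall eps : R, (0 < eps)%R ->
  exists2 M, inf_subsets L M &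
    ereal_sup [set y | exists N E,
      [/\ inf_subsets M N, F E & y = block_meas P N 0 E]] <= eps%:E.

Definition homogeneous (xi : ord) (P : prob_block) : Prop :=
  sufficient xi P /\ is_rank (block_fam P) (OSucc (omega_exp xi)).

End Blocks.

Definition scalar_field (R : realType) (cplx : bool) : numFieldType :=
  if cplx then (R[i] : numFieldType) else (R : numFieldType).

Definition of_real (R : realType) (cplx : bool) : R -> scalar_field R cplx :=
  if cplx as b return R -> scalar_field R b then fun x => x%:C%C else fun x => x.
Arguments of_real {R} cplx _.

Section Sequences.
Variables (R : realType) (cplx : bool).
Let K : numFieldType := scalar_field R cplx.
Implicit Types (X G : completeNormedModType K).

Definition weakly_null X (x : nat -> X) : Prop :=
  forall f : {linear X -> K^o}, continuous f -> f (x n) @[n --> \oo] --> (0 : K^o).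

Definition schauder_basis G (g : nat -> G) : Prop :=
  forall y : G, exists! a : nat -> K,
    series (fun n => a n *: g n) @ \oo --> y.

Definition seminormalized G (g : nat -> G) : Prop :=
  exists c d : R, (0 < c)%R /\
    forall n, of_real cplx c <= `|g n| /\ `|g n| <= of_real cplx d.

(* The truncations at n of arbitrary sequences are exactly the finitely
   supported ones. When some g n is not zero, C >= 0 is forced. *)
Definition C_dominated X G (C : R) (x : nat -> X) (g : nat -> G) : Prop :=
  forall (n : nat) (a : nat -> K),
    `|\sum_(i < n) a i *: x i| <= of_real cplx C * `|\sum_(i < n) a i *: g i|.

Definition dominated X G (x : nat -> X) (g : nat -> G) : Prop :=
  exists C : R, C_dominated C x g.

(* The sum over the support is [fsbig]'s finitely supported sum; the measures
   of a block evaluated at infinite M have finite support. *)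
Definition block_avg (P : prob_block R) (M : set nat) X (x : nat -> X) :
    nat -> X :=
  fun n => \sum_(i \in supp (block_meas P M n))
             of_real cplx (fine (block_meas P M n [set i])) *: x i.

Definition uniformly_dominated (P : prob_block R) X G (g : nat -> G) (C : R) :
    Prop :=
  forall x : nat -> X, weakly_null x -> (forall n, `|x n| <= 1) ->
  forall L, infinite_set L ->
  exists2 M, inf_subsets L M &
    forall N, inf_subsets M N -> C_dominated C (block_avg P N x) g.

End Sequences.

Arguments uniformly_dominated {R cplx} P X {G} g C.

(* Main.v *)
Require Import Defs.
From HB Require Import structures.
From mathcomp Require Import all_boot all_order all_algebra.
From mathcomp Require Import complex.
From mathcomp Require Import all_classical all_reals all_analysis.
From mathcomp Require Import zify ring lra.

Set Implicit Arguments.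
Unset Strict Implicit.
Unset Printing Implicit Defensive.

Import Order.TTheory GRing.Theory Num.Theory.
Import numFieldNormedType.Exports.

Local Open Scope classical_set_scope.
Local Open Scope ring_scope.

(** Suppose that the averages of a weakly null sequence [x] in the unit ball,
    taken with a block [Q], fail to be dominated with constant [C].  The failure
    for an index set [N] involves finitely many averages, so it is an open
    condition on [N], and by Ramsey's theorem for open sets ([open_Ramsey]) it
    may be assumed for all infinite subsets of some [L].

    A failure comes with coefficients [a i] and a norming functional [u].
    Since [u] of an average is an average of values of [u], the functional is
    almost as large as needed at the points of some part of the [i]-th support,
    and this part has [Q]-measure bounded below ([functional_large]).
    Sufficiency makes members of regular families of rank at most [omega^xi]
    negligible, so such a part cannot belong to one of these families.  This is
    used for the family [H] of the members of the family of another block [P]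
    with one point inserted: all sections of [H] at a point are negligible for
    [Q] ([plus_one_small]).  Hence, on a suitable infinite set [T], every
    infinite [E] has a functional that is large on the blocks of [E] relative to
    [H], except at their minima ([thin_witnessed]).  Here [Q] has disappeared.

    After a further thinning in the manner of Elton this functional is also
    small at the points of [T] outside [E] ([thin_small_witness]); this is where
    weak nullity enters, through the weak* compactness of the dual ball
    ([weakly_null_gap]).

    Now take countably many rows [x l], each with such a failure of its own
    constant [c l].  Stage by stage one chooses indices [phi l j] such that, for
    each [k] and each [N], there is a set [E] for the row [k] whose blocks,
    from the [k]-th on, contain the images under [phi k] of the supports of [P]
    along [N], while
    the other rows only meet the complement of [E] ([assembly]).  The inserted
    point is what makes room for this: it becomes the minimum of the block.  So
    row [k] along [phi k] has the functional required to violate domination with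
    constant [c k] for the block [P], and the other rows are almost invisible to
    this functional ([transfer]).

    With a single row this shows that domination with constant [C] for [P]
    implies domination with every larger constant for [Q]; by symmetry the
    infima agree.  With [Q = P] and rows of rapidly growing [c k], the weighted
    sum of the rows ([superpose]) is a weakly null bounded sequence whose
    averages are not dominated along any set, so that some constant must work
    uniformly if domination can always be achieved. *)

(** * Thinning infinite sets of integers *)

Definition hd (c : nat) (E : set nat) : set nat := E `&` [set n | (n <= c)%N].
Definition tl (c : nat) (E : set nat) : set nat := E `&` [set n | (c < n)%N].

Lemma infP (A : set nat) :
  infinite_set A <-> forall b, exists2 n, A n & (b < n)%N.
Proof.
split=> [iA b|hA fA].
  apply: contrapT => /forall2NP h; apply: iA.
  apply: (@sub_finite_set _ _ `I_b.+1); last exact: finite_II.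
  by move=> n An /=; case: (h n) => // /negP; rewrite -leqNgt.
have /finite_seqP[s As] := fA.
have [n An] := hA (\max_(i <- s) i).
have ns : n \in s by move: An; rewrite As.
by rewrite ltnNge (@leq_bigmax_seq _ _ _ id _ ns).
Qed.

Lemma infinite_tl c A : infinite_set A -> infinite_set (tl c A).
Proof.
move=> /infP hA; apply/infP => b; have [n An nb] := hA (maxn b c).
by exists n => //=; [split=> //=; lia | lia].
Qed.

Lemma inf_sub (A B : set nat) : infinite_set A -> A `<=` B -> infinite_set B.
Proof. by move=> iA AB fB; apply: iA; apply: sub_finite_set fB. Qed.

Lemma inf_subsets_trans L M N :
  inf_subsets L M -> inf_subsets M N -> inf_subsets L N.
Proof. by move=> [LM _] [MN iN]; split=> // x /MN /LM. Qed.

Lemma inf_subsetsxx L : infinite_set L -> inf_subsets L L.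
Proof. by split. Qed.

Lemma inf_subsets_tl b M : infinite_set M -> inf_subsets M (tl b M).
Proof. by move=> iM; split; [move=> x [] | exact: infinite_tl]. Qed.

Lemma hd_tlU c E : hd c E `|` tl c E = E.
Proof.
rewrite /hd /tl -setIUr; apply/setIidl => x _ /=; case: (leqP x c); by [left|right].
Qed.

Lemma ex_least (P : nat -> Prop) :
  (exists n, P n) -> exists2 n, P n & forall m, P m -> (n <= m)%N.
Proof.
move=> [n0 Pn0]; have ex : exists n, `[< P n >] by exists n0; apply/asboolP.
case: (ex_minnP ex) => n /asboolP Pn mn; exists n => // m Pm.
by apply: mn; apply/asboolP.
Qed.

Lemma ex_pred (E : set nat) c : (exists2 x, E x & (x < c)%N) ->
  exists x, [/\ E x, (x < c)%N & forall y, E y -> (y < c)%N -> (y <= x)%N].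
Proof.
move=> [x0 Ex0 x0c].
pose P n := [/\ (n <= c)%N, E (c - n)%N & (0 < n)%N].
have [|n [nc En n0] mn] := @ex_least P.
  by exists (c - x0)%N; split; [lia| rewrite subKn // ltnW | lia].
exists (c - n)%N; split=> //; first lia.
move=> y Ey yc; have := mn (c - y)%N; rewrite /P subKn; last exact: ltnW.
by move=> h; have /h : [/\ (c - y <= c)%N, E y & (0 < c - y)%N]; [split=> //; lia | lia].
Qed.

(** The diagonal argument behind every thinning below: a requirement attached to
    each point [b] of [T] is met by the points of [T] that were chosen after
    [b]. *)
Lemma fusion (Phi : nat -> set nat -> Prop) (L : set nat) :
  (forall b M M', Phi b M -> inf_subsets M M' -> Phi b M') ->
  (forall b M, infinite_set M -> exists2 M', inf_subsets M M' & Phi b M') ->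
  infinite_set L ->
  exists2 T, inf_subsets L T & forall b, T b -> Phi b (tl b T).
Proof.
move=> mono dens iL.
have step (M : set nat) : exists p : nat * set nat, infinite_set M ->
    [/\ M p.1, inf_subsets (tl p.1 M) p.2 & Phi p.1 p.2].
  have [iM|nM] := pselect (infinite_set M); last by exists (0%N, M).
  have [t Mt _] := (infP M).1 iM 0%N.
  have [M' sM' PM'] := dens t _ (infinite_tl (c := t) iM).
  by exists (t, M').
have [f fP] := choice step.
pose M i := iter i (fun M => (f M).2) L.
have iM i : infinite_set (M i).
  by elim: i => // i IH; have [_ []] := fP _ IH.
have MS i : inf_subsets (tl (f (M i)).1 (M i)) (M i.+1).
  by have [_ ? _] := fP _ (iM i).
pose t i := (f (M i)).1.
have Mt i : M i (t i) by have [] := fP _ (iM i).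
have Msub i j : M (i + j)%N `<=` M i.
  elim: j => [|j IH]; first by rewrite addn0.
  by rewrite addnS => x; have [+ _] := MS (i + j)%N => /[apply] -[/IH].
have tlt i j : (i < j)%N -> (t i < t j)%N.
  move=> ij; have : M i.+1 (t j).
    by have := @Msub i.+1 (j - i.+1)%N; rewrite subnKC //; exact.
  by have [+ _] := MS i => /[apply] -[].
have tge i : (i <= t i)%N.
  elim: i => // i IH; exact: leq_ltn_trans IH (tlt _ _ (ltnSn i)).
exists (range t).
  split.
    by move=> _ [i _ <-]; apply: (@Msub 0%N i).
  apply/infP => b; exists (t b.+1); first by exists b.+1.
  exact: leq_ltn_trans (tge b) (tlt _ _ (ltnSn b)).
move=> _ [i _ <-]; have [_ _ Phit] := fP _ (iM i).
apply: (mono _ _ _ Phit); split.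
  move=> _ [[j _ <-] /= tij].
  have ij : (i < j)%N.
    rewrite ltnNge; apply/negP; rewrite leq_eqVlt => /predU1P[ji|/tlt].
      by move: tij; rewrite ji ltnn.
    by move=> /(ltn_trans tij); rewrite ltnn.
  by have := @Msub i.+1 (j - i.+1)%N (t j); rewrite subnKC //; exact.
apply: infinite_tl; apply/infP => b; exists (t b.+1); first by exists b.+1.
exact: leq_ltn_trans (tge b) (tlt _ _ (ltnSn b)).
Qed.

(** Finitely many requirements indexed by the subsets of an initial interval
    can be met one after the other. *)
Lemma forall_subsets (A : Type) (ok : A -> Prop) (le : A -> A -> Prop) b
    (Psi : set nat -> A -> Prop) :
  (forall x, le x x) -> (forall y x z, le x y -> le y z -> le x z) ->
  (forall s x y, Psi s x -> le x y -> ok y -> Psi s y) ->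
  (forall s x, ok x -> exists y, [/\ ok y, le x y & Psi s y]) ->
  forall x, ok x ->
    exists y, [/\ ok y, le x y & forall s, s `<=` `I_b -> Psi s y].
Proof.
move=> le1 leT; elim: b Psi => [|b IH] Psi mono dens x okx.
  have [y [oky xy Py]] := dens set0 x okx; exists y; split=> // s s0.
  by have -> : s = set0 by apply/seteqP; split=> // z /s0.
pose Psi' s y := Psi s y /\ Psi (s `|` [set b]) y.
have [|s y oky|y [oky xy h]] := IH Psi' _ _ x okx.
- by move=> s y z [P1 P2] yz okz; split; [exact: mono P1 yz okz|exact: mono P2 yz okz].
- have [z [okz yz Pz]] := dens s y oky.
  have [w [okw zw Pw]] := dens (s `|` [set b]) z okz.
  by exists w; split=> //; [exact: leT yz zw | split=> //; exact: mono zw okw].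
exists y; split=> // s sb.
have [P1 P2] := h (s `&` `I_b) (@subIsetr _ _ _).
have [sb1|sb1] := pselect (s b).
- suff -> : s = s `&` `I_b `|` [set b] by [].
  apply/seteqP; split=> [z sz|z [[]//|->//]].
  have [->|zb] := eqVneq z b; first by right.
  by left; split=> //=; have /= := sb _ sz; lia.
suff -> : s = s `&` `I_b by [].
apply/seteqP; split=> [z sz|z []//]; split=> //=.
have [zb|zb] := eqVneq z b; first by rewrite zb in sz.
by have /= := sb _ sz; lia.
Qed.

Lemma thin_forall_subsets b (Psi : set nat -> set nat -> Prop) :
  (forall s M M', Psi s M -> inf_subsets M M' -> Psi s M') ->
  (forall s M, infinite_set M -> exists2 M', inf_subsets M M' & Psi s M') ->
  forall M, infinite_set M ->
    exists2 M', inf_subsets M M' & forall s, s `<=` `I_b -> Psi s M'.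
Proof.
move=> mono dens M iM.
have [|||s x ix|M' [iM' MM' h]] := @forall_subsets _ (fun M : set nat => infinite_set M)
  (fun M M' : set nat => M' `<=` M) b Psi _ _ _ _ M iM.
- by move=> x t.
- by move=> y x z yx zy t /zy /yx.
- by move=> s x y Px yx iy; apply: mono Px _; split.
- by have [y [yx iy] Py] := dens s x ix; exists y.
by exists M'.
Qed.

Definition open_family (U : set (set nat)) : Prop :=
  forall N, infinite_set N -> U N -> exists b, forall N', infinite_set N' ->
    (forall n, (n <= b)%N -> N n <-> N' n) -> U N'.

(** Nash-Williams' theorem, by combinatorial forcing: a finite set [s] is
    accepted by [M] if all its extensions by subsets of [M] are in [U], and
    rejected if no subset of [M] accepts it.  On a diagonal set, a rejected [s]
    has only rejected one-point extensions; if the empty set is rejected, so are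
    all finite initial segments of any [N], whereas those of a member of [U] end
    up being accepted because [U] is open. *)
Lemma open_Ramsey (U : set (set nat)) (L : set nat) :
  open_family U -> infinite_set L ->
  exists2 T, inf_subsets L T &
    (forall N, inf_subsets T N -> U N) \/ (forall N, inf_subsets T N -> ~ U N).
Proof.
move=> oU iL.
pose acc s M := forall N, inf_subsets M N -> U (s `|` N).
pose rej s M := forall M', inf_subsets M M' -> ~ acc s M'.
have accS s M M' : acc s M -> inf_subsets M M' -> acc s M'.
  by move=> h MM' N M'N; apply: h; apply: inf_subsets_trans M'N.
have rejS s M M' : rej s M -> inf_subsets M M' -> rej s M'.
  by move=> h MM' N M'N; apply: h; apply: inf_subsets_trans M'N.
have dec s M : infinite_set M ->
    exists2 M', inf_subsets M M' & acc s M' \/ rej s M'.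
  move=> iM; have [[M' MM' aM']|nacc] := pselect (exists2 M', inf_subsets M M' & acc s M').
    by exists M' => //; left.
  exists M; first exact: inf_subsetsxx.
  by right=> M' MM' aM'; apply: nacc; exists M'.
pose Psi s M := acc s M \/ forall n, M n -> rej (s `|` [set n]) (tl n M).
have tlS n M M' : inf_subsets M M' -> inf_subsets (tl n M) (tl n M').
  by move=> [MM' iM']; split; [move=> x [/MM' ? ?] | exact: infinite_tl].
have PsiS s M M' : Psi s M -> inf_subsets M M' -> Psi s M'.
  move=> [aM|rM] MM'; [left; exact: accS aM MM'|right=> n M'n].
  by apply: rejS (tlS n _ _ MM'); apply: rM; exact: MM'.1.
have Psid s M : infinite_set M -> exists2 M', inf_subsets M M' & Psi s M'.
  move=> iM; have [M0 MM0 [aM0|rM0]] := dec s M iM; first by exists M0 => //; left.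
  have [|n M1 iM1|M1 MM1 dM1] := @fusion
      (fun n M => acc (s `|` [set n]) M \/ rej (s `|` [set n]) M) M0 _ _ MM0.2.
  - by move=> n M1 M2 [h|h] M12; [left; exact: accS h M12|right; exact: rejS h M12].
  - exact: dec.
  pose A := [set n | M1 n /\ acc (s `|` [set n]) (tl n M1)].
  have [iA|/infP] := pselect (infinite_set A).
    exfalso; apply: (rM0 A); first by split=> // x [/MM1.1].
    move=> N [NA iN].
    have [n Nn mn] : exists2 n, N n & forall m, N m -> (n <= m)%N.
      by apply: ex_least; have [n Nn _] := (infP N).1 iN 0%N; exists n.
    have [_ /(_ (tl n N))] := NA n Nn.
    have -> : s `|` [set n] `|` tl n N = s `|` N.
      apply/seteqP; split=> x.
        by move=> [[sx|->]|[Nx _]]; [left|right|right].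
      move=> [sx|Nx]; first by left; left.
      by have := mn x Nx; rewrite leq_eqVlt => /predU1P[<-|nx]; [left; right|right].
    apply; split; last exact: infinite_tl.
    by move=> x [Nx nx]; split=> //; have [] := NA x Nx.
  move=> /existsNP[b /forall2NP nb].
  exists (tl b M1).
    by apply: inf_subsets_trans MM0 (inf_subsets_trans MM1 (inf_subsets_tl b MM1.2)).
  right=> n [M1n bn]; have [a|r] := dM1 n M1n.
    by case: (nb n) => //; case.
  by apply: rejS r (tlS n _ _ (inf_subsets_tl b MM1.2)).
have [M0 LM0 [aM0|rM0]] := Psid set0 L iL.
  by exists M0 => //; left=> N M0N; rewrite -[N]set0U; exact: aM0.
have [|b M iM|T M0T PT] := @fusion (fun b M => forall s, s `<=` `I_b.+1 -> Psi s M)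
    M0 _ _ LM0.2.
- by move=> b M M' h MM' s sb; apply: PsiS (h s sb) MM'.
- exact: thin_forall_subsets.
exists T; first exact: inf_subsets_trans M0T.
right=> N TN UN.
have key c : N c -> rej (hd c N) (tl c T).
  elim/ltn_ind: c => c IH Nc.
  have [lo|nlo] := pselect (exists2 x, N x & (x < c)%N).
    have [d [Nd dc md]] := ex_pred lo.
    have hE : hd c N = hd d N `|` [set c].
      apply/seteqP; split=> x.
        move=> [Nx]; rewrite /= leq_eqVlt => /predU1P[->|xc]; first by right.
        by left; split=> //=; exact: md.
      by move=> [[Nx /= xd]|->]; split=> //=; lia.
    have [||h] := PT d (TN.1 _ Nd) (hd d N).
    - by move=> x [_ /=].
    - move=> a; exfalso; apply: (IH d dc Nd) a; apply: inf_subsetsxx.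
      exact: infinite_tl M0T.2.
    have := h c; rewrite hE => /(_ (conj (TN.1 _ Nc) dc)) r.
    apply: rejS r _; split; last exact: infinite_tl M0T.2.
    by move=> x [Tx cx]; split=> //; split=> //=; move: cx => /=; lia.
  have -> : hd c N = set0 `|` [set c].
    rewrite set0U; apply/seteqP; split=> [x [Nx /= xc]|_ ->]; last by split=> /=.
    by apply/eqP; rewrite eqn_leq xc leqNgt; apply/negP => cx; apply: nlo; exists x.
  apply: rejS (rM0 c (M0T.1 _ (TN.1 _ Nc))) (tlS c _ _ M0T).
have [b hb] := oU N TN.2 UN.
have [c Nc bc] := (infP N).1 TN.2 b.
apply: (key c Nc (tl c T)); first by apply: inf_subsetsxx; exact: infinite_tl M0T.2.
move=> N' [N'T iN']; apply: hb.
  by apply: inf_sub iN' _ => x; right.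
move=> n nb; split=> [Nn|[[]//|/N'T[_ /=]]]; last by lia.
by left; split=> //=; lia.
Qed.

(** * Ordinals and ranks *)

Lemma ord_le_refl a : ord_le a a.
Proof.
elim: a => [|a IH|f IH]; first exact: ord_le_zero.
- exact: ord_le_succ.
- by apply: ord_le_lub => n; apply: (@ord_le_sup _ _ n).
Qed.

Lemma ord_le_lim_inv f b n : ord_le (OLim f) b -> ord_le (f n) b.
Proof.
elim: b => [|b IH|g IH] H.
- by inversion H.
- by inversion H.
- inversion H as [| |a g' m H1|f' b' H1]; subst; last exact: H1.
  by apply: (@ord_le_sup _ _ m); exact: IH.
Qed.

Lemma ord_le_succ_inv a b : ord_le (OSucc a) (OSucc b) -> ord_le a b.
Proof. by move=> H; inversion H. Qed.

Lemma ord_lt_lim_inv a f : ord_lt a (OLim f) -> exists n, ord_lt a (f n).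
Proof. by move=> H; inversion H as [| |a' g' m H1|]; exists m. Qed.

Lemma ord_le_trans b a c : ord_le a b -> ord_le b c -> ord_le a c.
Proof.
move=> ab; elim: ab c => {a b} [b|a b ab IH|a f n afn IH|f b fb IH] c bc.
- exact: ord_le_zero.
- elim: c bc => [|c _|g IHg] H; first by inversion H.
    by apply: ord_le_succ; apply: IH; exact: ord_le_succ_inv H.
  by have [n gn] := ord_lt_lim_inv H; apply: (@ord_le_sup _ _ n); exact: IHg.
- by apply: IH; exact: ord_le_lim_inv bc.
- by apply: ord_le_lub => n; exact: IH.
Qed.

Lemma ord_leS a : ord_le a (OSucc a).
Proof.
elim: a => [|a IH|f IH]; [exact: ord_le_zero|exact: ord_le_succ|].
apply: ord_le_lub => n; apply: ord_le_trans (IH n) _; apply: ord_le_succ.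
by apply: (@ord_le_sup _ _ n); exact: ord_le_refl.
Qed.

Lemma ord_le_total a b : ord_le a b \/ ord_lt b a.
Proof.
elim: a b => [b|a IH|f IH b]; first by left; exact: ord_le_zero.
- elim=> [|b _|f IHf].
  + by right; apply: ord_le_succ; exact: ord_le_zero.
  + by case: (IH b) => h; [left|right]; exact: ord_le_succ.
  + have [[n h]|nh] := pselect (exists n, ord_le (OSucc a) (f n)).
      by left; exact: ord_le_sup h.
    right; apply: ord_le_succ; apply: ord_le_lub => n.
    by case: (IHf n) => h; [case: nh; exists n|exact: ord_le_succ_inv].
- have [[n h]|nh] := pselect (exists n, ord_lt b (f n)).
    by right; exact: ord_le_sup h.
  by left; apply: ord_le_lub => n; case: (IH n b) => // h; case: nh; exists n.
Qed.

Lemma ord_lt_wf b : Acc ord_lt b.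
Proof.
suff h a : ord_lt a b -> Acc ord_lt a by constructor=> a; exact: h.
elim: b a => [|b IH|f IH] a H; first by inversion H.
- constructor=> c ca; apply: IH; apply: ord_le_trans ca _.
  exact: ord_le_succ_inv H.
- by have [n h] := ord_lt_lim_inv H; exact: IH h.
Qed.

(** Ordinals being well founded, any ordinal at which the derivatives vanish
    bounds the rank. *)
Lemma rank_le_of F eta : derivative F eta = set0 -> rank_le F eta.
Proof.
elim: {eta}(ord_lt_wf eta) => eta _ IH F0.
have [[theta th t0]|nh] := pselect (exists2 t, ord_lt t eta & derivative F t = set0).
  have [z [rz zt]] := IH _ th t0; exists z; split=> //.
  exact: ord_le_trans zt (ord_le_trans (ord_leS _) th).
exists eta; split; last exact: ord_le_refl.
split=> // t t0; case: (ord_le_total eta t) => // h.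
by case: nh; exists t.
Qed.

Lemma ord_le_addr a b : ord_le a (ord_add a b).
Proof.
elim: b => [|b IH|f IH] /=; first exact: ord_le_refl.
- exact: ord_le_trans IH (ord_leS _).
- exact: (@ord_le_sup _ _ 0%N).
Qed.

Lemma ord_add_pos a b : ord_lt OZero b -> ord_lt a (ord_add a b).
Proof.
elim: b => [|b IH|f IH] H /=; first by inversion H.
- by apply: ord_le_succ; exact: ord_le_addr.
- by have [n h] := ord_lt_lim_inv H; apply: (@ord_le_sup _ _ n); exact: IH.
Qed.

Lemma omega_exp_pos a : ord_lt OZero (omega_exp a).
Proof.
elim: a => [|a IH|f IH] /=; first exact: ord_le_refl.
- by apply: (@ord_le_sup _ _ 1%N) => /=; exact: ord_add_pos.
- by apply: (@ord_le_sup _ _ 0%N); exact: IH.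
Qed.

Lemma omega_exp_ge2 a : ord_lt OZero a -> ord_le (OSucc (OSucc OZero)) (omega_exp a).
Proof.
elim: a => [|a IH|f IH] H /=; first by inversion H.
- apply: (@ord_le_sup _ _ 2%N) => /=.
  have h : ord_lt OZero (ord_add OZero (omega_exp a)).
    by apply: ord_add_pos; exact: omega_exp_pos.
  by apply: ord_le_trans (ord_le_succ h) _; apply: ord_add_pos; exact: omega_exp_pos.
- by have [n h] := ord_lt_lim_inv H; apply: (@ord_le_sup _ _ n); exact: IH.
Qed.

(** * Compact families *)

Lemma nbhs_agree (p : cantor_space) c :
  nbhs p [set b : cantor_space | forall n, (n <= c)%N -> b n = p n].
Proof.
have h n : nbhs p [set b : cantor_space | b n = p n].
  have := @proj_continuous nat (fun=> bool) n p [set p n].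
  by apply; apply: open_nbhs_nbhs; split=> //; exact: discrete_open.
elim: c => [|c IH].
  by apply: filterS (h 0%N) => b bp n; rewrite leqn0 => /eqP ->.
apply: filterS2 (h c.+1) IH => b b1 b2 n.
by rewrite leq_eqVlt => /predU1P[->|/b2].
Qed.

(** The part of compactness on which everything below relies. *)
Definition exits (F : set (set nat)) : Prop :=
  forall E, infinite_set E -> exists c, ~ F (hd c E).

Lemma finite_bound (A : set nat) : finite_set A -> exists b, A `<=` `I_b.
Proof.
move=> fA; apply: contrapT => h; apply: (_ : infinite_set A) fA.
apply/infP => b; apply: contrapT => /forall2NP nb; apply: h; exists b.+1 => x Ax /=.
by case: (nb x) => // /negP; rewrite -leqNgt.
Qed.

Lemma hd_bound (A : set nat) b : A `<=` `I_b -> hd b A = A.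
Proof.
by move=> Ab; apply/seteqP; split=> [x []//|x Ax]; split=> //=; have /= := Ab x Ax; lia.
Qed.

(** The initial segments of an infinite set converge to it in the Cantor space,
    so they cannot all lie in a compact family of finite sets. *)
Lemma compact_exits F : F `<=` [set A | finite_set A] -> compact_family F ->
  exits F.
Proof.
move=> Ff Fc E iE; apply: contrapT => /forallNP h.
have {}h c : F (hd c E) by have := h c => /contrapT.
pose ind (A : set nat) : cantor_space := fun n => n \in A.
have [|p [[A FA <-] clp]] := Fc ((fun c => ind (hd c E)) @ \oo) _.
  by exists 0%N => // c _; exists (hd c E).
suff EA : E = A by apply: iE; rewrite EA; exact: Ff.
have key c : exists2 d, (c <= d)%N & forall n, (n <= c)%N -> (n \in hd d E) = (n \in A).
  have h1 : ((fun c => ind (hd c E)) @ \oo) [set ind (hd d E) | d in [set d | (c <= d)%N]].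
    by exists c => // d cd; exists d.
  by have [q [[d /= cd <-] hq]] := clp _ _ h1 (nbhs_agree (fun n => n \in A) c); exists d.
apply/seteqP; split=> x hx; have [d xd /(_ x (leqnn x)) e] := key x.
  by rewrite -in_setE -e in_setE.
by move: hx; rewrite -in_setE -e in_setE => -[].
Qed.

Lemma exits_compact F : F `<=` [set A | finite_set A] -> hereditary F ->
  exits F -> compact_family F.
Proof.
move=> Ff Fh Fe; apply: subclosed_compact cantor_space_compact _ => //.
move=> p clp; pose A := [set n | p n].
have hA c : F (hd c A).
  have [q [[B FB <-] hq]] := clp _ (nbhs_agree p c).
  apply: Fh FB _ => n [pn /= nc]; rewrite -in_setE.
  by rewrite (hq n nc); exact: pn.
have [iA|/contrapT fA] := pselect (infinite_set A).
  by have [c] := Fe A iA; case; exact: hA.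
have [b Ab] := finite_bound fA.
exists A; first by rewrite -(hd_bound Ab).
by apply/funext => n; apply/idP/idP; rewrite in_setE.
Qed.

(** * Sections of a family *)

Lemma spread_map F (f : nat -> nat) (A : set nat) :
  spreading F -> finite_set A ->
  (forall x y, A x -> A y -> (x < y)%N -> (f x < f y)%N) ->
  (forall x, A x -> (x <= f x)%N) -> F A -> F (f @` A).
Proof.
move=> sF /finite_seqP[s As] fh fge FA.
pose r := sort leq (undup s).
have rA x : (x \in r) = (x \in s) by rewrite mem_sort mem_undup.
have rs : sorted ltn r by rewrite ltn_sorted_uniq_leq sort_uniq undup_uniq sort_sorted//; exact: leq_total.
pose m (i : 'I_(size r)) := nth 0%N r i.
have Am i : A (m i) by rewrite As /= -rA mem_nth.
have mh : {homo m : i j / (i < j)%N}.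
  by move=> i j ij; apply: (sorted_ltn_nth ltn_trans 0%N rs); rewrite ?inE.
have rm : range m = A.
  apply/seteqP; split=> [_ [i _ <-]//|x]; rewrite As /= -rA => xr.
  have ir : (index x r < size r)%N by rewrite index_mem.
  by exists (Ordinal ir) => //; rewrite /m /= nth_index.
have -> : f @` A = range (f \o m) by rewrite -rm image_comp.
apply: (sF _ m) => //; last by rewrite rm.
  by move=> i j ij /=; apply: fh => //; exact: mh.
by move=> i; exact: fge.
Qed.

Definition section_at (F : set (set nat)) (p : nat) : set (set nat) :=
  [set E | set_before [set p] E /\ F ([set p] `|` E)].

Lemma section_regular F p : regular F -> regular (section_at F p).
Proof.
move=> [Ff sF hF cF].
have ff : section_at F p `<=` [set A | finite_set A].
  by move=> E [_ /Ff fE]; apply: sub_finite_set fE => x; right.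
have hh : hereditary (section_at F p).
  move=> A B [pA FA] BA; split; first by move=> i j pi /BA; exact: pA.
  by apply: hF FA _; exact: setUS.
split=> //; last first.
  apply: exits_compact => // E iE.
  have [|c nc] := compact_exits Ff cF (E := [set p] `|` tl p E).
    by apply: inf_sub (infinite_tl (c := p) iE) _ => x; right.
  exists (maxn c p) => -[pE FE]; apply: nc; apply: hF FE _ => x [[->|[Ex _]] /= xc].
    by left.
  by right; split=> //=; rewrite leq_max xc.
move=> t m l mh lh ml [pm Fm].
have minj i j : m i = m j -> i = j.
  move=> mij; apply/val_inj.
  by case: (ltngtP i j) => // /mh; rewrite mij ltnn.
have mle i j : (m i < m j)%N -> (i < j)%N.
  move=> mij; rewrite ltnNge leq_eqVlt; apply/negP => /predU1P[ij|/mh].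
    by move: mij; have -> : j = i by [exact: val_inj]; rewrite ltnn.
  by move=> /(ltn_trans mij); rewrite ltnn.
have /choice[g gm] : forall x, exists y, forall i, m i = x -> y = l i.
  move=> x.
  have [[i mi]|nx] := pselect (exists i, m i = x); last first.
    by exists 0%N => i mi; case: nx; exists i.
  by exists (l i) => j mj; congr l; apply: minj; rewrite mi mj.
have pl i : (p < l i)%N by apply: leq_trans (pm p (m i) erefl _) (ml i); exists i.
split; first by move=> _ _ -> [i _ <-]; exact: pl.
pose f x := if x == p then p else g x.
have fp : f p = p by rewrite /f eqxx.
have fm i : f (m i) = l i.
  rewrite /f; case: eqP => [e|_]; last exact: gm.
  by have : (p < m i)%N by [apply: pm => //; exists i]; rewrite e ltnn.
have -> : [set p] `|` range l = f @` ([set p] `|` range m).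
  apply/seteqP; split=> x.
    move=> [->|[i _ <-]]; first by exists p => //; left.
    by exists (m i); [right; exists i|].
  by move=> [y [->|[i _ <-]] <-]; [left; rewrite fp|right; exists i].
apply: spread_map => //; first exact: Ff Fm.
- move=> x y [->|[i _ <-]] [->|[j _ <-]]; rewrite ?fp ?fm ?ltnn//.
    by move=> h; have : (p < m i)%N by [apply: pm => //; exists i]; lia.
  by move=> /mle/lh.
- by move=> x [->|[i _ <-]]; rewrite ?fp ?fm.
Qed.

Lemma init_seg0 G : init_seg set0 G.
Proof. by split=> // x y []. Qed.

Lemma derivative_set0 F eta A : hereditary F -> derivative F eta A ->
  derivative F eta set0.
Proof.
move=> hF; elim: eta A => [|eta IH|f IH] A /=; first by move=> FA; apply: hF FA _.
- move=> [dA nA]; split; first exact: IH dA.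
  move=> [d0 h]; apply: nA; split=> // G dG AG.
  by rewrite (h G dG (init_seg0 G)) (h A dA (init_seg0 A)).
- by move=> h n _; apply: (IH n A); exact: h.
Qed.

Lemma derivative_section F p eta E : derivative (section_at F p) eta E ->
  set_before [set p] E /\ derivative F eta ([set p] `|` E).
Proof.
elim: eta E => [|eta IH|f IH] E /=; first by move=> [].
- move=> [dE nE]; have [pE dF] := IH E dE; split=> //; split=> //.
  move=> [_ h]; apply: nE; split=> // G dG [EG EG'].
  have [pG dG'] := IH G dG.
  have e : [set p] `|` G = [set p] `|` E.
    apply: h => //; split; first exact: setUS.
    move=> m n hn [->|Gm] mn; [by left|right].
    case: hn => [np|En]; last exact: EG' En Gm mn.
    by have := pG p m erefl Gm; move: mn; rewrite np; lia.
  apply/seteqP; split=> x hx.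
    have : ([set p] `|` E) x by rewrite -e; right.
    by case=> // xp; have := pG p x erefl hx; rewrite xp ltnn.
  by exact: EG.
- move=> h; split; first by have [] := IH 0%N E (h 0%N I).
  by move=> n _; have [] := IH n E (h n I).
Qed.

(** If the derivative of order [omega^xi] of the section at [p] had a member,
    that of [F] would have a nonempty one; then the empty set would not be
    maximal there and would survive one more derivation. *)
Lemma section_rank F xi p : hereditary F ->
  derivative F (OSucc (omega_exp xi)) = set0 ->
  rank_le (section_at F p) (omega_exp xi).
Proof.
move=> hF d0; apply: rank_le_of; apply/seteqP; split=> // E dE.
have [_ dA] := derivative_section dE.
have dz := derivative_set0 hF dA.
suff : derivative F (OSucc (omega_exp xi)) set0 by rewrite d0.
split=> // -[_ h]; have := h _ dA (init_seg0 _).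
by move/seteqP => [/(_ p) + _]; apply; left.
Qed.

(** * Inserting one point *)

Definition subsingletons : set (set nat) := [set A | exists n, A `<=` [set n]].

Lemma subsingletons_regular : regular subsingletons.
Proof.
have ff : subsingletons `<=` [set A | finite_set A].
  by move=> A [n An]; apply: sub_finite_set An _; exact: finite_set1.
have hh : hereditary subsingletons.
  by move=> A B [n An] BA; exists n => x /BA /An.
split=> //.
- move=> t m l mh _ _ [n mn].
  have [[i _]|ni] := pselect (exists i : 'I_t, True); last first.
    by exists 0%N; move=> x [i _ _]; case: ni; exists i.
  exists (l i) => _ [j _ <-] /=; congr l.
  have mi k : m k = n by apply: mn; exists k.
  by apply: val_inj; case: (ltngtP i j) => // /mh; rewrite !mi ltnn.
- apply: exits_compact => // E /infP iE.
  have [x Ex _] := iE 0%N; have [y Ey xy] := iE x.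
  exists y => -[n h]; have xn := h x; have yn := h y.
  move: (xy); rewrite (yn (conj Ey (leqnn y))) (xn (conj Ex (ltnW xy))).
  by rewrite ltnn.
Qed.

Lemma rank_le_trans F a b : rank_le F a -> ord_le a b -> rank_le F b.
Proof. by move=> [z [rz za]] ab; exists z; split=> //; exact: ord_le_trans ab. Qed.

(** This is where [0 < xi] is needed: the rank of the subsingletons is [2]. *)
Lemma subsingletons_rank xi : ord_lt OZero xi ->
  rank_le subsingletons (omega_exp xi).
Proof.
move=> /omega_exp_ge2; apply: rank_le_trans; apply: rank_le_of => /=.
have D1 A : (subsingletons `\` MAX subsingletons) A -> A = set0.
  move=> [[n An] nA]; apply/seteqP; split=> // x Ax; apply: nA.
  split; first by exists n.
  move=> G [m Gm] [AG _]; apply/seteqP; split=> // y Gy.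
  by have -> : y = x by rewrite (Gm y Gy) (Gm x (AG x Ax)).
apply/seteqP; split=> // A [dA nA]; apply: nA; split=> // G /D1 -> _.
by rewrite (D1 _ dA).
Qed.

(** A set of the form [{q} U h(A)], where [A] is in [F] and [h] moves its
    points to the right, has one point too many for [F] if [A] is maximal, but
    belongs to this enlargement ([plus_one_spread]), which is still negligible.  The
    inserted point [e] lies above some point of the set, so that it can be
    removed inside each section. *)
Definition plus_one (F : set (set nat)) : set (set nat) :=
  [set b | b = set0 \/ exists p e, [/\ b p, (p < e)%N & F (b `\ e)]].

Lemma plus_one_hd F c b : hereditary F -> plus_one F b -> plus_one F (hd c b).
Proof.
move=> hF [->|[p [e [bp pe Fb]]]]; first by left; rewrite /hd set0I.
have [[x [bx xc]]|n] := pselect (exists x, hd c b x); last first.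
  by left; apply/seteqP; split=> // x hx; case: n; exists x.
right; exists (minn p x), e; split; last by apply: hF Fb _ => y [[]].
- by case: (leqP p x) => px; split=> //=; move: xc => /=; lia.
- by rewrite gtn_min pe.
Qed.

(** Each inserted point [e] can repair only finitely many initial segments, by
    exit of [E] without [e]; and an [e] beyond the exit of [E] itself repairs
    nothing. *)
Lemma plus_one_exits F : hereditary F -> exits F -> exits (plus_one F).
Proof.
move=> hF eF E iE; apply: contrapT => /forallNP h.
have [c0 Ec0 _] := (infP E).1 iE 0%N.
have {}h c : (c0 <= c)%N -> exists e, F (hd c E `\ e).
  move=> c0c; have /contrapT [E0|[p [e [_ _ ?]]]] := h c; last by exists e.
  by have : hd c E c0 by []; rewrite E0.
have [[e he]|nhe] := pselect (exists e, forall d, exists2 c, (d <= c)%N & F (hd c E `\ e)).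
  have [|d nd] := eF (E `\ e).
    by apply: inf_sub (infinite_tl (c := e) iE) _ => x [Ex /= ex]; split=> // xe; move: ex; rewrite xe ltnn.
  have [c dc Fc] := he d; apply: nd; apply: hF Fc _ => x [[Ex xe] /= xd].
  by split=> //; split=> //=; exact: leq_trans dc.
have /choice[C hC] : forall e, exists d, forall c, (d <= c)%N -> ~ F (hd c E `\ e).
  move=> e; apply: contrapT => /forallNP ne; apply: nhe; exists e => d.
  by have /existsNP[c /not_implyP[dc /contrapT Fc]] := ne d; exists c.
have [d nd] := eF E iE.
pose c := maxn c0 (maxn d (\max_(e < d.+1) C e)).
have [|e Fe] := h c; first by rewrite leq_max leqnn.
have [ed|de] := leqP e d.
  apply: (hC e c) Fe; rewrite !leq_max; apply/orP; right; apply/orP; right.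
  by rewrite -ltnS in ed; exact: (leq_bigmax (Ordinal ed)).
apply: nd; apply: hF Fe _ => x [Ex /= xd]; split; last by move=> /= xe; move: xd; rewrite xe leqNgt de.
by split=> //=; rewrite !leq_max xd orbT.
Qed.

(** Removing [g x0] leaves the image of [A] under the map that sends the minimum
    [x0] to [q] instead, and this map still moves points to the right. *)
Lemma plus_one_spread F (A : set nat) q x0 (g : nat -> nat) :
  spreading F -> finite_set A -> F A -> A x0 -> (forall x, A x -> (x0 <= x)%N) ->
  (x0 <= q)%N -> (q < g x0)%N -> (forall x, A x -> (x <= g x)%N) ->
  (forall x y, A x -> A y -> (x < y)%N -> (g x < g y)%N) ->
  plus_one F ([set q] `|` g @` A).
Proof.
move=> sF fA FA A0 m0 x0q qg gge gh; right; exists q, (g x0); split=> //; first by left.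
pose f x := if x == x0 then q else g x.
have -> : ([set q] `|` g @` A) `\ g x0 = f @` A.
  apply/seteqP; split=> y.
    move=> [[->|[x Ax <-]] yx]; first by exists x0; rewrite // /f eqxx.
    by exists x; rewrite // /f; case: eqP => // xx; case: yx; rewrite xx.
  move=> [x Ax <-]; rewrite /f; case: eqP => [_|/eqP xx].
    by split; [left|move=> /= qq; move: qg; rewrite qq ltnn].
  split; first by right; exists x.
  have : (x0 < x)%N by rewrite ltn_neqAle eq_sym xx m0.
  by move=> /(gh _ _ A0 Ax) h /= e; move: h; rewrite e ltnn.
apply: spread_map => // [x y Ax Ay xy|x Ax]; rewrite /f.
  case: eqP => [xx|_]; case: eqP => [yy|_]; last exact: gh.
  - by move: xy; rewrite xx yy ltnn.
  - by apply: ltn_trans qg _; apply: gh => //; rewrite -xx.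
  - by have := m0 x Ax; rewrite -yy; move: xy; lia.
by case: eqP => [->//|_]; exact: gge.
Qed.

Section BlockSmall.
Variable R : realType.
Implicit Types (P Q : prob_block R).
Local Open Scope ereal_scope.

Lemma sufficient_small xi Q F : sufficient xi Q -> regular F ->
  rank_le F (omega_exp xi) -> forall eps : R, (0 < eps)%R ->
  forall M, infinite_set M -> exists2 M', inf_subsets M M' &
    forall N E, inf_subsets M' N -> F E -> block_meas Q N 0 E <= eps%:E.
Proof.
move=> sQ rF kF eps e0 M iM; have [M' MM' h] := sQ F rF kF M iM eps e0.
exists M' => // N E M'N FE; apply: le_trans h; apply: ereal_sup_ubound.
by exists N, E.
Qed.

(** Such an [E] is a member of a section of [block_fam P] together with one more
    point, so it is negligible as the union of two negligible sets. *)
Lemma plus_one_small xi P Q p : ord_lt OZero xi -> homogeneous xi P ->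
  sufficient xi Q -> forall eps : R, (0 < eps)%R ->
  forall M, infinite_set M -> exists2 M', inf_subsets M M' &
    forall N E, inf_subsets M' N -> set_before [set p] E ->
      plus_one (block_fam P) ([set p] `|` E) -> block_meas Q N 0 E <= eps%:E.
Proof.
move=> xi0 [_ [d0 _]] sQ eps e0 M iM.
have [rP _ _] := block_nice P; have [_ _ hP _] := rP.
have e2 : (0 < eps / 2)%R by rewrite divr_gt0.
have [M1 MM1 h1] := sufficient_small sQ (section_regular p rP) (section_rank p hP d0) e2 iM.
have [M2 MM2 h2] := sufficient_small sQ subsingletons_regular (subsingletons_rank xi0) e2 MM1.2.
exists M2; first exact: inf_subsets_trans MM2.
move=> N E M2N pE [/seteqP[/(_ p) h _]|[x [e [bx xe Fe]]]]; first by case: h; left.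
have pe : (p < e)%N.
  by case: bx => [xp|Ex]; [rewrite -xp|have := pE p x erefl Ex; move: xe; lia].
have -> : eps%:E = (eps / 2)%:E + (eps / 2)%:E by rewrite -EFinD -splitr.
apply: (@le_trans _ _ (block_meas Q N 0 (E `\ e) + block_meas Q N 0 [set e])).
  apply: le_trans (measureU2 _ _ _) => //; apply: le_measure; rewrite ?inE//.
  by move=> y Ey; have [->|/eqP ye] := eqVneq y e; [right|left].
apply: leeD.
  apply: h1; first exact: inf_subsets_trans M2N.
  split; first by move=> i j ip [Ej _]; exact: pE.
  apply: hP Fe _ => y [->|[Ey ye]]; split; [by left| |by right|by []].
  by move=> /= ep; move: pe; rewrite ep ltnn.
by apply: h2 => //; exists e.
Qed.

End BlockSmall.

(** * The blocks of a set relative to a family *)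

Section Cutting.
Variable F : set (set nat).

(** The blocks of [E] are obtained by repeatedly splitting off the shortest
    initial segment that is not in [F].  The default value of [cut] concerns
    sets that never leave [F]. *)
Definition cut (E : set nat) : nat :=
  if pselect (exists c, ~ F (hd c E)) is left h then sval (cid2 (ex_least h))
  else 0%N.

Definition rest (E : set nat) (i : nat) : set nat :=
  iter i (fun E => tl (cut E) E) E.

Definition blk (E : set nat) (i : nat) : set nat :=
  hd (cut (rest E i)) (rest E i).

Hypothesis F0 : F set0.
Hypothesis Fexits : exits F.

Lemma cut_spec E : (exists c, ~ F (hd c E)) ->
  ~ F (hd (cut E) E) /\ forall c, ~ F (hd c E) -> (cut E <= c)%N.
Proof. by rewrite /cut; case: pselect => // h _; case: cid2. Qed.

Lemma cut_lt E c : (c < cut E)%N -> F (hd c E).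
Proof.
move=> cE; apply: contrapT => nF.
have [_ /(_ c nF)] := @cut_spec E (ex_intro _ c nF).
by rewrite leqNgt cE.
Qed.

Lemma cutP E : infinite_set E ->
  ~ F (hd (cut E) E) /\ forall c, (c < cut E)%N -> F (hd c E).
Proof.
move=> iE; have [h _] := cut_spec (Fexits iE).
by split=> // c; exact: cut_lt.
Qed.

Lemma cut_uniq E d : ~ F (hd d E) -> (forall c, (c < d)%N -> F (hd c E)) ->
  cut E = d.
Proof.
move=> nd hd'; rewrite /cut; case: pselect => [h|n]; last by case: n; exists d.
case: cid2 => m Fm hm /=; apply/eqP; rewrite eqn_leq hm //= leqNgt.
by apply/negP => /hd'.
Qed.

Lemma inf_rest E i : infinite_set E -> infinite_set (rest E i).
Proof. by move=> iE; elim: i => //= i IH; exact: infinite_tl. Qed.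

Lemma hd_agree c c' (E E' : set nat) : (forall n, (n <= c)%N -> E n <-> E' n) ->
  (c' <= c)%N -> hd c' E = hd c' E'.
Proof.
move=> ag cc; apply/seteqP; split=> x [Ex /= xc]; split=> //;
  by have [? ?] := ag x (leq_trans xc cc); auto.
Qed.

Lemma rest_agree c n E E' : infinite_set E ->
  (forall n, (n <= c)%N -> E n <-> E' n) ->
  (forall i, (i < n)%N -> (cut (rest E i) <= c)%N) ->
  (forall i, (i <= n)%N -> forall m, (m <= c)%N -> rest E i m <-> rest E' i m) /\
  (forall i, (i < n)%N -> cut (rest E' i) = cut (rest E i) /\ blk E' i = blk E i).
Proof.
move=> iE ag cn.
have key i : (i <= n)%N ->
    (forall m, (m <= c)%N -> rest E i m <-> rest E' i m) /\
    ((i < n)%N -> cut (rest E' i) = cut (rest E i) /\ blk E' i = blk E i).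
  have step j : (forall m, (m <= c)%N -> rest E j m <-> rest E' j m) ->
      (j < n)%N -> cut (rest E' j) = cut (rest E j) /\ blk E' j = blk E j.
    move=> agj jn; have [nF hF] := cutP (inf_rest (i := j) iE).
    have e : cut (rest E' j) = cut (rest E j).
      apply: cut_uniq => [|d dc]; rewrite -(hd_agree agj) ?cn //.
        exact: hF.
      exact: leq_trans (ltnW dc) (cn j jn).
    by split=> //; rewrite /blk e (hd_agree agj) // cn.
  elim: i => [|i IH] iN; first by split=> // h; exact: step.
  have [agi /(_ iN)[ci _]] := IH (ltnW iN).
  have h : forall m, (m <= c)%N -> rest E i.+1 m <-> rest E' i.+1 m.
    move=> m mc /=; rewrite ci /tl; have [? ?] := agi m mc.
    by split=> -[? ?]; split; auto.
  by split=> //; exact: step.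
by split=> i iN; have := key i; case; auto; exact: ltnW.
Qed.

(** A block is recognised by its own points: what follows it has no influence
    on where the first exit from [F] takes place. *)
Lemma blocks_of (b : nat -> set nat) (d : nat -> nat) :
  (forall i, ~ F (b i)) -> (forall i c, (c < d i)%N -> F (hd c (b i))) ->
  (forall i x, b i x -> (x <= d i)%N) -> (forall i x, b i.+1 x -> (d i < x)%N) ->
  let E := \bigcup_i b i in
  infinite_set E /\ forall i, cut (rest E i) = d i /\ blk E i = b i.
Proof.
move=> nF hF bd db E.
have dS i : (d i < d i.+1)%N.
  have [[x bx]|n] := pselect (exists x, b i.+1 x).
    exact: leq_trans (db _ _ bx) (bd _ _ bx).
  case: (nF i.+1); suff -> : b i.+1 = set0 by [].
  by apply/seteqP; split=> // x bx; case: n; exists x.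
have dm i j : (i <= j)%N -> (d i <= d j)%N.
  move=> /subnK <-; elim: (j - i)%N => // k IH; exact: leq_trans IH (ltnW (dS _)).
have dbj i j x : (i < j)%N -> b j x -> (d i < x)%N.
  by case: j => // j ij bx; apply: leq_ltn_trans (dm i j ij) (db _ _ bx).
have bne i : exists x, b i x.
  apply: contrapT => n; apply: (nF i); suff -> : b i = set0 by [].
  by apply/seteqP; split=> // x bx; case: n; exists x.
have dge i : (i <= d i)%N.
  by elim: i => // i IH; exact: leq_ltn_trans IH (dS i).
have first i : rest E i = \bigcup_(j in [set j | (i <= j)%N]) b j ->
    cut (rest E i) = d i /\ blk E i = b i.
  move=> re; have hdE c : (c <= d i)%N -> hd c (rest E i) = hd c (b i).
    move=> cd; rewrite re; apply/seteqP; split=> x.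
      move=> [[j /= ij bx] /= xc]; split=> //.
      move: ij; rewrite leq_eqVlt => /predU1P[->//|ij].
      by have := dbj _ _ _ ij bx; rewrite ltnNge (leq_trans xc cd).
    by move=> [bx xc]; split=> //; exists i => /=.
  have hb : hd (d i) (b i) = b i.
    by apply/seteqP; split=> [x []//|x bx]; split=> //=; exact: bd.
  have ci : cut (rest E i) = d i.
    apply: cut_uniq => [|c cd]; rewrite hdE //; first by rewrite hb.
      exact: hF.
    exact: ltnW.
  by split=> //; rewrite /blk ci hdE // hb.
have key i : rest E i = \bigcup_(j in [set j | (i <= j)%N]) b j.
  elim: i => [|i IH] /=.
    by apply/seteqP; split=> x [j _ bx]; exists j.
  have [-> _] := first i IH; rewrite IH; apply/seteqP; split=> x.
    move=> [[j /= ij bx] /= dx]; exists j => //=.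
    by move: ij; rewrite leq_eqVlt => /predU1P[ij|//]; move: dx; rewrite ltnNge bd // ij.
  by move=> [j /= ij bx]; split; [exists j => //=; exact: ltnW|exact: dbj bx].
split; last by move=> i; exact: first.
apply/infP => c; have [x bx] := bne c.+1; exists x; first by exists c.+1.
exact: leq_ltn_trans (dge c) (db _ _ bx).
Qed.

Lemma blk_sub E i : blk E i `<=` E.
Proof.
move=> x [+ _]; elim: i => //= i IH [+ _]; exact: IH.
Qed.

End Cutting.

(** The minimum of a block serves as a marker, at which nothing is known about
    the functionals considered below. *)
Definition above_min (b : set nat) : set nat :=
  [set x | b x /\ exists2 y, b y & (y < x)%N].

(** * Supports in a probability block *)

Section BlockStructure.
Variables (R : realType) (Q : prob_block R).
Local Notation q := (block_meas Q).

Lemma supp_finite N i : infinite_set N -> finite_set (supp (q N i)).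
Proof.
move=> iN; have [_ mx _] := block_partition Q iN.
by have [[h _ _ _] _ _] := block_nice Q; apply: h; have [] := mx i.
Qed.

Lemma supp_neq0 N i : infinite_set N -> exists x, supp (q N i) x.
Proof.
move=> iN; have [_ mx _] := block_partition Q iN.
apply: contrapT => n; have e : supp (q N i) = set0.
  by apply/seteqP; split=> // x sx; case: n; exists x.
have [_ /(_ [set 0%N])] := mx i; rewrite e.
have [_ s1 _] := block_nice Q => /(_ (s1 0%N) (init_seg0 _)).
by move=> /seteqP[/(_ 0%N) + _]; apply.
Qed.

Lemma supp_sub N i : infinite_set N -> supp (q N i) `<=` N.
Proof.
by move=> iN x sx; have [<- _ _] := block_partition Q iN; exists i.
Qed.

Lemma supp_fam N i : infinite_set N -> block_fam Q (supp (q N i)).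
Proof. by move=> iN; have [_ mx _] := block_partition Q iN; have [] := mx i. Qed.

Lemma supp_lt N i j : infinite_set N -> (i < j)%N ->
  set_before (supp (q N i)) (supp (q N j)).
Proof.
move=> iN; have [_ _ nx] := block_partition Q iN.
elim: j => // j IH; rewrite ltnS leq_eqVlt => /predU1P[->|ij]; first exact: nx.
move=> x y sx sy; have [z sz] := supp_neq0 j iN.
exact: ltn_trans (IH ij x z sx sz) (nx _ _ _ sz sy).
Qed.

Lemma supp_ge N i x : infinite_set N -> supp (q N i) x -> (i <= x)%N.
Proof.
move=> iN; elim: i x => // i IH x sx; have [z sz] := supp_neq0 i iN.
exact: leq_ltn_trans (IH z sz) (supp_lt iN (ltnSn i) sz sx).
Qed.

Lemma supp_eq N N' i j : q N i =1 q N' j -> supp (q N i) = supp (q N' j).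
Proof. by move=> e; apply/seteqP; split=> x; rewrite /supp /= e. Qed.

Lemma supp_cover N x : infinite_set N -> N x -> exists i, supp (q N i) x.
Proof.
move=> iN; have [e _ _] := block_partition Q iN.
by rewrite -{1}e => -[i _ sx]; exists i.
Qed.

Definition remainder (N : set nat) (i : nat) : set nat :=
  N `\` \bigcup_(j in `I_i) supp (q N j).

Lemma remainderP N i x : infinite_set N ->
  remainder N i x <-> exists2 j, (i <= j)%N & supp (q N j) x.
Proof.
move=> iN; split=> [[Nx nx]|[j ij sx]].
  have [j sx] := supp_cover iN Nx; exists j => //; rewrite leqNgt.
  by apply/negP => ji; apply: nx; exists j.
split; first exact: supp_sub sx.
move=> [k /= ki kx]; have := supp_lt iN (leq_trans ki ij) kx sx.
by rewrite ltnn.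
Qed.

Lemma inf_remainder N i : infinite_set N -> infinite_set (remainder N i).
Proof.
move=> iN; apply/infP => c; have [x sx] := supp_neq0 (maxn i c.+1) iN.
exists x; first by apply/remainderP => //; exists (maxn i c.+1) => //; exact: leq_maxl.
by apply: leq_trans (supp_ge iN sx); exact: leq_maxr.
Qed.

Lemma finite_proper (A B : set nat) : finite_set A -> infinite_set B ->
  init_seg A B -> proper_init_seg A B.
Proof. by move=> fA iB AB; split=> // e; apply: iB; rewrite -e. Qed.

(** The measures of a block are all first measures, of the sets left after the
    previous supports. *)
Lemma block_restart N i : infinite_set N -> q (remainder N i) 0 =1 q N i.
Proof.
move=> iN; apply: block_shift => //; first exact: inf_remainder.
apply: finite_proper; [exact: supp_finite|exact: inf_remainder|split].
  by move=> x sx; apply/remainderP => //; exists i.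
move=> m n sn /remainderP -/(_ iN)[j ij sm] mn.
move: ij; rewrite leq_eqVlt => /predU1P[->//|ij].
by have := supp_lt iN ij sn sm; rewrite ltnNge mn.
Qed.

(** By induction the previous supports agree, hence so do the beginnings of the
    remainders, and the first measure of a set only depends on an initial
    segment. *)
Lemma block_local N N' c n : infinite_set N -> infinite_set N' ->
  (forall m, (m <= c)%N -> N m <-> N' m) ->
  (forall i x, (i < n)%N -> supp (q N i) x -> (x <= c)%N) ->
  forall i, (i < n)%N -> q N' i =1 q N i.
Proof.
move=> iN iN' ag sc; elim/ltn_ind => i IH iN_.
have se j : (j < i)%N -> supp (q N' j) = supp (q N j).
  by move=> ji; apply: supp_eq; apply: IH => //; exact: ltn_trans iN_.
move=> A; rewrite -(block_restart i iN') -/(q _ _).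
apply: block_shift => //; first exact: inf_remainder.
apply: finite_proper; [exact: supp_finite|exact: inf_remainder|split].
  move=> x sx; split; first by apply/ag; [exact: sc sx|exact: supp_sub sx].
  move=> [j /= ji]; rewrite se // => sj.
  by have := supp_lt iN ji sj sx; rewrite ltnn.
move=> m k sk [N'm nm] mk; have mc : (m <= c)%N := leq_trans mk (sc _ _ iN_ sk).
have Nm : N m by apply/ag.
have [j sj] := supp_cover iN Nm.
have [ji|ij] := ltnP j i; first by case: nm; exists j => //=; rewrite se.
move: ij; rewrite leq_eqVlt => /predU1P[->//|ij].
by have := supp_lt iN ij sk sj; rewrite ltnNge mk.
Qed.

(** Successive first supports of unrelated sets may be glued: each of them is an
    initial segment of what remains of the union. *)
Lemma block_concat (M : nat -> set nat) : (forall i, infinite_set (M i)) ->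
  (forall i, set_before (supp (q (M i) 0)) (supp (q (M i.+1) 0))) ->
  let N := \bigcup_i supp (q (M i) 0) in
  infinite_set N /\ forall i, q N i =1 q (M i) 0.
Proof.
move=> iM nx N; pose G i := supp (q (M i) 0).
have Gne i : exists x, G i x by exact: supp_neq0.
have Glt i j : (i < j)%N -> set_before (G i) (G j).
  elim: j => // j IH; rewrite ltnS leq_eqVlt => /predU1P[->|ij]; first exact: nx.
  move=> x y sx sy; have [z sz] := Gne j.
  exact: ltn_trans (IH ij x z sx sz) (nx _ _ _ sz sy).
have Gge i x : G i x -> (i <= x)%N.
  elim: i x => // i IH x sx; have [z sz] := Gne i.
  exact: leq_ltn_trans (IH z sz) (Glt _ _ (ltnSn i) _ _ sz sx).
have iN : infinite_set N.
  apply/infP => c; have [x sx] := Gne c.+1; exists x; first by exists c.+1.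
  exact: Gge sx.
split=> //; elim/ltn_ind => i IH A.
have se j : (j < i)%N -> supp (q N j) = G j by move=> ji; apply: supp_eq; exact: IH.
rewrite -(block_restart i iN); apply: block_shift => //; first exact: inf_remainder.
apply: finite_proper; [exact: supp_finite|exact: inf_remainder|split].
  move=> x sx; split; first by exists i.
  by move=> [j /= ji]; rewrite se // => sj; have := Glt _ _ ji _ _ sj sx; rewrite ltnn.
move=> m k sk [[j _ sj] nm] mk.
have [ji|ij] := ltnP j i; first by case: nm; exists j => //=; rewrite se.
move: ij; rewrite leq_eqVlt => /predU1P[->//|ij].
by have := Glt _ _ ij _ _ sk sj; rewrite ltnNge mk.
Qed.

End BlockStructure.

Lemma nat_measure_supp (R : realType) (p : probability nat R) :
  p (supp p) = 1%E.
Proof.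
have z : p (~` supp p) = 0%E.
  have -> : ~` supp p = \bigcup_(i in ~` supp p) [set i].
    by apply/seteqP; split=> [x nx|x [y ny ->]//]; exists x.
  rewrite measure_bigcup //=; last first.
    by apply/trivIsetP => i j _ _ ij; apply/seteqP; split=> // x [-> ji]; move: ij; rewrite ji eqxx.
  by rewrite eseries0 // => i _; rewrite inE => /= /negP /negPn /eqP.
have := @probability_setT _ _ _ p; rewrite -(setvU (supp p)) measureU //=; last by rewrite setICl.
by rewrite [X in (X + _)%E]z add0e.
Qed.

(** * Functionals attached to the blocks of every subset *)

(** [Wit n Es u] abstracts from the analytic content: it says that [u] testifies
    to a failure of domination through its values on [Es 0], ..., [Es n.-1]. *)
Section Witnesses.
Variables (U : Type) (Wit : nat -> (nat -> set nat) -> U -> Prop).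
Hypothesis WitS : forall n Es Es' u,
  (forall i, (i < n)%N -> Es' i `<=` Es i) -> Wit n Es u -> Wit n Es' u.

Definition witnessed (F : set (set nat)) (n : nat) (E : set nat) (u : U) : Prop :=
  Wit n (fun i => above_min (blk F E i)) u.

Section Family.
Variable F : set (set nat).
Hypothesis Fexits : exits F.

Lemma witnessed_local n E : infinite_set E -> exists c, forall E',
  (forall m, (m <= c)%N -> E m <-> E' m) ->
  forall n' u, (n' <= n)%N -> witnessed F n' E' u <-> witnessed F n' E u.
Proof.
move=> iE; exists (\max_(i < n) cut F (rest F E i)) => E' ag n' u n'n.
have [|_ h] := rest_agree Fexits (n := n) iE ag.
  by move=> i iN; exact: (leq_bigmax (Ordinal iN)).
have e i : (i < n')%N -> blk F E' i = blk F E i.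
  by move=> iN; have [] := h i (leq_trans iN n'n).
by split; apply: WitS => i iN; rewrite e.
Qed.

(** A witness only concerns finitely many blocks. *)
Lemma witnessed_open : open_family [set E | exists n u, witnessed F n E u].
Proof.
move=> E iE [n [u w]]; have [c h] := witnessed_local n iE.
by exists c => E' _ ag; exists n, u; apply/(h E' ag).
Qed.

End Family.

Section Thinning.
Variables (R : realType) (Q : prob_block R) (G : set (set nat)).
Variables (lam : nat -> nat) (eps : nat -> R).
Local Notation q := (block_meas Q).
Local Notation F := [set b : set nat | G (lam @` b)].
Hypothesis lam_lt : forall x y, (x < y)%N -> (lam x < lam y)%N.
Hypothesis G0 : G set0.
Hypothesis Ghd : forall c b, G b -> G (hd c b).
Hypothesis Gexits : exits G.
Hypothesis eps01 : forall i, (0 < eps i < 1)%R.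
Hypothesis Gsmall : forall p (e : R), (0 < e)%R -> forall M, infinite_set M ->
  exists2 M', inf_subsets M M' & forall N E, inf_subsets M' N ->
    set_before [set p] E -> G ([set p] `|` E) -> (q N 0 E <= e%:E)%E.
Hypothesis big_witness : forall N, inf_subsets (range lam) N ->
  exists n u (Es : nat -> set nat),
    (forall i, (i < n)%N -> Es i `<=` supp (q N i) /\ ~ (q N i (Es i) <= (eps i)%:E)%E)
    /\ Wit n (fun i => lam @^-1` Es i) u.

Lemma lam_ge x : (x <= lam x)%N.
Proof. by elim: x => // x IH; exact: leq_ltn_trans IH (lam_lt (ltnSn x)). Qed.

Lemma lam_le x y : (x <= y)%N -> (lam x <= lam y)%N.
Proof. by rewrite leq_eqVlt => /predU1P[->//|/lam_lt/ltnW]. Qed.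

Lemma lam_inj x y : lam x = lam y -> x = y.
Proof. by case: (ltngtP x y) => // /lam_lt + e; rewrite e ltnn. Qed.

Lemma inf_image E : infinite_set E -> infinite_set (lam @` E).
Proof.
move=> /infP iE; apply/infP => b; have [x Ex bx] := iE b.
by exists (lam x); [exists x | exact: leq_trans bx (lam_ge x)].
Qed.

Lemma pull0 : F set0. Proof. by rewrite /= image_set0. Qed.

Lemma hd_image c b : lam @` (hd c b) = hd (lam c) (lam @` b).
Proof.
apply/seteqP; split=> y.
  by move=> [x [bx xc] <-]; split; [exists x|exact: lam_le].
move=> [[x bx <-] /= xc]; exists x => //; split=> //=.
by rewrite leqNgt; apply/negP => /lam_lt; rewrite ltnNge xc.
Qed.

Lemma pull_hd c b : F b -> F (hd c b).
Proof. by rewrite /= hd_image; exact: Ghd. Qed.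

Lemma pull_exits : exits F.
Proof.
move=> E iE; have [c nc] := Gexits (inf_image iE); exists c => Fc; apply: nc.
suff -> : hd c (lam @` E) = hd c (lam @` hd c E) by exact: Ghd.
apply/seteqP; split=> y.
  move=> [[x Ex <-] /= xc]; split=> //; exists x => //; split=> //=.
  exact: leq_trans (lam_ge x) xc.
by move=> [[x [Ex _] <-] yc]; split=> //; exists x.
Qed.

(** Otherwise, by Ramsey's theorem, no infinite subset of some [T] is witnessed.
    Choose in turn a marker [p i] in [T] and then a first support of [Q] in a set
    so thin that the section of [G] at [p i] is small.  The supports form one set
    [N], and the large pieces [Es i] given by [big_witness] overflow the sections
    at the markers.  So [p i] together with [Es i] contains a block, and these
    are the blocks of an infinite subset of [T], which is then witnessed by the
    same functional. *)
Lemma thin_witnessed L : infinite_set L -> exists2 T, inf_subsets L T &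
  forall E, inf_subsets T E -> exists n u, witnessed F n E u.
Proof.
move=> iL; have [T LT [h|nw]] := open_Ramsey (witnessed_open pull_exits) iL.
  by exists T.
exfalso; have iT := LT.2.
have step (ib : nat * nat) : exists s : nat * set nat * nat,
    [/\ T s.1.1, (ib.2 < s.1.1)%N,
      inf_subsets (lam @` (tl s.1.1 T)) s.1.2,
      forall E, set_before [set lam s.1.1] E -> G ([set lam s.1.1] `|` E) ->
        (q s.1.2 0 E <= (eps ib.1)%:E)%E
    & (s.1.1 <= s.2)%N /\ forall x, supp (q s.1.2 0) x -> (x <= s.2)%N].
  have [p Tp bp] := (infP T).1 iT ib.2.
  have /andP[e0 _] := eps01 ib.1.
  have [M MT hM] := @Gsmall (lam p) _ e0 _ (inf_image (infinite_tl (c := p) iT)).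
  have [b hb] := finite_bound (@supp_finite R Q M 0 MT.2).
  exists (p, M, maxn p b); split=> //=; first by move=> E; apply: hM; exact: inf_subsetsxx MT.2.
  by split; rewrite ?leq_maxl // => x /hb /= xb; rewrite leq_max (ltnW xb) orbT.
have [f fP] := choice step.
pose b := fix b i := if i is j.+1 then (f (j, b j)).2 else 0%N.
pose p i := (f (i, b i)).1.1.
pose M i := (f (i, b i)).1.2.
have Tp i : T (p i) by have [] := fP (i, b i).
have bp i : (b i < p i)%N by have [] := fP (i, b i).
have MT i : inf_subsets (lam @` (tl (p i) T)) (M i) by have [] := fP (i, b i).
have small i E : set_before [set lam (p i)] E -> G ([set lam (p i)] `|` E) ->
  (q (M i) 0 E <= (eps i)%:E)%E by have [_ _ _ h _] := fP (i, b i); exact: h.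
have pb i : (p i <= b i.+1)%N by have [_ _ _ _ []] := fP (i, b i).
have sb i x : supp (q (M i) 0) x -> (x <= b i.+1)%N.
  by have [_ _ _ _ [_ h]] := fP (i, b i); exact: h.
have sT i x : supp (q (M i) 0) x -> exists y, [/\ T y, (p i < y)%N & lam y = x].
  by move=> /(supp_sub (MT i).2)/(MT i).1[y [Ty py] <-]; exists y.
have [|iN qN] := block_concat (Q := Q) (fun i => (MT i).2).
  move=> i x y /sb xb /sT[z [_ pz <-]].
  apply: leq_ltn_trans xb _; apply: leq_trans (lam_ge z).
  exact: ltn_trans (bp _) pz.
set N := \bigcup_i _ in iN qN.
have [|n [u [Es [big w]]]] := big_witness (N := N).
  by split=> // x [i _ /sT[y [_ _ <-]]]; exists y.
(* the whole supports serve as fillers beyond the [n] pieces that matter *)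
pose Es' i := if (i < n)%N then Es i else supp (q (M i) 0).
have Es's i : Es' i `<=` supp (q (M i) 0).
  rewrite /Es'; case: ltnP => iN_; last by [].
  have [+ _] := big i iN_.
  by rewrite (supp_eq (qN i)).
have nsm i : ~ (q (M i) 0 (Es' i) <= (eps i)%:E)%E.
  rewrite /Es'; case: ltnP => iN_; first by have [_] := big i iN_; rewrite qN.
  rewrite nat_measure_supp lee_fin; apply/negP; rewrite -ltNge.
  by have /andP[] := eps01 i.
pose X i := lam @^-1` Es' i.
have XT i x : X i x -> [/\ T x, (p i < x)%N & (x <= b i.+1)%N].
  move=> Xx; have sx := Es's i _ Xx; have [y [Ty py /lam_inj e]] := sT i _ sx.
  by rewrite -e; split=> //; apply: leq_trans (lam_ge y) _; rewrite e; exact: sb.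
pose c0 i := [set p i] `|` X i.
have nF i : ~ F (c0 i).
  rewrite /= image_setU image_set1.
  have -> : lam @` X i = Es' i.
    apply/seteqP; split=> [_ [x Xx <-]//|y Ey].
    by have [x [_ _ e]] := sT i y (Es's i y Ey); exists x; rewrite // /X /= e.
  move=> Gi; apply: (nsm i); apply: small Gi.
  by move=> _ y -> /(Es's i)/sT[x [_ px <-]]; exact: lam_lt.
have hc0 i : hd (b i.+1) (c0 i) = c0 i.
  apply/seteqP; split=> [x []//|x cx]; split=> //=.
  by case: cx => [->|/XT[]].
pose d i := cut F (c0 i).
have [nFd dle] : (forall i, ~ F (hd (d i) (c0 i))) /\ forall i, (d i <= b i.+1)%N.
  suff h i : ~ F (hd (d i) (c0 i)) /\ (d i <= b i.+1)%N by split=> i; have [] := h i.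
  have nFb : ~ F (hd (b i.+1) (c0 i)) by rewrite hc0.
  have [|h1 h2] := @cut_spec F (c0 i); first by exists (b i.+1).
  by split=> //; exact: h2.
pose e i := hd (d i) (c0 i).
have ege i x : e i x -> (p i <= x)%N.
  by move=> [[->//|/XT[_ px _]] _]; exact: ltnW.
have hde i c : (c < d i)%N -> hd c (e i) = hd c (c0 i).
  move=> cd; apply/seteqP; split=> x [ex /= xc]; split=> //; first by case: ex.
  by split=> //=; exact: leq_trans (ltnW cd).
have [|||iE bE] := @blocks_of F pull0 e d nFd.
- by move=> i c cd; rewrite hde //; exact: cut_lt cd.
- by move=> i x [].
- move=> i x /ege px; apply: leq_ltn_trans (dle i) _.
  exact: leq_trans (bp _) px.
apply: (nw (\bigcup_i e i)).
  by split=> // x [i _ [[->|/XT[]//]]].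
exists n, u; apply: WitS w => i iN_ x; have [_ ->] := bE i.
move=> [ex [y ey yx]].
case: (ex) => [[xp|Xx] _]; first by move: yx; rewrite xp ltnNge ege.
by move: Xx; rewrite /X /= /Es' iN_.
Qed.

End Thinning.

(** * Smallness outside the set *)

Section Elton.
Variables (F : set (set nat)) (sm : U -> nat -> nat -> Prop).
Hypothesis Fexits : exits F.
Hypothesis smS : forall u b b' m, sm u b m -> (b' <= b)%N -> sm u b' m.
Hypothesis gap : forall b S, infinite_set S -> exists c, forall u,
  exists2 g, S g /\ (g <= c)%N & sm u b g.

(** Minimality of [n] makes the number of blocks involved depend on [E] alone, so
    that the end of the last block is known before the witness is. *)
Definition small_witness (E s : set nat) : Prop := exists n u,
  [/\ forall n' u', (n' < n)%N -> ~ witnessed F n' E u', witnessed F n E u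
    & forall m b, s m -> ~ E m -> s b -> (b < m)%N -> sm u b m].

Lemma small_witness_local E s : infinite_set E -> small_witness E s ->
  exists c, forall E', (forall m, (m <= c)%N -> E m <-> E' m) ->
  forall s', (forall m, s' m -> ~ E' m -> ~ E m /\ s m) -> (s' `<=` s) ->
  small_witness E' s'.
Proof.
move=> iE [n [u [mn w smu]]]; have [c h] := witnessed_local Fexits n iE.
exists c => E' ag s' ss' s's; exists n, u; split.
- by move=> n' u' n'n /(h E' ag _ _ (ltnW n'n)); exact: mn.
- by apply/(h E' ag).
- move=> m b sm' nE' sb bm; have [nE s1] := ss' _ sm' nE'.
  exact: smu s1 nE (s's _ sb) bm.
Qed.

(** Elton's device: either no continuation of [D] has a witness that is small on
    [s], or, whenever the next point [t] is left out, one can be found that is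
    small at [t] too.  By Ramsey's theorem the only other case is that the
    continuations of [D] have witnesses, but never one that is small at the
    omitted point.  Then a witness for a continuation that starts beyond the
    bound [c] given by [gap] is small at none of the points before [c], against
    the choice of [c]. *)
Lemma small_witness_next b s D M0 : s `<=` `I_b.+1 -> D `<=` `I_b.+1 ->
  infinite_set M0 -> exists2 M', inf_subsets M0 M' &
  (forall N, inf_subsets M' N -> ~ small_witness (D `|` N) s) \/
  (forall t N, M' t -> inf_subsets (tl t M') N ->
     small_witness (D `|` N) (s `|` [set t])).
Proof.
move=> sb Db iM0.
have [M MM0 Mb] : exists2 M, inf_subsets M0 M & forall x, M x -> (b < x)%N.
  by exists (tl b M0); [exact: inf_subsets_tl | move=> x []].
have iM := MM0.2.
have agU E1 E2 c : (forall m, (m <= c)%N -> E1 m <-> E2 m) ->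
    forall m, (m <= c)%N -> (D `|` E1) m <-> (D `|` E2) m.
  by move=> ag m mc; have [? ?] := ag m mc; split=> -[?|?]; [left|right|left|right]; auto.
have infU N : infinite_set N -> infinite_set (D `|` N).
  by move=> iN; apply: inf_sub iN _ => x; right.
pose U1 := [set N | small_witness (D `|` N) s].
have oU1 : open_family U1.
  move=> N iN w; have [c h] := small_witness_local (infU _ iN) w.
  exists (maxn b c) => N' iN' ag; apply: h => [|m sm' nE|//].
    by apply: agU => m mc; apply: ag; rewrite leq_max mc orbT.
  split=> // -[Dm|Nm]; apply: nE; [by left|right].
  by apply/ag => //; rewrite leq_max; have /= := sb _ sm'; rewrite ltnS => ->.
have [M1 MM1 [all1|none1]] := open_Ramsey oU1 iM; last first.
  by exists M1; [exact: inf_subsets_trans MM0 MM1|left].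
pose U2 := [set N | exists t, [/\ N t, forall x, N x -> (t <= x)%N
  & small_witness (D `|` tl t N) (s `|` [set t])]].
have oU2 : open_family U2.
  move=> N iN [t [Nt mt w]].
  have [c h] := small_witness_local (infU _ (infinite_tl (c := t) iN)) w.
  exists (maxn (maxn b t) c) => N' iN' ag.
  have agt m : (m <= maxn (maxn b t) c)%N -> tl t N m <-> tl t N' m.
    by move=> mc; have [? ?] := ag m mc; split=> -[? ?]; split; auto.
  exists t; split.
  - by apply/ag => //; rewrite !leq_max leqnn orbT.
  - move=> x N'x; rewrite leqNgt; apply/negP => xt.
    have : N x by apply/ag => //; rewrite !leq_max (ltnW xt) orbT.
    by move=> /mt; rewrite leqNgt xt.
  apply: h => [|m sm' nE|//].
    by apply: agU => m mc; apply: agt; rewrite leq_max mc orbT.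
  split=> // -[Dm|Nm]; apply: nE; [by left|right].
  apply/agt => //; rewrite !leq_max.
  by case: sm' => [/sb /=|->]; rewrite ?ltnS ?leqnn ?orbT // => ->.
have [M2 MM2 [all2|none2]] := open_Ramsey oU2 MM1.2.
  exists M2; first exact: inf_subsets_trans MM0 (inf_subsets_trans MM1 MM2).
  right=> t N M2t [NM iN].
  have iN' : infinite_set ([set t] `|` N) by apply: inf_sub iN _ => x; right.
  have [|t' [Nt' mt' w]] := all2 ([set t] `|` N).
    by split=> // x [->//|/NM[]].
  have tt' : t' = t.
    case: Nt' => // /NM[_ /= tt']; have := mt' t (or_introl erefl).
    by rewrite leqNgt tt'.
  have tlN : tl t ([set t] `|` N) = N; last by move: w; rewrite tt' tlN.
  apply/seteqP; split=> x; first by move=> [[->|//]] /=; rewrite ltnn.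
  by move=> Nx; split; [right|have [] := NM x Nx].
exfalso; have [c gc] := gap b MM2.2.
have iN : inf_subsets M1 (tl c M2).
  by split; [move=> x [/MM2.1]|exact: infinite_tl MM2.2].
have [n [u [mn w smu]]] := all1 _ iN.
have [g [M2g gc'] smg] := gc u.
have gt x : tl c M2 x -> (g < x)%N by move=> [_ cx]; exact: leq_ltn_trans cx.
apply: (none2 ([set g] `|` tl c M2)).
  split; first by move=> x [->//|[]].
  by apply: inf_sub iN.2 _ => x; right.
have gb : (b < g)%N by apply: Mb; apply: MM1.1; exact: MM2.1.
exists g; split; [by left|by move=> x [->//|/gt/ltnW]|].
have -> : tl g ([set g] `|` tl c M2) = tl c M2.
  apply/seteqP; split=> x; first by move=> [[->|//]] /=; rewrite ltnn.
  by move=> Nx; split; [right|exact: gt].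
exists n, u; split=> // m b' sm' nE sb' b'm.
case: sm' => [sm'|mg].
  case: sb' => [sb'|b'g]; first exact: smu.
  by have /= := sb _ sm'; move: b'm; rewrite b'g; lia.
rewrite mg in b'm *; apply: smS smg _.
case: sb' => [/sb /=|b'g]; first by rewrite ltnS.
by move: b'm; rewrite b'g ltnn.
Qed.

(** Fusion makes [small_witness_next] available for all pairs [s], [D] of subsets
    of an initial segment of [T].  The points of [T] are then treated in
    increasing order, up to the end of the blocks of [E]: those in [E] demand
    nothing, and those outside are the omitted ones. *)
Lemma thin_small_witness L : infinite_set L ->
  (forall E, inf_subsets L E -> exists n u, witnessed F n E u) ->
  exists2 T, inf_subsets L T & forall E, inf_subsets T E -> exists n u,
    witnessed F n E u /\ forall m b i, T m -> ~ E m -> T b -> (b < m)%N ->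
      (i < n)%N -> (m <= cut F (rest F E i))%N -> sm u b m.
Proof.
move=> iL wL.
pose alt s D M := (forall N, inf_subsets M N -> ~ small_witness (D `|` N) s) \/
  (forall t N, M t -> inf_subsets (tl t M) N ->
     small_witness (D `|` N) (s `|` [set t])).
have altS s D M M' : alt s D M -> inf_subsets M M' -> alt s D M'.
  move=> [h|h] MM'; [left=> N M'N; apply: h; exact: inf_subsets_trans M'N|right].
  move=> t N M't [NM' iN]; apply: h; first exact: MM'.1.
  by split=> // x /NM'[/MM'.1 ? ?].
have [|b M iM|T LT PT] := @fusion (fun b M => forall s, s `<=` `I_b.+1 ->
    forall D, D `<=` `I_b.+1 -> alt s D M) L _ _ iL.
- by move=> b M M' h MM' s sb D Db; apply: altS MM'; exact: h.
- have [|s M' iM'|M' MM' h] := @thin_forall_subsets b.+1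
    (fun s M => s `<=` `I_b.+1 -> forall D, D `<=` `I_b.+1 -> alt s D M) _ _ M iM.
  + by move=> s M1 M2 h M12 sb D Db; apply: altS M12; exact: h.
  + have [sb|nsb] := pselect (s `<=` `I_b.+1); last first.
      by exists M'; first exact: inf_subsetsxx.
    have [|D M1 iM1|M1 M'M1 h] := @thin_forall_subsets b.+1
      (fun D M => D `<=` `I_b.+1 -> alt s D M) _ _ M' iM'.
    * by move=> D M1 M2 h M12 Db; apply: altS M12; exact: h.
    * have [Db|nDb] := pselect (D `<=` `I_b.+1); last first.
        by exists M1; first exact: inf_subsetsxx.
      by have [M2 M12 h] := small_witness_next sb Db iM1; exists M2.
    by exists M1 => // _ D Db; exact: h.
  by exists M' => // s sb; exact: h.
exists T => // E TE.
have first_wit E' : inf_subsets T E' -> exists n u,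
    (forall n' u', (n' < n)%N -> ~ witnessed F n' E' u') /\ witnessed F n E' u.
  move=> TE'; have [n0 [u0 w0]] := wL E' (inf_subsets_trans LT TE').
  have [|n [u w] mn] := @ex_least (fun n => exists u, witnessed F n E' u).
    by exists n0, u0.
  exists n, u; split=> // n' u' n'n w'.
  by have := mn n' (ex_intro _ _ w'); rewrite leqNgt n'n.
have key t : T t -> forall E', inf_subsets T E' -> small_witness E' (hd t T).
  elim/ltn_ind: t => t IH Tt E' TE'.
  have [lo|nlo] := pselect (exists2 x, T x & (x < t)%N); last first.
    have hT m : hd t T m -> m = t.
      move=> [Tm /=]; rewrite leq_eqVlt => /predU1P[//|mt].
      by case: nlo; exists m.
    have [n [u [mn w]]] := first_wit E' TE'.
    by exists n, u; split=> // m b /hT -> _ /hT ->; rewrite ltnn.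
  have [r [Tr rt mr]] := ex_pred lo.
  have hE : hd t T = hd r T `|` [set t].
    apply/seteqP; split=> x.
      move=> [Tx]; rewrite /= leq_eqVlt => /predU1P[->|xc]; first by right.
      by left; split=> //=; exact: mr.
    by move=> [[Tx /= xd]|->]; split=> //=; lia.
  have w := IH r rt Tr E' TE'.
  have [E't|nE't] := pselect (E' t).
    have [n [u [mn wn smu]]] := w; exists n, u; split=> // m b.
    rewrite hE => -[hm|-> //] nE' [hb|->] bm; first exact: smu.
    by have [_ /=] := hm; lia.
  have Eu : E' = hd r E' `|` tl r E' by rewrite hd_tlU.
  have tlE : inf_subsets (tl r T) (tl r E').
    by split; [move=> x [/TE'.1]|exact: infinite_tl TE'.2].
  have [||h|h] := PT r Tr (hd r T) _ (hd r E') _.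
  - by move=> x [_ /=].
  - by move=> x [_ /=].
  - by exfalso; apply: (h _ tlE); rewrite -Eu.
  rewrite hE Eu; apply: h => //; split; last exact: tlE.2.
  move=> x [E'x /= rx]; split; first by split=> //; exact: TE'.1.
  rewrite /= ltn_neqAle; apply/andP; split.
    by apply/eqP => tx; apply: nE't; rewrite tx.
  rewrite leqNgt; apply/negP => xt; have := mr x (TE'.1 _ E'x) xt.
  by rewrite leqNgt rx.
have [n [u [mn w]]] := first_wit E TE.
have [t Tt ct] := (infP T).1 (LT.2) (\max_(i < n) cut F (rest F E i)).
have [n' [u' [mn' w' smu]]] := key t Tt E TE.
have nn' : n' = n.
  apply/eqP; rewrite eqn_leq; apply/andP; split; rewrite leqNgt; apply/negP => h.
    exact: mn' h w.
  exact: mn h w'.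
exists n', u'; split=> // m b i Tm nEm Tb bm iN mc; apply: smu => //.
- split=> //=; apply: leq_trans mc (leq_trans _ (ltnW ct)).
  by rewrite nn' in iN; exact: (leq_bigmax (Ordinal iN)).
- split=> //=; apply: leq_trans (ltnW bm) _.
  apply: leq_trans mc (leq_trans _ (ltnW ct)).
  by rewrite nn' in iN; exact: (leq_bigmax (Ordinal iN)).
Qed.

End Elton.
End Witnesses.

(** * Assembling the rows *)

Lemma inf_enum (A : set nat) : infinite_set A ->
  exists e : nat -> nat, (forall i, A (e i)) /\ {homo e : i j / (i < j)%N}.
Proof.
move=> /infP iA.
have /choice[f fP] : forall b, exists n, A n /\ (b < n)%N.
  by move=> b; have [n An bn] := iA b; exists n.
exists (fun i => iter i f (f 0%N)); split; first by case=> [|i] /=; apply: (fP _).1.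
move=> i j; elim: j => // j IH; rewrite ltnS leq_eqVlt => /predU1P[->|/IH ij] /=.
  by have [] := fP (iter j f (f 0%N)).
by apply: ltn_trans ij _; have [] := fP (iter j f (f 0%N)).
Qed.

Lemma ex_greatest (A : set nat) : finite_set A -> (exists x, A x) ->
  exists2 m, A m & forall x, A x -> (x <= m)%N.
Proof.
move=> /finite_bound[b Ab] [x Ax].
have [|m [Am mb mx]] := @ex_pred A b; first by exists x => //; exact: Ab.
by exists m => // y Ay; apply: mx => //; exact: Ab.
Qed.

Lemma hd_hd c c' (E : set nat) : (c <= c')%N -> hd c (hd c' E) = hd c E.
Proof.
move=> cc; apply/seteqP; split=> x; first by move=> [[Ex _] xc].
by move=> [Ex xc]; split=> //; split=> //=; exact: leq_trans cc.
Qed.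

Section Assembly.
Variables (R : realType) (P : prob_block R).
Variables (U : Type) (Wit : nat -> nat -> (nat -> set nat) -> U -> Prop).
Variables (F : nat -> set (set nat)) (T : nat -> set nat).
Variable sm : U -> nat -> nat -> Prop.
Hypothesis WitS : forall k n Es Es' u,
  (forall i, (i < n)%N -> Es' i `<=` Es i) -> Wit k n Es u -> Wit k n Es' u.
Hypothesis F0 : forall k, F k set0.
Hypothesis Fhd : forall k c b, F k b -> F k (hd c b).
Hypothesis Fexits : forall k, exits (F k).
Hypothesis iT : forall k, infinite_set (T k).
Hypothesis TS : forall k, T k.+1 `<=` T k.
Hypothesis Twit : forall k E, inf_subsets (T k) E -> exists n u,
  witnessed (Wit k) (F k) n E u /\ forall m b i, T k m -> ~ E m -> T k b ->
    (b < m)%N -> (i < n)%N -> (m <= cut (F k) (rest (F k) E i))%N -> sm u b m.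
Hypothesis Fspread : forall k (A : set nat) q x0 (g : nat -> nat),
  finite_set A -> block_fam P A -> A x0 -> (forall x, A x -> (x0 <= x)%N) ->
  (x0 <= q)%N -> (q < g x0)%N -> (forall x, A x -> (x <= g x)%N) ->
  (forall x y, A x -> A y -> (x < y)%N -> (g x < g y)%N) ->
  F k ([set q] `|` g @` A).

(** For one [b] this is the exit of [b] followed by [T k]; there are finitely many
    [b] to be considered. *)
Lemma room k c : exists a, forall a' b, (a <= a')%N -> b `<=` `I_c.+1 ->
  ~ F k (b `|` hd a' (tl c (T k))).
Proof.
pose Psi b a := b `<=` `I_c.+1 ->
  forall a', (a <= a')%N -> ~ F k (b `|` hd a' (tl c (T k))).
have [||||a [_ _ ha]] := @forall_subsets nat (fun=> True) leq c.+1 Psi _ _ _ _ 0%N I.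
- exact: leqnn.
- exact: leq_trans.
- by move=> s x y h xy _ sc a' ya; apply: h => //; exact: leq_trans ya.
- move=> s x _; pose S := s `|` tl c (T k).
  have iS : infinite_set S by apply: inf_sub (infinite_tl (c := c) (@iT k)) _ => y; right.
  have [m nF] := @Fexits k _ iS.
  exists (maxn x m); split; rewrite ?leq_maxl // => sc a'; rewrite geq_max => /andP[_ ma] FS.
  apply: nF; suff <- : hd m (s `|` hd a' (tl c (T k))) = hd m S by exact: Fhd.
  apply/seteqP; split=> y [[sy|ty] /= ym]; split=> //; [by left|right|by left|right].
    by case: ty.
  by split=> //=; exact: leq_trans ma.
by exists a => a' b aa bc; exact: ha.
Qed.

Lemma T_mono k j : (k <= j)%N -> T j `<=` T k.
Proof. by move=> /subnK <-; elim: (j - k)%N => // i IH x /TS /IH. Qed.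

(** The finite sets assigned to one index [j]: a marker [q], then the positions
    [t 0 < ... < t j] used by the first rows, up to [c]; the points between [c]
    and [a'] complete any block begun before. *)
Definition stage (j a q : nat) (t : nat -> nat) (c a' : nat) : Prop :=
  [/\ [/\ T j q, (a < q)%N, (j <= q)%N &
        forall i, (i < j)%N -> (cut (F j) (rest (F j) (T j) i) < q)%N],
      [/\ (forall l, T j (t l)), (forall l, (q < t l)%N) & {homo t : x y / (x < y)%N}],
      forall l, (l <= j)%N -> (t l <= c)%N,
      (c <= a')%N &
      forall k b, (k <= j)%N -> b `<=` `I_c.+1 -> ~ F k (b `|` hd a' (tl c (T k)))].

Lemma stage_ex j a : exists s : (nat * (nat -> nat)) * (nat * nat),
  stage j a s.1.1 s.1.2 s.2.1 s.2.2.
Proof.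
have [q Tq] := (infP (T j)).1 (@iT j)
  (maxn (maxn a j) (\max_(i < j) cut (F j) (rest (F j) (T j) i))).
rewrite !gtn_max => /andP[/andP[aq jq] cq].
have [t [Tt th]] := inf_enum (infinite_tl (c := q) (@iT j)).
have /choice[ak hak] : forall k, exists x, forall a' b, (x <= a')%N ->
  b `<=` `I_(t j).+1 -> ~ F k (b `|` hd a' (tl (t j) (T k))) by move=> k; exact: room.
exists ((q, t), (t j, maxn (t j) (\max_(k < j.+1) ak k))); split=> //=.
- split=> //; first exact: ltnW.
  move=> i ij; apply: leq_ltn_trans cq.
  exact: (leq_bigmax (F := fun i : 'I_j => cut (F j) (rest (F j) (T j) i)) (Ordinal ij)).
- by split=> // l; have [] := Tt l.
- by move=> l; rewrite leq_eqVlt => /predU1P[->//|/th/ltnW].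
- exact: leq_maxl.
- move=> k b; rewrite -ltnS => kj bc; apply: hak => //; rewrite leq_max; apply/orP; right.
  exact: (leq_bigmax (F := fun i : 'I_j.+1 => ak i) (Ordinal kj)).
Qed.

(** For given [k] and [N] the set [E] consists of the first [k] blocks of [T k],
    which play no part in the conclusion, followed by one block for each
    [i >= k]: the marker [q (mn i)], the points [t j k] for [j] in the [i]-th
    support, and as many points of [T k] after these as it takes to leave [F k].
    A point [t j l] of another row is not in [E], because the stages of different
    [j] occupy disjoint intervals. *)
Lemma assembly : exists t : nat -> nat -> nat, (forall j l, (j <= t j l)%N) /\
  forall k N, infinite_set N -> exists n u,
    Wit k n (fun i => if (i < k)%N then set0
                      else (fun j => t j k) @` supp (block_meas P N i)) u /\
    forall i j l, (k <= i < n)%N -> supp (block_meas P N i) j -> (l <= j)%N ->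
      l != k -> exists2 b, (j <= b)%N & sm u b (t j l).
Proof.
have /choice[f fP] : forall ja : nat * nat, exists s : (nat * (nat -> nat)) * (nat * nat),
  stage ja.1 ja.2 s.1.1 s.1.2 s.2.1 s.2.2 by move=> ja; exact: stage_ex.
pose a := fix a j := if j is i.+1 then (f (i, a i)).2.2 else 0%N.
pose q j := (f (j, a j)).1.1.
pose t j := (f (j, a j)).1.2.
pose c j := (f (j, a j)).2.1.
have st j : stage j (a j) (q j) (t j) (c j) (a j.+1) by exact: (fP (j, a j)).
have aq j : (a j < q j)%N by have [[]] := st j.
have jq j : (j <= q j)%N by have [[]] := st j.
have Tq j : T j (q j) by have [[]] := st j.
have dum k i : (i < k)%N -> (cut (F k) (rest (F k) (T k) i) < q k)%N.
  by have [[_ _ _ h] _ _ _ _] := st k; exact: h.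
have Tt j l : T j (t j l) by have [_ [h _ _] _ _ _] := st j; exact: h.
have qt j l : (q j < t j l)%N by have [_ [_ h _] _ _ _] := st j; exact: h.
have th j : {homo t j : x y / (x < y)%N} by have [_ [_ _ h] _ _ _] := st j; exact: h.
have tc j l : (l <= j)%N -> (t j l <= c j)%N by have [_ _ h _ _] := st j; exact: h.
have ca j : (c j <= a j.+1)%N by have [] := st j.
have rm j k b : (k <= j)%N -> b `<=` `I_(c j).+1 ->
    ~ F k (b `|` hd (a j.+1) (tl (c j) (T k))) by have [_ _ _ _ h] := st j; exact: h.
have qc j : (q j < c j)%N by apply: leq_trans (qt j 0%N) (tc j 0%N _).
have aS j : (a j < a j.+1)%N := leq_trans (ltn_trans (aq j) (qc j)) (ca j).
have am i j : (i <= j)%N -> (a i <= a j)%N.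
  by move=> /subnK <-; elim: (j - i)%N => // d IH; exact: leq_trans IH (ltnW (aS _)).
have cm i j : (i < j)%N -> (c i < q j)%N.
  by move=> ij; apply: leq_ltn_trans (ca i) (leq_ltn_trans (am _ _ ij) (aq j)).
have cle i j : (i <= j)%N -> (c i <= c j)%N.
  by rewrite leq_eqVlt => /predU1P[->//|/cm h]; exact: ltnW (ltn_trans h (qc j)).
have qle i j : (i <= j)%N -> (q i <= q j)%N.
  by rewrite leq_eqVlt => /predU1P[->//|/cm h]; exact: ltnW (ltn_trans (qc i) h).
exists t; split; first by move=> j l; exact: leq_trans (jq j) (ltnW (qt j l)).
move=> k N iN; pose S i := supp (block_meas P N i).
have fS i : finite_set (S i) by exact: supp_finite.
have neS i : exists x, S i x by exact: supp_neq0.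
have /choice[m mS] : forall i, exists m, S i m /\ forall x, S i x -> (x <= m)%N.
  by move=> i; have [m ? ?] := ex_greatest (fS i) (neS i); exists m.
have /choice[mn mnS] : forall i, exists m, S i m /\ forall x, S i x -> (m <= x)%N.
  by move=> i; have [m' ? ?] := ex_least (neS i); exists m'.
have Sge i x : S i x -> (i <= x)%N by exact: supp_ge.
have Slt i j x y : (i < j)%N -> S i x -> S j y -> (x < y)%N.
  by move=> ij sx sy; exact: (supp_lt iN ij sx sy).
(* the block numbered [i], before and after the completion by points of [T k] *)
pose base i := [set q (mn i)] `|` (fun j => t j k) @` S i.
pose B i := base i `|` hd (a (m i).+1) (tl (c (m i)) (T k)).
have tk j : (k <= j)%N -> (t j k <= c j)%N by exact: tc.
have mnm i : (mn i <= m i)%N by apply: (mnS i).2; exact: (mS i).1.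
have mnk i : (k <= i)%N -> (k <= mn i)%N by move=> ki; exact: leq_trans ki (Sge _ _ (mnS i).1).
have base_le i : (k <= i)%N -> base i `<=` `I_(c (m i)).+1.
  move=> ki x /= [->|[j Sj <-]]; rewrite ltnS.
    exact: leq_trans (ltnW (qc _)) (cle _ _ (mnm i)).
  by apply: leq_trans (tk j _) (cle _ _ ((mS i).2 _ Sj)); exact: leq_trans ki (Sge _ _ Sj).
have FB i : (k <= i)%N -> F k (base i).
  move=> ki; apply: (@Fspread k (S i) (q (mn i)) (mn i)) => //.
  - exact: supp_fam.
  - exact: (mnS i).1.
  - exact: (mnS i).2.
  - by move=> x _; exact: leq_trans (jq x) (ltnW (qt x k)).
  - move=> x y Sx _ xy; apply: leq_ltn_trans (tk x _) (ltn_trans (cm _ _ xy) (qt y k)).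
    exact: leq_trans ki (Sge _ _ Sx).
have nFB i : (k <= i)%N -> ~ F k (B i).
  by move=> ki; apply: rm (base_le i ki); exact: leq_trans (mnk i ki) (mnm i).
pose d i := if (i < k)%N then cut (F k) (rest (F k) (T k) i) else cut (F k) (B i).
have hB i : (k <= i)%N -> hd (a (m i).+1) (B i) = B i.
  move=> ki; apply/seteqP; split=> [x []//|x Bx]; split=> //=.
  case: Bx => [/(base_le i ki) /=|[]//]; rewrite ltnS => h; exact: leq_trans h (ca _).
have cutB i : (k <= i)%N -> ~ F k (hd (cut (F k) (B i)) (B i)) /\
    (cut (F k) (B i) <= a (m i).+1)%N.
  move=> ki; have nF := nFB i ki; have [|h1 h2] := @cut_spec (F k) (B i).
    by exists (a (m i).+1); rewrite hB.
  by split=> //; apply: h2; rewrite hB.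
have cd i : (k <= i)%N -> (c (m i) < cut (F k) (B i))%N.
  move=> ki; rewrite ltnNge; apply/negP => h; apply: (cutB i ki).1.
  suff -> : hd (cut (F k) (B i)) (B i) = hd (cut (F k) (B i)) (base i).
    by apply: Fhd; exact: FB.
  apply/seteqP; split=> x [Bx /= xc]; split=> //; last by left.
  by case: Bx => // -[[_ /= cx] _]; have := leq_trans xc h; rewrite leqNgt cx.
pose e i := if (i < k)%N then blk (F k) (T k) i else hd (d i) (B i).
have qe i x : (k <= i)%N -> B i x -> (q (mn i) <= x)%N.
  move=> ki [[->//|[j Sj <-]]|[[_ /= cx] _]].
    exact: leq_trans (qle _ _ ((mnS i).2 _ Sj)) (ltnW (qt _ _)).
  exact: leq_trans (ltnW (qc _)) (leq_trans (cle _ _ (mnm i)) (ltnW cx)).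
have [||||iE bE] := @blocks_of (F k) (@F0 k) e d.
- move=> i; rewrite /e /d; case: ltnP => ik; last exact: (cutB i ik).1.
  by have [h _] := cutP (@Fexits k) (@inf_rest (F k) (T k) i (@iT k)); exact: h.
- move=> i x; rewrite /e /d /blk; case: (ltnP i k) => ik xd;
    by rewrite (hd_hd _ (ltnW xd)); exact: cut_lt xd.
- by move=> i x; rewrite /e /d; case: (ltnP i k) => ik; move=> [].
- move=> i x; rewrite /e /d.
  have [ik|ki] := ltnP i.+1 k.
    by rewrite (ltnW ik) /blk => -[[_ /=]].
  move=> [Bx _]; have qx := qe i.+1 x ki Bx.
  case: (ltnP i k) => ik.
    apply: leq_trans (dum _ _ ik) (leq_trans (qle _ _ _) qx).
    exact: mnk.
  apply: leq_ltn_trans (cutB i ik).2 _; apply: leq_trans (leq_ltn_trans _ (aq (mn i.+1))) qx.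
  by apply: am; apply: (Slt i i.+1) => //; [exact: (mS i).1|exact: (mnS i.+1).1].
set E := \bigcup_i e i in iE bE.
have dum_le i x : (i < k)%N -> blk (F k) (T k) i x -> (x < q k)%N.
  by move=> ik [_ /= xc]; exact: leq_ltn_trans xc (dum _ _ ik).
have ET : inf_subsets (T k) E.
  split=> // x [i _]; rewrite /e; case: (ltnP _ k) => ik; first exact: blk_sub.
  move=> [[[->|[j Sj <-]]|[[Tx _] _]] _] //.
  - by apply: T_mono (Tq _); exact: mnk.
  - by apply: T_mono (Tt _ _); exact: leq_trans ik (Sge _ _ Sj).
have [n [u [w smu]]] := Twit ET; exists n, u; split.
  apply: WitS w => i iN_; case: (ltnP i k) => ki; first by [].
  move=> _ [j Sj <-]; have [_ ->] := bE i.
  have kj : (k <= j)%N := leq_trans ki (Sge _ _ Sj).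
  rewrite /above_min /e (ltnNge i k) ki /= /d (ltnNge i k) ki /=; split.
    split; first by left; right; exists j.
    exact: leq_trans (tk j kj) (leq_trans (cle _ _ ((mS i).2 _ Sj)) (ltnW (cd i ki))).
  exists (q (mn i)); last exact: leq_ltn_trans (qle _ _ ((mnS i).2 _ Sj)) (qt j k).
  split; first by left; left.
  exact: leq_trans (ltnW (qc _)) (leq_trans (cle _ _ (mnm i)) (ltnW (cd i ki))).
move=> i j l /andP[ki iN_] Sj lj lk; exists (q j); first exact: jq.
have kj : (k <= j)%N := leq_trans ki (Sge _ _ Sj).
have xc : (t j l <= c j)%N by exact: tc.
apply: (smu _ _ i) => //.
- exact: T_mono kj _ (Tt _ _).
- move=> [i' _]; rewrite /e; case: (ltnP _ k) => ik.
    move=> /(dum_le _ _ ik) h; have := leq_trans (ltn_trans (qt j l) h) (qle _ _ kj).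
    by rewrite ltnn.
  move=> [[[xq|[j' Sj' xt]]|[[_ /= cx] /= xa]] _].
  + have [jm|mj] := ltnP j (mn i'); last by have := qle _ _ mj; rewrite -xq leqNgt qt.
    by have := leq_ltn_trans xc (cm _ _ jm); rewrite -xq ltnn.
  + have kj' : (k <= j')%N := leq_trans ik (Sge _ _ Sj').
    have [jj|jj|jj] := ltngtP j j'.
    * by have := ltn_trans (cm _ _ jj) (qt j' k); rewrite xt ltnNge xc.
    * have := leq_ltn_trans (tk j' kj') (ltn_trans (cm _ _ jj) (qt j l)).
      by rewrite xt ltnn.
    * move: xt; rewrite -jj; have [h|h|h] := ltngtP k l; last by move: lk; rewrite h eqxx.
        by have := th j _ _ h; move=> + e0; rewrite e0 ltnn.
      by have := th j _ _ h; move=> + e0; rewrite e0 ltnn.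
  + have [jm|mj] := leqP j (m i').
      by have := leq_trans cx (leq_trans xc (cle _ _ jm)); rewrite ltnn.
    have := leq_ltn_trans xa (leq_ltn_trans (am _ _ mj) (ltn_trans (aq j) (qt j l))).
    by rewrite ltnn.
- exact: T_mono kj _ (Tq _).
- have [-> _] := bE i; rewrite /d (ltnNge i k) ki /=.
  exact: leq_trans xc (leq_trans (cle _ _ ((mS i).2 _ Sj)) (ltnW (cd i ki))).
Qed.
End Assembly.

(** * Real parts and norms *)

Section Scalars.
Variables (R : realType) (cplx : bool).
Local Notation K := (scalar_field R cplx).

Definition re : K -> R :=
  if cplx as b return (scalar_field R b -> R) then @complex.Re R else id.

(** A square root of [-1] over the complex numbers, and [0] over the reals:
    [K] is spanned over [R] by [1] and [iu]. *)
Definition iu : K :=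
  if cplx as b return scalar_field R b then ('i%C : R[i]) else (0 : R).

End Scalars.
Arguments re {R cplx} _.
Arguments iu {R cplx}.

Section ScalarTheory.
Variables (R : realType).

Lemma reD (cplx : bool) (z w : scalar_field R cplx) : re (z + w) = re z + re w.
Proof. by case: cplx z w => // -[a b] [c d]. Qed.

Lemma re0 (cplx : bool) : re (0 : scalar_field R cplx) = 0.
Proof. by case: cplx. Qed.

Lemma reN (cplx : bool) (z : scalar_field R cplx) : re (- z) = - re z.
Proof. by case: cplx z => // -[a b]. Qed.

Lemma reB (cplx : bool) (z w : scalar_field R cplx) : re (z - w) = re z - re w.
Proof. by rewrite reD reN. Qed.

Lemma re_of_real (cplx : bool) (r : R) : re (of_real cplx r) = r.
Proof. by case: cplx. Qed.

Lemma of_realD (cplx : bool) (r s : R) : of_real cplx (r + s) = of_real cplx r + of_real cplx s.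
Proof. by case: cplx => //=; rewrite -rmorphD. Qed.

Lemma of_realN (cplx : bool) (r : R) : of_real cplx (- r) = - of_real cplx r.
Proof. by case: cplx => //=; rewrite -rmorphN. Qed.

Lemma of_realB (cplx : bool) (r s : R) : of_real cplx (r - s) = of_real cplx r - of_real cplx s.
Proof. by rewrite of_realD of_realN. Qed.

Lemma of_realM (cplx : bool) (r s : R) : of_real cplx (r * s) = of_real cplx r * of_real cplx s.
Proof. by case: cplx => //=; rewrite -rmorphM. Qed.

Lemma of_real0 (cplx : bool) : of_real cplx (0 : R) = 0.
Proof. by case: cplx. Qed.

Lemma of_real1 (cplx : bool) : of_real cplx (1 : R) = 1.
Proof. by case: cplx. Qed.

Lemma of_real_le (cplx : bool) (r s : R) : (of_real cplx r <= of_real cplx s) = (r <= s).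
Proof. by case: cplx => //=; rewrite lecR. Qed.

Lemma of_real_lt (cplx : bool) (r s : R) : (of_real cplx r < of_real cplx s) = (r < s).
Proof. by case: cplx => //=; rewrite ltcR. Qed.

Lemma reM_real (cplx : bool) (r : R) (z : scalar_field R cplx) :
  re (of_real cplx r * z) = r * re z.
Proof. by case: cplx z => // -[a b] /=; rewrite mul0r subr0. Qed.

Lemma re_ge0K (cplx : bool) (z : scalar_field R cplx) : 0 <= z -> of_real cplx (re z) = z.
Proof.
case: cplx z => //= z z0; apply: RRe_real; exact: ger0_real.
Qed.

Lemma re_norm_ge (cplx : bool) (z : scalar_field R cplx) : `|re z| <= re `|z|.
Proof.
case: cplx z => //= z; rewrite -lecR; exact: normc_ge_Re.
Qed.

Lemma norm_of_real (cplx : bool) (r : R) : `|of_real cplx r| = of_real cplx `|r|.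
Proof.
by case: cplx => //=; rewrite normc_def /= expr0n addr0 sqrtr_sqr.
Qed.

Lemma iu_norm (cplx : bool) : re `|iu : scalar_field R cplx| <= 1.
Proof.
case: cplx => /=; last by rewrite normr0 ler01.
by rewrite expr0n expr1n add0r sqrtr1.
Qed.

Lemma scalar_split (cplx : bool) (z : scalar_field R cplx) :
  z = of_real cplx (re z) + of_real cplx (re (- (iu * z))) * iu.
Proof.
case: cplx z => /=; last by move=> z; rewrite mulr0 addr0.
case=> a b; apply/eqP; rewrite eq_complex /=; apply/andP.
by split; apply/eqP; lra.
Qed.

Lemma re_ge0 (cplx : bool) (z : scalar_field R cplx) : 0 <= z -> 0 <= re z.
Proof. by move=> z0; rewrite -(of_real_le cplx) of_real0 re_ge0K. Qed.

Lemma re_le (cplx : bool) (z w : scalar_field R cplx) : z <= w -> re z <= re w.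
Proof. by rewrite -subr_ge0 => /re_ge0; rewrite reB subr_ge0. Qed.

End ScalarTheory.

(** Norms take their values in the scalar field, which may be complex; all the
    estimates below are made in [R]. *)
Definition nrm (R : realType) (cplx : bool)
    (V : normedModType (scalar_field R cplx)) (x : V) : R := re `|x|.

Definition mag (R : realType) (cplx : bool) (a : scalar_field R cplx) : R := re `|a|.

Section Norm.
Variables (R : realType) (cplx : bool) (V : normedModType (scalar_field R cplx)).
Local Notation K := (scalar_field R cplx).
Implicit Types (x y : V) (a : K).

Lemma nrmK x : of_real cplx (nrm x) = `|x|.
Proof. by rewrite re_ge0K. Qed.

Lemma magK a : of_real cplx (mag a) = `|a|.
Proof. by rewrite re_ge0K. Qed.

Lemma nrm_ge0 x : 0 <= nrm x.
Proof. exact: re_ge0. Qed.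

Lemma mag_ge0 a : 0 <= mag a.
Proof. exact: re_ge0. Qed.

Lemma nrmD x y : nrm (x + y) <= nrm x + nrm y.
Proof. by rewrite /nrm -reD; apply: re_le; exact: ler_normD. Qed.

Lemma nrmN x : nrm (- x) = nrm x.
Proof. by rewrite /nrm normrN. Qed.

Lemma nrmBC x y : nrm (x - y) = nrm (y - x).
Proof. by rewrite -nrmN opprB. Qed.

Lemma nrm0 : nrm (0 : V) = 0.
Proof. by rewrite /nrm normr0 re0. Qed.

Lemma nrm0_eq x : nrm x = 0 -> x = 0.
Proof. by move=> x0; apply/normr0_eq0; rewrite -nrmK x0 of_real0. Qed.

Lemma nrmZ a x : nrm (a *: x) = mag a * nrm x.
Proof. by rewrite /nrm normrZ -magK reM_real. Qed.

Lemma mag_real (r : R) : mag (of_real cplx r) = `|r|.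
Proof. by rewrite /mag norm_of_real re_of_real. Qed.

Lemma nrm_leE x (r : R) : (`|x| <= of_real cplx r) = (nrm x <= r).
Proof. by rewrite -nrmK of_real_le. Qed.

Definition tendsto (u : nat -> V) (l : V) : Prop :=
  forall e : R, 0 < e -> exists N, forall n, (N <= n)%N -> nrm (u n - l) <= e.

Lemma tendstoP (u : nat -> V) (l : V) : (u n @[n --> \oo] --> l) <-> tendsto u l.
Proof.
split=> [/cvgrPdist_le h e e0|h].
  have := h (of_real cplx e); rewrite -(of_real0 R cplx) of_real_lt => /(_ e0)[N _ hN].
  by exists N => n /hN /=; rewrite nrm_leE nrmBC.
apply/cvgrPdist_le => e e0; have e0' : 0 < re e.
  by rewrite -(of_real_lt cplx) of_real0 re_ge0K // ltW.
have [N hN] := h _ e0'; exists N => // n /= /hN h'.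
by rewrite distrC -(re_ge0K (ltW e0)) nrm_leE.
Qed.

Lemma tendsto_uniq (u : nat -> V) l l' : tendsto u l -> tendsto u l' -> l = l'.
Proof.
move=> h h'; apply/subr0_eq/nrm0_eq/eqP; rewrite eq_le nrm_ge0 andbT.
apply/ler_addgt0Pr => e e0; rewrite add0r.
have [N hN] := h _ (divr_gt0 e0 (ltr0Sn R 1)).
have [N' hN'] := h' _ (divr_gt0 e0 (ltr0Sn R 1)).
have a := hN _ (leq_maxl N N'); have b := hN' _ (leq_maxr N N').
have -> : l - l' = (l - u (maxn N N')) + (u (maxn N N') - l').
  by rewrite addrA subrK.
apply: le_trans (nrmD _ _) _; rewrite nrmBC (splitr e); exact: lerD.
Qed.

End Norm.

Lemma half_pow_small (R : realType) (c e : R) : 0 < e ->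
  exists N, forall n, (N <= n)%N -> c * 2^-1 ^+ n <= e.
Proof.
move=> e0; have [c0|c0] := leP c 0.
  by exists 0%N => n _; apply: le_trans (ltW e0); rewrite mulr_le0_ge0 // exprn_ge0.
have := @cvg_expr R (2^-1); rewrite ger0_norm // => /(_ _) h.
have /cvgrPdist_le /(_ (e / c) (divr_gt0 e0 c0)) [N _ hN] : (fun n => (2^-1 : R) ^+ n) @ \oo --> 0.
  by apply: h; rewrite invf_lt1 // ltr1n.
exists N => n /hN /=; rewrite sub0r normrN ger0_norm ?exprn_ge0 //.
by rewrite ler_pdivlMr // mulrC.
Qed.

Lemma geometric_cvg (R : realType) (cplx : bool)
    (V : completeNormedModType (scalar_field R cplx)) (u : nat -> V) (c : R) :
  (forall n, nrm (u n.+1 - u n) <= c * 2^-1 ^+ n) ->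
  exists l, tendsto u l /\ forall n, nrm (u n - l) <= 2 * c * 2^-1 ^+ n.
Proof.
move=> hu.
have c0 : 0 <= c by have := hu 0%N; rewrite expr0 mulr1; apply: le_trans; exact: nrm_ge0.
have far n k : nrm (u (n + k)%N - u n) <= 2 * c * 2^-1 ^+ n.
  suff : nrm (u (n + k)%N - u n) <= 2 * c * 2^-1 ^+ n * (1 - 2^-1 ^+ k).
    move=> h; apply: le_trans h _; apply: ler_piMr.
      by rewrite !mulr_ge0 // exprn_ge0.
    by rewrite lerBlDr lerDl exprn_ge0.
  elim: k => [|k IH]; first by rewrite addn0 subrr nrm0 expr0 subrr mulr0.
  have -> : u (n + k.+1)%N - u n = (u (n + k).+1 - u (n + k)%N) + (u (n + k)%N - u n).
    by rewrite addrA subrK addnS.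
  apply: le_trans (nrmD _ _) _; apply: le_trans (lerD (hu _) IH) _.
  rewrite exprD exprS; set A := _ ^+ n; set B := _ ^+ k.
  by rewrite [leLHS](_ : _ = 2 * c * A * (1 - 2^-1 * B)) //; field.
have cu : cvg (u n @[n --> \oo]).
  apply: cauchy_cvg; apply: cauchy_exP => e e0.
  have e0' : 0 < re e by rewrite -(of_real_lt cplx) of_real0 re_ge0K // ltW.
  have [N hN] := half_pow_small (2 * c) (divr_gt0 e0' (ltr0Sn R 1)).
  exists (u N); exists N => // n /= Nn; rewrite -ball_normE /=.
  rewrite -nrmK -(re_ge0K (ltW e0)) of_real_lt nrmBC.
  rewrite -(subnKC Nn); apply: le_lt_trans (far _ _) _.
  by apply: le_lt_trans (hN N (leqnn N)) _; rewrite ltr_pdivrMr // ltr_pMr // ltr1n.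
have [l hl] : exists l, tendsto u l by exists (lim (u n @[n --> \oo])); apply/tendstoP.
exists l; split=> // n; apply/ler_addgt0Pr => e e0.
have [N hN] := hl e e0; have h1 := hN (n + N)%N (leq_addl _ _).
have -> : u n - l = (u n - u (n + N)%N) + (u (n + N)%N - l) by rewrite addrA subrK.
apply: le_trans (nrmD _ _) _; apply: lerD => //; rewrite nrmBC; exact: far.
Qed.

Lemma half_sum (R : realType) m n : \sum_(m <= l < n) (2^-1 : R) ^+ l.+1 <= 2^-1 ^+ m.
Proof.
have [mn|nm] := leqP m n; last by rewrite big_geq ?exprn_ge0 // ltnW.
rewrite (eq_bigr (fun l => - 2^-1 ^+ l.+1 - - (2^-1 : R) ^+ l)); last first.
  by move=> l _; rewrite exprS; field.
by rewrite telescope_sumr // opprK addrC lerBlDr lerDl exprn_ge0.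
Qed.

(** * Real functionals *)

Section Dual.
Variables (R : realType) (cplx : bool) (X : normedModType (scalar_field R cplx)).
Local Notation K := (scalar_field R cplx).
Local Notation sc r := (of_real cplx r).

(** The unit ball of the dual of [X] regarded as a real space.  Its members are
    the real parts of the functionals of the dual unit ball, and treat both kinds
    of scalars alike. *)
Definition dual_ball (u : X -> R) : Prop :=
  [/\ forall x y, u (x + y) = u x + u y,
      forall r x, u (sc r *: x) = r * u x & forall x, `|u x| <= nrm x].

Lemma nrm_sc (r : R) (x : X) : nrm (sc r *: x) = `|r| * nrm x.
Proof. by rewrite nrmZ mag_real. Qed.

Lemma dual_ball_sum u n (f : nat -> X) : dual_ball u ->
  u (\sum_(i < n) f i) = \sum_(i < n) u (f i).
Proof.
move=> [uD uZ _]; elim: n => [|n IH]; last by rewrite !big_ord_recr /= uD IH.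
by rewrite !big_ord0 -(scale0r 0) -(of_real0 R cplx) uZ mul0r.
Qed.

(** Partial functionals dominated by the norm, as graphs.  The empty graph is
    admitted, being the union of the empty chain. *)
Let partial (z : X) : set (set (X * R)) := [set G |
  [/\ G !=set0 -> G (z, nrm z),
      forall p q, G p -> G q -> G (p.1 + q.1, p.2 + q.2),
      forall r p, G p -> G (sc r *: p.1, r * p.2) &
      forall p, G p -> p.2 <= nrm p.1]].

(** A maximal graph is everywhere defined: it extends to a further vector [x0] by
    any value between the bounds that domination imposes on both sides. *)
Lemma Hahn_Banach (z : X) : exists2 u, dual_ball u & u z = nrm z.
Proof.
have [F FP totF|A [[Az AD AZ Ale] maxA]] := @Zorn_bigcup _ (partial z).
  split.
  - move=> [p [G FG Gp]]; exists G => //; have [h _ _ _] := FP _ FG.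
    by apply: h; exists p.
  - move=> p q [G FG Gp] [H FH Hq].
    have [GH|HG] := totF _ _ FG FH.
      by exists H => //; have [_ h _ _] := FP _ FH; apply: h => //; exact: GH.
    by exists G => //; have [_ h _ _] := FP _ FG; apply: h => //; exact: HG.
  - by move=> r p [G FG Gp]; exists G => //; have [_ _ h _] := FP _ FG; exact: h.
  - by move=> p [G FG Gp]; have [_ _ _ h] := FP _ FG; exact: h.
have nrm_ge (r : R) (x : X) : r * nrm x <= nrm (sc r *: x).
  by rewrite nrm_sc ler_wpM2r ?nrm_ge0 // ler_norm.
have A0 : A !=set0.
  apply: contrapT => nA; pose G := [set (sc r *: z, r * nrm z) | r in [set: R]].
  apply: (maxA G).
    split; first by move=> p Ap; case: nA; exists p.
    by move=> h; apply: nA; exists (sc 0 *: z, 0 * nrm z); apply: h; exists 0.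
  split.
  - by move=> _; exists 1; rewrite // of_real1 scale1r mul1r.
  - move=> _ _ [r _ <-] [s _ <-]; exists (r + s) => //=.
    by rewrite of_realD scalerDl mulrDl.
  - by move=> r _ [s _ <-]; exists (r * s) => //=; rewrite of_realM scalerA mulrA.
  - by move=> _ [r _ <-] /=; exact: nrm_ge.
have {}Az := Az A0.
have A00 : A (0, 0).
  by have := AZ 0 _ Az; rewrite /= of_real0 scale0r mul0r.
have dom x0 : exists c, A (x0, c).
  apply: contrapT => /forallNP nx0.
  pose S := [set p.2 - nrm (p.1 - x0) | p in A].
  have ub p q : A p -> A q -> p.2 - nrm (p.1 - x0) <= nrm (q.1 + x0) - q.2.
    move=> Ap Aq; have := Ale _ (AD _ _ Ap Aq) => /=.
    have -> : p.1 + q.1 = (p.1 - x0) + (q.1 + x0) by rewrite addrACA addNr addr0.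
    by move=> h; have := le_trans h (nrmD _ _); lra.
  (* [c] is the least value allowed at [x0] by the constraints from below *)
  have hS : has_sup S.
    split; first by exists (0 - nrm (0 - x0)); exists (0, 0).
    by exists (nrm (z + x0) - nrm z) => _ [p Ap <-]; exact: (ub p (z, nrm z)).
  pose c := sup S.
  have cl p : A p -> p.2 - nrm (p.1 - x0) <= c by move=> Ap; apply: (sup_upper_bound hS); exists p.
  have cu p : A p -> c <= nrm (p.1 + x0) - p.2.
    by move=> Ap; apply: ge_sup; [case: hS|move=> _ [q Aq <-]; exact: ub].
  apply: (maxA [set y | exists p s, A p /\ y = (p.1 + sc s *: x0, p.2 + s * c)]).
    split; first by move=> p Ap; exists p, 0; rewrite of_real0 scale0r mul0r !addr0 -surjective_pairing.
    move=> h; apply: (nx0 c); apply: h; exists (0, 0), 1.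
    by rewrite of_real1 scale1r mul1r !add0r.
  split.
  - by move=> _; exists (z, nrm z), 0; rewrite of_real0 scale0r mul0r !addr0.
  - move=> _ _ [p [s [Ap ->]]] [q [t [Aq ->]]]; exists (p.1 + q.1, p.2 + q.2), (s + t).
    split; first exact: AD.
    by rewrite /= of_realD scalerDl mulrDl addrACA; congr pair; rewrite addrACA.
  - move=> r _ [p [s [Ap ->]]]; exists (sc r *: p.1, r * p.2), (r * s).
    split; first exact: AZ.
    by rewrite /= scalerDr scalerA of_realM mulrDr mulrA.
  - move=> _ [p [s [Ap ->]]] /=.
    have [s0|s0|<-] := ltgtP 0 s; last first.
    + by rewrite of_real0 scale0r mul0r !addr0; exact: Ale.
    + have t0 : 0 < - s by lra.
      have := cl _ (AZ (- s)^-1 _ Ap) => /=.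
      have -> : nrm (sc (- s)^-1 *: p.1 - x0) = (- s)^-1 * nrm (p.1 + sc s *: x0).
        have -> : sc (- s)^-1 *: p.1 - x0 = sc (- s)^-1 *: (p.1 + sc s *: x0).
          rewrite scalerDr scalerA -of_realM invrN mulNr mulVf ?lt_eqF //.
          by rewrite (of_realN cplx 1) of_real1 scaleN1r.
        by rewrite nrm_sc ger0_norm // invr_ge0 ltW.
      rewrite -mulrBr => h; have := ler_wpM2l (ltW t0) h.
      by rewrite mulrA mulfV ?gt_eqF // mul1r; lra.
    + have := cu _ (AZ s^-1 _ Ap) => /=.
      have -> : nrm (sc s^-1 *: p.1 + x0) = s^-1 * nrm (p.1 + sc s *: x0).
        have -> : sc s^-1 *: p.1 + x0 = sc s^-1 *: (p.1 + sc s *: x0).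
          by rewrite scalerDr scalerA -of_realM mulVf ?gt_eqF // of_real1 scale1r.
        by rewrite nrm_sc ger0_norm // invr_ge0 ltW.
      rewrite -mulrBr => h; have := ler_wpM2l (ltW s0) h.
      by rewrite mulrA mulfV ?gt_eqF // mul1r; lra.
have [u uA] := choice dom.
have uniq x a b : A (x, a) -> A (x, b) -> a <= b.
  move=> Aa Ab; have := Ale _ (AD _ _ Aa (AZ (- 1) _ Ab)).
  by rewrite /= of_realN of_real1 scaleN1r subrr nrm0; lra.
have u_uniq x a : A (x, a) -> u x = a.
  by move=> Aa; apply/eqP; rewrite eq_le (uniq x _ _ (uA x) Aa) (uniq x _ _ Aa (uA x)).
exists u; last exact: u_uniq.
split.
- by move=> x y; apply: u_uniq; exact: (AD _ _ (uA x) (uA y)).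
- by move=> r x; apply: u_uniq; exact: (AZ r _ (uA x)).
- move=> x; rewrite ler_norml (Ale _ (uA x)) andbT lerNl.
  have := Ale _ (AZ (- 1) _ (uA x)).
  by rewrite /= mulN1r of_realN of_real1 scaleN1r nrmN.
Qed.

End Dual.

(** Over the complex numbers [f x = u x - i u (i x)]. *)
Lemma dual_ball_re (R : realType) (cplx : bool)
    (X : normedModType (scalar_field R cplx)) (u : X -> R) : dual_ball u ->
  exists f : {linear X -> (scalar_field R cplx)^o}, continuous f /\ forall x, re (f x) = u x.
Proof.
have bnd b (Y : normedModType (scalar_field R b)) (f : {linear Y -> (scalar_field R b)^o}) :
    (forall x, `|f x| <= 2 * `|x|) -> continuous f.
  move=> fb; apply: bounded_linear_continuous; apply/linear_boundedP.
  exists 2; split; first exact: realn.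
  move=> r r2 x; apply: le_trans (fb x) _; apply: ler_wpM2r => //; exact: ltW.
case: cplx X u => X u [uD uZ ub]; last first.
- have fl : linear (u : X -> R^o).
    by move=> a x y; rewrite uD uZ.
  pose F : {linear X -> R^o} := HB.pack (u : X -> R^o) (GRing.isLinear.Build _ _ _ _ (u : X -> R^o) fl).
  exists F; split=> //; apply: bnd => x; apply: le_trans (ub x) _.
  by rewrite /nrm /= mulr_natl mulr2n lerDl.
pose f (x : X) : (R[i])^o := Complex (u x) (- u ('i%C *: x)).
have uc (a : R[i]) x : u (a *: x) = complex.Re a * u x + complex.Im a * u ('i%C *: x).
  rewrite -!uZ -uD /= scalerA -scalerDl; congr (u (_ *: _)).
  by rewrite {1}(complexE a) mulrC.
have iux z : u ('i%C *: ('i%C *: z)) = - u z.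
  have -> : 'i%C *: ('i%C *: z) = of_real true (- 1 : R) *: z.
    by rewrite scalerA -expr2 sqr_i of_realN of_real1.
  by rewrite uZ mulN1r.
have fl : linear f.
  move=> a x y; rewrite /f scalerDr !uD.
  have -> : 'i%C *: (a *: x) = a *: ('i%C *: x) by rewrite !scalerA mulrC.
  rewrite (uc a x) (uc a ('i%C *: x)) iux.
  case: a => a b; apply/eqP; rewrite eq_complex /=.
  by apply/andP; split; apply/eqP; ring.
pose F : {linear X -> (R[i])^o} := HB.pack f (GRing.isLinear.Build _ _ _ _ f fl).
exists F; split=> //; apply: (bnd true) => x.
have n2 : nrm ('i%C *: x) <= nrm x.
  by rewrite nrmZ ler_piMl ?nrm_ge0 //; exact: (@iu_norm R true).
rewrite -(nrmK x).
have -> : 2 * of_real true (nrm x) = of_real true (nrm x + nrm x).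
  by rewrite of_realD mulr_natl mulr2n.
change (`|F x|) with (`|f x|).
have -> : f x = of_real true (u x) + of_real true (- u ('i%C *: x)) * 'i%C.
  by apply/eqP; rewrite eq_complex /=; apply/andP; split; apply/eqP; ring.
apply: le_trans (ler_normD _ _) _; rewrite of_realD; apply: lerD.
  by rewrite norm_of_real of_real_le ub.
rewrite normrM norm_of_real normrN.
have -> : `|'i%C : R[i]| = of_real true (mag ('i%C : scalar_field R true)) by rewrite magK.
rewrite -of_realM of_real_le.
apply: le_trans (_ : `|u ('i%C *: x)| * 1 <= _); last by rewrite mulr1 (le_trans (ub _)).
by apply: ler_wpM2l => //; exact: (@iu_norm R true).
Qed.

Section WeakNull.
Variables (R : realType) (cplx : bool) (X : completeNormedModType (scalar_field R cplx)).
Local Notation K := (scalar_field R cplx).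
Implicit Types (x : nat -> X).

Lemma weakly_null_re x (u : X -> R) (d : R) : weakly_null x -> dual_ball u -> 0 < d ->
  exists N, forall n, (N <= n)%N -> `|u (x n)| <= d /\ `|u (iu *: x n)| <= d.
Proof.
move=> wx ub d0; have [f [fc fu]] := dual_ball_re ub.
have /tendstoP/(_ d d0)[N hN] := wx f fc.
exists N => n /hN; rewrite subr0 => h; split; rewrite -fu.
  by apply: le_trans h; exact: re_norm_ge.
rewrite linearZ; apply: le_trans (re_norm_ge _) _.
change (nrm (iu *: f (x n) : K^o) <= d); rewrite nrmZ.
by apply: le_trans h; apply: ler_piMl (nrm_ge0 _) _; exact: iu_norm.
Qed.

(** Smallness at [z] and at [iu *: z] controls all the scalar multiples of [z]. *)
Lemma dual_ball_scale (u : X -> R) (a : K) (z : X) : dual_ball u ->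
  `|u (a *: z)| <= mag a * (`|u z| + `|u (iu *: z)|).
Proof.
move=> [uD uZ ub]; rewrite {1}(scalar_split a) scalerDl -scalerA uD !uZ.
apply: le_trans (ler_normD _ _) _; rewrite !normrM mulrDr; apply: lerD.
  by apply: ler_wpM2r => //; exact: re_norm_ge.
apply: ler_wpM2r => //; apply: le_trans (re_norm_ge _) _.
rewrite normrN normrM; change (re (`|iu : K| * `|a|) <= mag a).
rewrite -magK reM_real; apply: ler_piMl (mag_ge0 _) _; exact: iu_norm.
Qed.

(** Weak* compactness, in the form of a limit along an ultrafilter. *)
Lemma dual_ball_ultra (F : set_system nat) (v : nat -> X -> R) : UltraFilter F ->
  (forall n, dual_ball (v n)) -> exists2 u, dual_ball u &
    forall z (d : R), 0 < d -> F [set n | `|v n z - u z| <= d].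
Proof.
move=> FU vb; have PF : ProperFilter F by exact: ultra_proper.
have /choice[u near] : forall z, exists a : R, forall d, 0 < d -> F [set n | `|v n z - a| <= d].
  move=> z; have [|a [_ ca]] := @segment_compact R (- nrm z) (nrm z) ((fun n => v n z) @ F) _.
    have bn n : `[- nrm z, nrm z]%classic (v n z).
      by rewrite /= in_itv /= -ler_norml; have [_ _] := vb n; exact.
    by apply: (@filterS _ F _ _ _ (fun n _ => bn n) (@filterT _ F _)).
  exists a => d d0; have [//|Fc] := in_ultra_setVsetC [set n | `|v n z - a| <= d] FU.
  exfalso; have [|y [ny yb]] := ca (~` [set y | `|y - a| <= d]) (ball a d) Fc _.
    exact: nbhsx_ballx.
  by apply: ny; move: yb; rewrite -ball_normE /= distrC => /ltW.
have small (r C : R) : (forall d, 0 < d -> `|r| <= C * d) -> r = 0.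
  move=> h; apply/normr0_eq0/eqP; rewrite eq_le normr_ge0 andbT.
  apply/ler_addgt0Pr => e e0; rewrite add0r.
  have C1 : 0 < `|C| + 1 by rewrite ltr_wpDl.
  apply: le_trans (h (e / (`|C| + 1)) (divr_gt0 e0 C1)) _.
  rewrite mulrCA -[leRHS]mulr1; apply: ler_wpM2l; first exact: ltW.
  by rewrite ler_pdivrMr // mul1r; have := ler_norm C; lra.
exists u => //; split.
- move=> x y; apply/subr0_eq; apply: (small _ 3) => d d0.
  have [n [[h1 h2] h3]] := filter_ex (filterI (filterI (near x d d0) (near y d d0)) (near (x + y) d d0)).
  have [vD _ _] := vb n; move: h1 h2 h3 => /=; rewrite vD !ler_norml.
  by move=> /andP[? ?] /andP[? ?] /andP[? ?]; apply/andP; split; lra.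
- move=> r x; apply/subr0_eq; apply: (small _ (1 + `|r|)) => d d0.
  have [n [h1 h2]] := filter_ex (filterI (near x d d0) (near (of_real cplx r *: x) d d0)).
  have [_ vZ _] := vb n; move: h1 h2 => /=; rewrite vZ => h1 h2.
  have -> : u (of_real cplx r *: x) - r * u x
    = (r * (v n x - u x)) - (r * v n x - u (of_real cplx r *: x)) by ring.
  apply: le_trans (ler_normB _ _) _; rewrite normrM mulrDl mul1r addrC.
  by apply: lerD => //; apply: ler_wpM2l.
- move=> x; apply/ler_addgt0Pr => d d0; have [n h] := filter_ex (near x d d0).
  have [_ _ vN] := vb n; move: h => /= h; have := vN x.
  have -> : u x = v n x - (v n x - u x) by ring.
  by move=> h'; apply: le_trans (ler_normB _ _) _; exact: lerD.
Qed.

(** Otherwise, for each [c] some functional is not small at any point of [S] up to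
    [c]; a limit of these functionals is not small at any point of [S], which is
    impossible because the sequences are weakly null. *)
Lemma weakly_null_gap (x : nat -> nat -> X) (lam : nat -> nat -> nat) b (d : R)
    (S : set nat) :
  (forall l, weakly_null (x l)) -> (forall l m, (m <= lam l m)%N) -> 0 < d ->
  infinite_set S -> exists c, forall u, dual_ball u -> exists2 g,
    S g /\ (g <= c)%N & forall l, (l <= b)%N ->
      `|u (x l (lam l g))| <= d /\ `|u (iu *: x l (lam l g))| <= d.
Proof.
move=> wx lge d0 iS; apply: contrapT => /forallNP nc.
have /choice[v hv] : forall c, exists u, dual_ball u /\ forall g, S g -> (g <= c)%N ->
    ~ forall l, (l <= b)%N -> `|u (x l (lam l g))| <= d /\ `|u (iu *: x l (lam l g))| <= d.
  move=> c; have /existsNP[u /not_implyP[ub h]] := nc c.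
  by exists u; split=> // g Sg gc h'; apply: h; exists g.
have [F [FU Foo]] := ultraFilterLemma (F := \oo) _.
have [u ub hu] := dual_ball_ultra FU (fun c => (hv c).1).
have d2 : 0 < d / 2 by exact: divr_gt0.
have /choice[N hN] : forall l, exists N, forall n, (N <= n)%N ->
    `|u (x l n)| <= d / 2 /\ `|u (iu *: x l n)| <= d / 2.
  by move=> l; exact: weakly_null_re (wx l) ub d2.
have [g Sg Ng] := (infP S).1 iS (\max_(l < b.+1) N l).
have gN l : (l <= b)%N -> (N l <= lam l g)%N.
  rewrite -ltnS => lb; apply: leq_trans (lge l g); apply: ltnW; apply: leq_ltn_trans Ng.
  exact: (leq_bigmax (F := fun l : 'I_b.+1 => N l) (Ordinal lb)).
have PF : ProperFilter F by exact: ultra_proper.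
have good : F [set c | forall l, (l <= b)%N ->
    `|v c (x l (lam l g))| <= d /\ `|v c (iu *: x l (lam l g))| <= d].
  have one l : F [set c | (l <= b)%N ->
      `|v c (x l (lam l g))| <= d /\ `|v c (iu *: x l (lam l g))| <= d].
    apply: filterS2 (hu (x l (lam l g)) _ d2) (hu (iu *: x l (lam l g)) _ d2) => c /= h1 h2 lb.
    have [h3 h4] := hN l _ (gN l lb).
    have tri (p q : R) : `|p - q| <= d / 2 -> `|q| <= d / 2 -> `|p| <= d.
      by rewrite !ler_norml => /andP[? ?] /andP[? ?]; apply/andP; split; lra.
    by split; [exact: tri h1 h3|exact: tri h2 h4].
  have : F [set c | forall l, (l < b.+1)%N -> (l <= b)%N ->
      `|v c (x l (lam l g))| <= d /\ `|v c (iu *: x l (lam l g))| <= d].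
    elim: b.+1 => [|k IH]; first by apply: filterS filterT.
    apply: filterS2 IH (one k) => c h1 h2 l; rewrite ltnS leq_eqVlt => /predU1P[->//|].
    exact: h1.
  by apply: filterS => c h l lb; exact: h.
have big : F [set c | (g <= c)%N] by apply: Foo; exists g.
have [c [h gc]] := filter_ex (filterI good big).
exact: (hv c).2 g Sg gc h.
Qed.

End WeakNull.

(** * Coordinates with respect to a Schauder basis *)

Section Basis.
Variables (R : realType) (cplx : bool) (V : completeNormedModType (scalar_field R cplx)).
Local Notation K := (scalar_field R cplx).

Lemma tendstoD (u v : nat -> V) k l : tendsto u k -> tendsto v l ->
  tendsto (fun n => u n + v n) (k + l).
Proof. by move=> /tendstoP hu /tendstoP hv; apply/tendstoP; exact: cvgD. Qed.

Lemma tendstoZ (a : K) (u : nat -> V) l : tendsto u l ->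
  tendsto (fun n => a *: u n) (a *: l).
Proof. by move=> /tendstoP hu; apply/tendstoP; exact: cvgZr. Qed.

Lemma scalar_geometric (a : nat -> K) (c : R) :
  (forall k, mag (a k.+1 - a k) <= c * 2^-1 ^+ k) ->
  exists l, forall e : R, 0 < e -> exists N, forall k, (N <= k)%N -> mag (a k - l) <= e.
Proof.
move=> ha.
have part (f : K -> R) : (forall z w, f (z - w) = f z - f w) ->
    (forall z, `|f z| <= mag z) ->
    exists l : R, forall e : R, 0 < e -> exists N, forall k, (N <= k)%N -> `|f (a k) - l| <= e.
  move=> fB fm; have [|l [hl _]] := @geometric_cvg R false (R^o : completeNormedModType R) (f \o a) c.
    by move=> n; rewrite /nrm /= -fB; apply: le_trans (fm _) (ha n).
  by exists l.
have [|//|l1 h1] := part re; first exact: reB.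
  exact: re_norm_ge.
have im_le (z : K) : `|re (- (iu * z))| <= mag z.
  apply: le_trans (re_norm_ge _) _; rewrite normrN normrM.
  rewrite -magK reM_real; apply: ler_piMl (mag_ge0 _) _; exact: iu_norm.
have [||l2 h2] := part (fun z => re (- (iu * z))) => //.
  by move=> z w; rewrite mulrBr opprB reB !reN; ring.
exists (of_real cplx l1 + of_real cplx l2 * iu) => e e0.
have [N1 hN1] := h1 _ (divr_gt0 e0 (ltr0Sn R 1)).
have [N2 hN2] := h2 _ (divr_gt0 e0 (ltr0Sn R 1)).
exists (maxn N1 N2) => k; rewrite geq_max => /andP[/hN1 k1 /hN2 k2].
rewrite (scalar_split (a k)) opprD addrACA -mulrBl -!of_realB /mag.
apply: le_trans (re_le (ler_normD _ _)) _; rewrite reD normrM !norm_of_real re_of_real reM_real.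
rewrite (splitr e); apply: lerD => //; apply: le_trans k2.
by rewrite ler_piMr // iu_norm.
Qed.

Variable g : nat -> V.
Hypothesis gb : schauder_basis g.
Hypothesis gs : seminormalized g.

Local Notation expand a y := (tendsto (fun m => \sum_(i < m) a i *: g i) y).

(** Banach's theorem on the continuity of the coordinates of a Schauder basis:
    by Baire's argument the vectors whose partial sums are bounded by some [n]
    are dense in a ball, hence every vector is the sum of a rapidly converging
    series of such vectors; by uniqueness, expanding termwise gives its
    expansion. *)
Lemma coordinate_bound : exists2 beta : R, 0 < beta &
  forall (n : nat) (a : nat -> K) i, (i < n)%N ->
    mag (a i) <= beta * nrm (\sum_(j < n) a j *: g j).
Proof.
have [c0 [d0' [c00 gc]]] := gs.
have {}gc n : c0 <= nrm (g n) by rewrite -(of_real_le cplx) nrmK; have [] := gc n.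
have /choice[co coP] : forall y : V, exists a : nat -> K,
    expand a y /\ forall b : nat -> K, expand b y -> b = a.
  move=> y; have [a [ha ua]] := gb y.
  have E b : (series (fun n => b n *: g n) @ \oo --> y) <-> expand b y.
    by rewrite -tendstoP /series; under eq_fun do rewrite big_mkord.
  by exists a; split; [exact/E|move=> b /E/ua].
have coE y : expand (co y) y by have [] := coP y.
have coU (y : V) (b : nat -> K) : expand b y -> co y = b.
  by move=> h; have [_ /(_ b h) ->] := coP y.
pose S m y := \sum_(i < m) co y i *: g i.
have coB y y' : co (y - y') = fun i => co y i - co y' i.
  apply: coU; have := tendstoD (coE y) (tendstoZ (- 1) (coE y')).
  rewrite scaleN1r; congr (tendsto _ _); apply/funext => m.
  rewrite scaleN1r -sumrB; apply: eq_bigr => i _; by rewrite scalerBl.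
have coZ a y : co (a *: y) = fun i => a * co y i.
  apply: coU; have := tendstoZ a (coE y); congr (tendsto _ _); apply/funext => m.
  by rewrite scaler_sumr; apply: eq_bigr => i _; rewrite scalerA.
have SB m y y' : S m (y - y') = S m y - S m y'.
  by rewrite /S coB -sumrB; apply: eq_bigr => i _; rewrite scalerBl.
have SZ m a y : S m (a *: y) = a *: S m y.
  by rewrite /S coZ scaler_sumr; apply: eq_bigr => i _; rewrite scalerA.
have S0 m : S m 0 = 0 by have := SB m 0 0; rewrite !subrr.
have SD m y y' : S m (y + y') = S m y + S m y'.
  by rewrite -{1}(opprK y') SB -(sub0r y') SB S0 sub0r opprK.
have Sbnd y : exists n : nat, forall m, nrm (S m y) <= n%:R.
  have [N hN] := coE y 1 ltr01.
  pose B := \sum_(m < N) nrm (S m y) + (1 + nrm y).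
  exists (Num.truncn B).+1 => m; apply: le_trans (ltW (Num.Theory.truncnS_gt B)).
  have sge : 0 <= \sum_(m < N) nrm (S m y) by apply: sumr_ge0 => i _; exact: nrm_ge0.
  have [Nm|mN] := leqP N m.
    have := hN m Nm; rewrite -/(S m y) => h.
    have := nrmD (S m y - y) y; rewrite subrK /B; lra.
  rewrite /B (bigD1 (Ordinal mN)) //= -addrA lerDl addr_ge0 //.
    by apply: sumr_ge0 => i _; exact: nrm_ge0.
  by rewrite addr_ge0 // nrm_ge0.
pose A (n : nat) y := forall m, nrm (S m y) <= n%:R.
(* otherwise nested balls, the [k]-th of which avoids [A k], would shrink to a
   point that lies in some [A n] *)
have [n [y0 [r [r0 dens]]]] : exists n y0 (r : R), 0 < r /\
    forall y, nrm (y - y0) < r -> forall e, 0 < e -> exists2 z, A n z & nrm (y - z) <= e.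
  apply: contrapT => nd.
  have step (p : nat * (V * R)) : exists q : V * R, 0 < p.2.2 ->
      [/\ 0 < q.2, q.2 <= p.2.2 / 2, nrm (q.1 - p.2.1) <= p.2.2 / 4 &
        forall z, A p.1 z -> q.2 < nrm (q.1 - z)].
    have [p0|p0] := ltP 0 p.2.2; last by exists p.2; rewrite ltNge p0.
    apply: contrapT => /forallNP nq; apply: nd.
    exists p.1, p.2.1, (p.2.2 / 4); split; first exact: divr_gt0.
    move=> y hy e e0; apply: contrapT => /forall2NP nz.
    apply: (nq (y, Num.min e (p.2.2 / 2))) => _ /=; split.
    - by rewrite lt_min e0 divr_gt0.
    - by rewrite ge_min lexx orbT.
    - exact: ltW.
    - move=> z Az; case: (nz z) => // /negP; rewrite -ltNge; apply: le_lt_trans.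
      by rewrite ge_min lexx.
  have [f fP] := choice step.
  pose p := fix p k := if k is j.+1 then f (j, p j) else ((0 : V), (1 : R)).
  have p0 k : 0 < (p k).2 by elim: k => //= k IH; have [] := fP (k, p k) IH.
  have pS k := fP (k, p k) (p0 k).
  have phalf k j : (p (k + j)%N).2 <= (p k).2 * 2^-1 ^+ j.
    elim: j => [|j IH]; first by rewrite addn0 expr0 mulr1.
    rewrite addnS exprS; have [_ h _ _] := pS (k + j)%N.
    apply: le_trans h _; move: IH; set X := (_ ^+ j); rewrite /=; lra.
  have close k : exists l, tendsto (fun j => (p (k + j)%N).1) l /\ nrm ((p k).1 - l) <= (p k).2 / 2.
    have [|l [hl dl]] := @geometric_cvg R cplx V (fun j => (p (k + j)%N).1) ((p k).2 / 4).
      move=> j; rewrite addnS; have [_ _ h _] := pS (k + j)%N.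
      apply: le_trans h _; have := phalf k j; rewrite /=; set X := (_ ^+ j); lra.
    exists l; split=> //; have := dl 0%N; rewrite addn0 expr0; lra.
  have [l [hl _]] := close 0%N.
  have [n An] := Sbnd l.
  have [l' [hl' dl']] := close n.+1.
  have ll : l' = l.
    apply: tendsto_uniq hl' _ => e e0; have [N hN] := hl e e0.
    by exists N => j Nj; apply: (hN (n.+1 + j)%N); exact: leq_trans Nj (leq_addl _ _).
  have [_ _ _ h] := pS n; have := h l An; rewrite -/(p n.+1) -ll ltNge.
  by rewrite (le_trans dl') // ler_pdivrMr // ler_peMr ?ltW // ltr1n.
(* differences of points of [A n] near [y0] are dense near the origin, and
   scaling reaches every vector *)
pose D : R := 4 * n%:R / r + 1.
have D0 : 0 < D by rewrite ltr_wpDl // divr_ge0 ?mulr_ge0 // ltW.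
have appr y e : 0 < e -> exists z, nrm (y - z) <= e /\ forall m, nrm (S m z) <= D * nrm y.
  move=> e0; have [t0|t0] := ltP 0 (nrm y); last first.
    have y0' : nrm y = 0 by apply/eqP; rewrite eq_le t0 nrm_ge0.
    exists 0; split; first by rewrite subr0 y0' ltW.
    by move=> m; rewrite S0 nrm0 y0' mulr0.
  pose s := r / (2 * nrm y).
  have s0 : 0 < s by rewrite divr_gt0 // mulr_gt0.
  have e2 : 0 < e * s / 2 by rewrite divr_gt0 // mulr_gt0.
  have [|z1 Az1 d1] := dens (y0 + of_real cplx s *: y) _ _ e2.
    rewrite addrC addKr nrm_sc gtr0_norm //.
    by rewrite /s -mulrA invfM -mulrA mulVf ?gt_eqF // mulr1 ltr_pdivrMr // ltr_pMr // ltr1n.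
  have [|z0 Az0 d0] := dens y0 _ _ e2; first by rewrite subrr nrm0.
  exists (of_real cplx s^-1 *: (z1 - z0)); split.
    have -> : y - of_real cplx s^-1 *: (z1 - z0) =
        of_real cplx s^-1 *: ((y0 + of_real cplx s *: y - z1) - (y0 - z0)).
      rewrite !opprB [y0 + _]addrC -!addrA [y0 + _]addrCA [y0 + _]addrCA subrr addr0.
      rewrite [RHS]scalerDr scalerA -of_realM mulVf ?gt_eqF // of_real1 scale1r.
      by rewrite -scalerN opprB (addrC z0).
    rewrite nrm_sc gtr0_norm ?invr_gt0 // mulrC ler_pdivrMr //.
    have := nrmD (y0 + of_real cplx s *: y - z1) (- (y0 - z0)); rewrite nrmN; lra.
  move=> m; rewrite SZ SB nrm_sc gtr0_norm ?invr_gt0 //.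
  have h1 := Az1 m; have h0 := Az0 m; have := nrmD (S m z1) (- S m z0); rewrite nrmN => h.
  apply: (@le_trans _ _ (s^-1 * (2 * n%:R))).
    by apply: ler_wpM2l; [rewrite invr_ge0 ltW|lra].
  have -> : s^-1 * (2 * n%:R) = 4 * n%:R / r * nrm y.
    by rewrite /s invfM invrK; field; rewrite gt_eqF.
  by apply: ler_wpM2r; [exact: nrm_ge0|rewrite /D lerDl].
(* [y] is the sum of corrections [z] whose partial sums are at most
   [D t 2^-k], and the expansions of the corrections add up to that of [y] *)
have Sle y m : nrm (S m y) <= 2 * D * nrm y.
  have [t0|t0] := ltP 0 (nrm y); last first.
    have -> : y = 0 by apply: nrm0_eq; apply/eqP; rewrite eq_le t0 nrm_ge0.
    by rewrite S0 nrm0 mulr0.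
  pose t := nrm y.
  have /choice[z hz] : forall ky : nat * V, exists z,
      nrm (ky.2 - z) <= t * 2^-1 ^+ ky.1.+1 /\ forall m, nrm (S m z) <= D * nrm ky.2.
    by move=> ky; apply: appr; rewrite mulr_gt0 // exprn_gt0.
  pose w := fix w k := if k is j.+1 then w j + z (j, y - w j) else 0.
  have wy k : nrm (y - w k) <= t * 2^-1 ^+ k.
    case: k => [|k] /=; first by rewrite subr0 expr0 mulr1.
    by have [h _] := hz (k, y - w k); move: h; rewrite /= opprD addrA.
  have Sz k j : nrm (S j (w k.+1) - S j (w k)) <= D * t * 2^-1 ^+ k.
    rewrite /= SD addrC addKr; have [_ h] := hz (k, y - w k).
    apply: le_trans (h j) _; rewrite -mulrA; apply: ler_wpM2l; [exact: ltW|exact: wy].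
  have cw i k : mag (co (w k.+1) i - co (w k) i) <= 2 * D * t / c0 * 2^-1 ^+ k.
    have e : (co (w k.+1) i - co (w k) i) *: g i =
        (S i.+1 (w k.+1) - S i.+1 (w k)) - (S i (w k.+1) - S i (w k)).
      rewrite -!SB {1}/S big_ord_recr /= -/(S i _) [S i _ + _]addrC addrK.
      by rewrite coB.
    have := nrmD (S i.+1 (w k.+1) - S i.+1 (w k)) (- (S i (w k.+1) - S i (w k))).
    rewrite nrmN -e nrmZ => h.
    have h1 := Sz k i.+1; have h2 := Sz k i; have h3 := gc i.
    rewrite mulrAC ler_pdivlMr //; apply: (@le_trans _ _ (mag (co (w k.+1) i - co (w k) i) * nrm (g i))).
      by apply: ler_wpM2l => //; exact: mag_ge0.
    move: h1 h2 h; set P := 2^-1 ^+ k; set N1 := nrm _; set N2 := nrm _; set N3 := _ * _.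
    by move=> h1 h2 h; apply: le_trans h _; rewrite (_ : 2 * D * t * P = N3 + N3); [exact: lerD|rewrite /N3; ring].
  have /choice[c cP] : forall i, exists l, forall e : R, 0 < e -> exists N, forall k, (N <= k)%N ->
      mag (co (w k) i - l) <= e by move=> i; exact: scalar_geometric (cw i).
  have Sc j : tendsto (fun k => S j (w k)) (\sum_(i < j) c i *: g i).
    elim: j => [|j IH].
      by move=> e e0; exists 0%N => k _; rewrite /S !big_ord0 subrr nrm0 ltW.
    have : tendsto (fun k => S j (w k) + co (w k) j *: g j) (\sum_(i < j) c i *: g i + c j *: g j).
      apply: tendstoD IH _ => e e0.
      have g0 : 0 < nrm (g j) by exact: lt_le_trans (gc j).
      have [N hN] := cP j (e / nrm (g j)) (divr_gt0 e0 g0).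
      by exists N => k /hN; rewrite -scalerBl nrmZ ler_pdivlMr.
    by rewrite [in X in _ -> X]big_ord_recr; congr (tendsto _ _); apply/funext => k; rewrite /S big_ord_recr.
  have lim j : forall k, nrm (S j (w k) - \sum_(i < j) c i *: g i) <= 2 * (D * t) * 2^-1 ^+ k.
    have [|l [hl dl]] := @geometric_cvg R cplx V (fun k => S j (w k)) (D * t).
      by move=> k; exact: Sz.
    by rewrite (tendsto_uniq (Sc j) hl).
  have cE : co y = c.
    apply: coU => e e0.
    have e3 : 0 < e / 3 by exact: divr_gt0.
    have [N1 hN1] := half_pow_small (2 * (D * t)) e3.
    have [N2 hN2] := half_pow_small t e3.
    pose k := maxn N1 N2.
    have h1 := hN1 k (leq_maxl _ _); have h2 := hN2 k (leq_maxr _ _).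
    have [N3 hN3] := coE (w k) _ e3.
    exists N3 => j /hN3; rewrite -/(S j _) => h3.
    have h4 := lim j k; have h5 := wy k.
    have -> : \sum_(i < j) c i *: g i - y = (S j (w k) - w k)
       - (S j (w k) - \sum_(i < j) c i *: g i) - (y - w k).
      by rewrite !opprB (addrC (S j (w k) - w k)) !subrKA.
    have := nrmD (S j (w k) - w k - (S j (w k) - \sum_(i < j) c i *: g i)) (- (y - w k)).
    have := nrmD (S j (w k) - w k) (- (S j (w k) - \sum_(i < j) c i *: g i)).
    rewrite !nrmN; move: h1 h2 h3 h4 h5; rewrite -/k; lra.
  have -> : S m y = - (S m (w 0%N) - \sum_(i < m) c i *: g i).
    by rewrite /= S0 sub0r opprK /S cE.
  by rewrite nrmN; have := lim m 0%N; rewrite expr0 mulr1 mulrA.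
exists (4 * D / c0); first by rewrite divr_gt0 // mulr_gt0.
move=> N a i iN; set y := \sum_(j < N) _.
have cy : co y = fun j => if (j < N)%N then a j else 0.
  apply: coU => e e0; exists N => m Nm.
  suff -> : \sum_(i < m) (if (i < N)%N then a i else 0) *: g i = y.
    by rewrite subrr nrm0 ltW.
  rewrite -(big_mkord xpredT (fun i => (if (i < N)%N then a i else 0) *: g i)).
  rewrite (@big_cat_nat _ _ _ N) //= [X in _ + X]big_nat_cond [X in _ + X]big1; last first.
    by move=> j /andP[/andP[Nj _] _]; rewrite ltnNge Nj scale0r.
  by rewrite addr0 big_mkord; apply: eq_bigr => j _; rewrite ltn_ord.
have e : a i *: g i = S i.+1 y - S i y.
  by rewrite {1}/S big_ord_recr /= -/(S i y) (addrC (S i y)) addrK cy iN.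
rewrite mulrAC ler_pdivlMr //; apply: (@le_trans _ _ (mag (a i) * nrm (g i))).
  by apply: ler_wpM2l; [exact: mag_ge0|exact: gc].
rewrite -nrmZ e; have := nrmD (S i.+1 y) (- S i y); rewrite nrmN.
have := Sle y i; have := Sle y i.+1; rewrite -!mulrA; lra.
Qed.
End Basis.

(** * Averages and domination *)

Section FiniteSums.
Variable R : realType.

Lemma ler_fsum (A : set nat) (f h : nat -> R) : finite_set A ->
  (forall i, A i -> f i <= h i) -> \sum_(i \in A) f i <= \sum_(i \in A) h i.
Proof.
move=> fA fh; rewrite !fsbig_finite // big_seq [leRHS]big_seq; apply: ler_sum => i.
by rewrite in_fset_set // inE; exact: fh.
Qed.

Lemma fsum_mulr (A : set nat) (f : nat -> R) (c : R) : finite_set A ->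
  \sum_(i \in A) (f i * c) = (\sum_(i \in A) f i) * c.
Proof. by move=> fA; rewrite !fsbig_finite // mulr_suml. Qed.

Definition weight (p : probability nat R) (j : nat) : R := fine (p [set j]).

Lemma weightE (p : probability nat R) j : (p [set j] = (weight p j)%:E)%E.
Proof. by rewrite /weight fineK // fin_num_measure. Qed.

Lemma weight_ge0 (p : probability nat R) j : 0 <= weight p j.
Proof. by rewrite -lee_fin -weightE. Qed.

Lemma measure_weight (p : probability nat R) (A : set nat) : finite_set A ->
  (p A = (\sum_(j \in A) weight p j)%:E)%E.
Proof.
move=> fA; have {1}-> : A = \bigcup_(i in A) [set i].
  by apply/seteqP; split=> [x Ax|x [y Ay ->]//]; exists x.
rewrite measure_fin_bigcup //; last first.
  by apply/trivIsetP => i j _ _ ij; apply/seteqP; split=> // x [-> ji]; move: ij; rewrite ji eqxx.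
by rewrite -fsumEFin //; apply: eq_fsbigr => i _; exact: weightE.
Qed.

Lemma weight_sum (p : probability nat R) : finite_set (supp p) ->
  \sum_(j \in supp p) weight p j = 1.
Proof.
by move=> fS; apply: EFin_inj; rewrite -measure_weight // nat_measure_supp.
Qed.

(** Markov's inequality: the values below [v] are replaced by [v], the others by
    [m]. *)
Lemma average_le (p : probability nat R) (w : nat -> R) (m v : R) :
  finite_set (supp p) -> (forall j, supp p j -> w j <= m) ->
  \sum_(j \in supp p) (weight p j * w j) <=
    v + (m - v) * \sum_(j \in supp p `&` [set j | v <= w j]) weight p j.
Proof.
move=> fS wm; rewrite (fsbigID [set j | v <= w j]) //=.
have fA : finite_set (supp p `&` [set j | v <= w j]) by apply: sub_finite_set fS => x [].
have fB : finite_set (supp p `&` ~` [set j | v <= w j]) by apply: sub_finite_set fS => x [].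
have h1 := ler_fsum (f := fun j => weight p j * w j) (h := fun j => weight p j * m) fA.
have h2 := ler_fsum (f := fun j => weight p j * w j) (h := fun j => weight p j * v) fB.
rewrite !fsum_mulr // in h1 h2.
have := weight_sum fS; rewrite (fsbigID [set j | v <= w j]) //= => e.
set a := (\sum_(i \in _ `&` [set _ | _]) weight p i) in h1 e *.
set b := (\sum_(i \in _ `&` ~` _) weight p i) in h2 e *.
apply: (@le_trans _ _ (a * m + b * v)).
  apply: lerD; first by apply: h1 => j [sj _]; apply: ler_wpM2l; [exact: weight_ge0|exact: wm].
  apply: h2 => j [_ /= /negP]; rewrite -ltNge => wv.
  by apply: ler_wpM2l; [exact: weight_ge0|exact: ltW].
have -> : b = 1 - a by rewrite -e addrAC subrr add0r.
by rewrite [leLHS](_ : _ = v + (m - v) * a) //; ring.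
Qed.

End FiniteSums.

Section Averages.
Variables (R : realType) (cplx : bool) (X : completeNormedModType (scalar_field R cplx)).
Variable Q : prob_block R.
Local Notation K := (scalar_field R cplx).
Local Notation q := (block_meas Q).
Implicit Types (x : nat -> X) (u : X -> R) (N : set nat).

Lemma functional_avg u (a : K) x N i : dual_ball u -> infinite_set N ->
  u (a *: block_avg Q N x i) =
  \sum_(j \in supp (q N i)) (weight (q N i) j * u (a *: x j)).
Proof.
move=> [uD uZ _] iN; have fS := supp_finite Q i iN.
rewrite /block_avg !fsbig_finite //= scaler_sumr.
have u0 : u 0 = 0 by rewrite -(scale0r 0) -(of_real0 R cplx) uZ mul0r.
rewrite (big_morph u uD u0); apply: eq_bigr => j _.
by rewrite scalerA mulrC -scalerA uZ.
Qed.

Lemma functional_avg_ge u (a : K) x N i (v : R) : dual_ball u -> infinite_set N ->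
  (forall j, supp (q N i) j -> v <= u (a *: x j)) ->
  v <= u (a *: block_avg Q N x i).
Proof.
move=> ub iN h; rewrite functional_avg //; have fS := supp_finite Q i iN.
rewrite -[v]mul1r -(weight_sum fS) -fsum_mulr //; apply: ler_fsum => // j sj.
by apply: ler_wpM2l; [exact: weight_ge0|exact: h].
Qed.

Lemma functional_le u (a : K) (z : X) : dual_ball u -> nrm z <= 1 ->
  `|u (a *: z)| <= mag a.
Proof.
move=> [_ _ ub] z1; apply: le_trans (ub _) _; rewrite nrmZ.
by apply: ler_piMr (mag_ge0 _) z1.
Qed.

(** With [m = mag a] the values of [u] lie between [-m] and [m], so
    [m - v <= (2 + e) m].  If the set had measure at most [e / (e + 3)], the
    average would be at most [v + (2 + e) m e / (e + 3)], which is less than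
    [v + e m]. *)
Lemma functional_large u (a : K) x N i (e : R) : dual_ball u -> infinite_set N ->
  (forall j, nrm (x j) <= 1) -> 0 < e ->
  let v := u (a *: block_avg Q N x i) - e * mag a in
  v <= mag a /\
  ~ (q N i (supp (q N i) `&` [set j | (v <= u (a *: x j))%R]) <= (e / (e + 3))%:E)%E.
Proof.
move=> ub iN x1 e0 v; have fS := supp_finite Q i iN.
have m0 := mag_ge0 a.
have wm j : u (a *: x j) <= mag a.
  by apply: le_trans (ler_norm _) _; exact: functional_le.
have lb j : - mag a <= u (a *: x j).
  by have := functional_le a ub (x1 j); rewrite ler_norml => /andP[].
have av_ge : - mag a <= u (a *: block_avg Q N x i) by exact: functional_avg_ge.
have av_le : u (a *: block_avg Q N x i) <= mag a.
  have := @functional_avg_ge u (- a) x N i (- mag a) ub iN.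
  rewrite scaleNr; have [uD uZ _] := ub.
  have uN z : u (- z) = - u z.
    by rewrite -scaleN1r -(of_real1 R cplx) -of_realN uZ mulN1r.
  rewrite uN lerN2; apply => j _; by rewrite scaleNr uN lerN2.
have em : 0 <= e * mag a by rewrite mulr_ge0 // ltW.
split; first by rewrite /v; lra.
rewrite measure_weight; last by apply: sub_finite_set fS => j [].
rewrite lee_fin => s_le.
have := @average_le R (q N i) (fun j => u (a *: x j)) (mag a) v fS (fun j _ => wm j).
rewrite -functional_avg //; move: s_le; set s := (\sum_(j \in _) _) => s_le.
have s0 : 0 <= s.
  by rewrite /s fsbig_finite; [apply: sumr_ge0 => j _; exact: weight_ge0|apply: sub_finite_set fS => j []].
have e3 : 0 < e + 3 by rewrite addr_gt0.
have [a0|a0] := eqVneq (mag a) 0.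
  move=> _; move: s_le; rewrite /s.
  have -> : supp (q N i) `&` [set j | v <= u (a *: x j)] = supp (q N i).
    apply/setIidl => j _ /=; rewrite /v a0 mulr0 subr0.
    have h1 := lb j; have h2 := wm j; move: av_ge av_le h1 h2; rewrite a0; lra.
  by rewrite weight_sum // ler_pdivlMr // mul1r; lra.
have ap : 0 < mag a by rewrite lt_neqAle eq_sym a0.
rewrite {1}[u _](_ : _ = v + e * mag a); last by rewrite /v; ring.
rewrite lerD2l => h.
have mv : mag a - v <= (2 + e) * mag a by rewrite /v; nra.
have : e * mag a <= (2 + e) * mag a * (e / (e + 3)).
  apply: le_trans h _; apply: (@le_trans _ _ ((2 + e) * mag a * s)); first exact: ler_wpM2r.
  by apply: ler_wpM2l s_le; rewrite mulr_ge0 // addr_ge0 // ltW.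
have -> : (2 + e) * mag a * (e / (e + 3)) = e * mag a * ((2 + e) / (e + 3)) by field; rewrite gt_eqF.
by rewrite ler_pMr ?mulr_gt0 // ler_pdivlMr // mul1r; lra.
Qed.

End Averages.

Section Domination.
Variables (R : realType) (cplx : bool).
Variables (X G : completeNormedModType (scalar_field R cplx)).
Local Notation K := (scalar_field R cplx).
Implicit Types (x : nat -> X) (g : nat -> G).

Lemma C_dominatedP (C : R) x g : C_dominated C x g <->
  forall (n : nat) (a : nat -> K),
    nrm (\sum_(i < n) a i *: x i) <= C * nrm (\sum_(i < n) a i *: g i).
Proof.
by split=> h n a; have := h n a; rewrite -(nrmK (\sum_(i < n) a i *: g i)) -of_realM nrm_leE.
Qed.

Lemma not_dominated (C : R) x g : ~ C_dominated C x g -> exists (n : nat) (a : nat -> K),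
  C * nrm (\sum_(i < n) a i *: g i) < nrm (\sum_(i < n) a i *: x i).
Proof.
move=> h; apply: contrapT => nh; apply: h; apply/C_dominatedP => n a.
by rewrite leNgt; apply/negP => lt; apply: nh; exists n, a.
Qed.

(** Failure of domination is witnessed by finitely many blocks, so it is an open
    condition on the index set. *)
Lemma not_dominated_open (Q : prob_block R) (C : R) x g :
  open_family [set N | ~ C_dominated C (block_avg Q N x) g].
Proof.
move=> N iN /not_dominated[n [a lt]].
have /choice[b hb] : forall i, exists b, supp (block_meas Q N i) `<=` `I_b.
  by move=> i; exact: finite_bound (supp_finite Q i iN).
exists (\max_(i < n) b i) => N' iN' ag /C_dominatedP/(_ n a).
suff e i : (i < n)%N -> block_avg Q N' x i = block_avg Q N x i.
  by under eq_bigr => i _ do rewrite e //; rewrite leNgt lt.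
move=> iN_; have eq : block_meas Q N' i =1 block_meas Q N i.
  apply: (block_local (Q := Q) iN iN' ag _ iN_) => k y kn /hb /= yb.
  apply: leq_trans (ltnW yb) _; exact: (leq_bigmax (F := fun i : 'I_n => b i) (Ordinal kn)).
by rewrite /block_avg (supp_eq eq); apply: eq_fsbigr => j _; rewrite eq.
Qed.

End Domination.

(** * Transfer of a failure from one block to another *)

Section Transfer.
Variables (R : realType) (cplx : bool) (xi : ord) (P Q : prob_block R).
Variables (X G : completeNormedModType (scalar_field R cplx)) (g : nat -> G).
Local Notation K := (scalar_field R cplx).
Hypothesis xi0 : ord_lt OZero xi.
Hypothesis homP : homogeneous xi P.
Hypothesis homQ : homogeneous xi Q.
Variables (d : R) (eps : nat -> R).
Hypothesis eps0 : forall i, 0 < eps i.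
Hypothesis eps_dec : forall i j, (i <= j)%N -> eps j <= eps i.
Hypothesis eps_sum : forall (n : nat) (a : nat -> K),
  \sum_(i < n) eps i * mag (a i) <= d * nrm (\sum_(i < n) a i *: g i).
Variables (x : nat -> nat -> X) (L : nat -> set nat) (c : nat -> R).
Hypothesis xw : forall l, weakly_null (x l).
Hypothesis x1 : forall l j, nrm (x l j) <= 1.
Hypothesis iL : forall l, infinite_set (L l).
Hypothesis bad : forall l N, inf_subsets (L l) N ->
  ~ C_dominated (c l + d) (block_avg Q N (x l)) g.

Let U := {u : X -> R | dual_ball u}.

(** The lower bounds [v i] hold pointwise on [Es i], so averages with respect to
    any measures carried by these sets inherit them: this is what allows one
    block to replace another. *)
Definition violation (C : R) (y : nat -> X) (n : nat) (Es : nat -> set nat)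
    (u : U) (a : nat -> K) (v : nat -> R) : Prop :=
  C * nrm (\sum_(i < n) a i *: g i) < \sum_(i < n) v i /\
  forall i, (i < n)%N ->
    v i <= mag (a i) /\ forall j, Es i j -> v i <= sval u (a i *: y j).

Let Wit C y n Es (u : U) := exists a v, violation C y n Es u a v.

Let WitS C y n Es Es' u : (forall i, (i < n)%N -> Es' i `<=` Es i) ->
  Wit C y n Es u -> Wit C y n Es' u.
Proof.
move=> ES [a [v [h1 h2]]]; exists a, v; split=> // i iN.
by have [h3 h4] := h2 i iN; split=> // j /(ES i iN); exact: h4.
Qed.

Lemma violation_large (C : R) (y : nat -> X) N : (forall j, nrm (y j) <= 1) ->
  infinite_set N -> ~ C_dominated (C + d) (block_avg Q N y) g ->
  exists n (u : U) (Es : nat -> set nat),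
    (forall i, (i < n)%N -> Es i `<=` supp (block_meas Q N i) /\
       ~ (block_meas Q N i (Es i) <= (eps i / (eps i + 3))%:E)%E)
    /\ exists a v, violation C y n Es u a v.
Proof.
move=> y1 iN /not_dominated[n [a lt]].
have [u ub uz] := Hahn_Banach (\sum_(i < n) a i *: block_avg Q N y i).
pose v i := u (a i *: block_avg Q N y i) - eps i * mag (a i).
pose Es i := supp (block_meas Q N i) `&` [set j | v i <= u (a i *: y j)].
exists n, (exist _ u ub), Es; split.
  move=> i _; split; first by move=> j [].
  by have [_ h] := functional_large Q (a i) i ub iN y1 (eps0 i).
exists a, v; split.
  rewrite /v sumrB -(dual_ball_sum n (fun i => a i *: block_avg Q N y i) ub) uz.
  have := eps_sum n a; move: lt; rewrite mulrDl; lra.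
move=> i _; split; last by move=> j [].
by have [h _] := functional_large Q (a i) i ub iN y1 (eps0 i).
Qed.

(** The index of row [l] is reached in two steps: [lam l] enumerates the set on
    which domination fails, and the combinatorial lemmas are applied to the
    positions in this enumeration.  The one-point enlargement of the family of
    [P] is therefore pulled back along each [lam l]. *)
Lemma transfer : exists phi : nat -> nat -> nat, (forall l j, (j <= phi l j)%N) /\
  forall k N, infinite_set N -> exists n (u : X -> R) (a : nat -> K) (v : nat -> R),
    [/\ dual_ball u,
      c k * nrm (\sum_(i < n) a i *: g i) < \sum_(i < n) v i,
      forall i, (i < n)%N -> v i <= mag (a i)
    & forall i j, (k <= i < n)%N -> supp (block_meas P N i) j ->
        v i <= u (a i *: x k (phi k j)) /\
        forall l, (l <= j)%N -> l != k ->
          `|u (a i *: x l (phi l j))| <= 2 * eps i * mag (a i)].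
Proof.
have [rP _ _] := block_nice P; have [fP sP hP cP] := rP.
have eP := compact_exits fP cP.
pose H := plus_one (block_fam P).
have H0 : H set0 by left.
have Hhd : forall c b, H b -> H (hd c b) by move=> c' b; exact: plus_one_hd.
have Hexits : exits H by exact: plus_one_exits.
have Hsmall p (e : R) : 0 < e -> forall M, infinite_set M ->
    exists2 M', inf_subsets M M' & forall N E, inf_subsets M' N ->
      set_before [set p] E -> H ([set p] `|` E) -> (block_meas Q N 0 E <= e%:E)%E.
  by move=> e0 M iM; exact: plus_one_small xi0 homP homQ.1 _ e0 _ iM.
have /choice[lam lamP] : forall l, exists f : nat -> nat,
    (forall i, L l (f i)) /\ {homo f : i j / (i < j)%N} by move=> l; exact: inf_enum.
have lamL l i : L l (lam l i) by have [] := lamP l.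
have lam_lt l y z : (y < z)%N -> (lam l y < lam l z)%N by have [_ h] := lamP l; exact: h.
have lamge l y : (y <= lam l y)%N by exact: lam_ge (lam_lt l) y.
pose F l := [set b : set nat | H (lam l @` b)].
pose W l n Es u := Wit (c l) (fun j => x l (lam l j)) n Es u.
pose sm (u : U) (b m : nat) := forall l, (l <= b)%N ->
  `|sval u (x l (lam l m))| <= eps b /\ `|sval u (iu *: x l (lam l m))| <= eps b.
have smS u b b' m : sm u b m -> (b' <= b)%N -> sm u b' m.
  move=> h bb l lb; have [h1 h2] := h l (leq_trans lb bb).
  by split; [exact: le_trans h1 (eps_dec bb)|exact: le_trans h2 (eps_dec bb)].
have gap b S : infinite_set S -> exists c, forall u, exists2 m, S m /\ (m <= c)%N & sm u b m.
  move=> iS; have [c' hc] := weakly_null_gap b xw lamge (eps0 b) iS.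
  by exists c' => u; exact: hc _ (svalP u).
have thr i : 0 < eps i / (eps i + 3) < 1.
  have e0 := eps0 i; rewrite divr_gt0 ?addr_gt0 //=.
  by rewrite ltr_pdivrMr ?addr_gt0 // mul1r; lra.
have Fe l : exits (F l) by exact: pull_exits (lam_lt l) Hhd Hexits.
have Fh l c' b : F l b -> F l (hd c' b) by exact: pull_hd (lam_lt l) Hhd c' b.
have big l N : inf_subsets (range (lam l)) N -> exists n u (Es : nat -> set nat),
    (forall i, (i < n)%N -> Es i `<=` supp (block_meas Q N i) /\
      ~ (block_meas Q N i (Es i) <= (eps i / (eps i + 3))%:E)%E)
    /\ W l n (fun i => lam l @^-1` Es i) u.
  move=> [Nl iN]; have [|n [u [Es [h w]]]] := violation_large (x1 l) iN (bad (l := l) _).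
    by split=> // y /Nl[i _ <-].
  exists n, u, Es; split=> //; move: w => [a [v [w1 w2]]]; exists a, v; split=> // i iN_.
  by have [w3 w4] := w2 i iN_; split=> // j Ej; exact: w4.
have WS l n Es Es' u : (forall i, (i < n)%N -> Es' i `<=` Es i) -> W l n Es u -> W l n Es' u.
  exact: WitS.
have F0 l : F l set0 by rewrite /F /= image_set0.
have step (lS : nat * set nat) : exists T, infinite_set lS.2 -> inf_subsets lS.2 T /\
    forall E, inf_subsets T E -> exists n u,
      witnessed (W lS.1) (F lS.1) n E u /\ forall m b i, T m -> ~ E m -> T b ->
        (b < m)%N -> (i < n)%N -> (m <= cut (F lS.1) (rest (F lS.1) E i))%N -> sm u b m.
  have [iS|niS] := pselect (infinite_set lS.2); last by exists set0.
  have [T1 ST1 w1] := @thin_witnessed U (W lS.1) (@WS lS.1) R Q H (lam lS.1)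
    (fun i => eps i / (eps i + 3)) (lam_lt lS.1) H0 Hhd Hexits thr Hsmall (big lS.1) lS.2 iS.
  have [T2 T12 w2] := thin_small_witness (@WS lS.1) (@Fe lS.1) smS gap ST1.2 w1.
  by exists T2 => _; split; first exact: inf_subsets_trans T12.
have [f fP'] := choice step.
pose T := fix T k := f (k, if k is j.+1 then T j else [set: nat]).
have iT k : infinite_set (T k).
  elim: k => [|k IH]; last by have [[]] := fP' (k.+1, T k) IH.
  by have [[]] := fP' (0%N, [set: nat]) infinite_nat.
have TP k : inf_subsets (if k is j.+1 then T j else [set: nat]) (T k) /\
    forall E, inf_subsets (T k) E -> exists n u,
      witnessed (W k) (F k) n E u /\ forall m b i, T k m -> ~ E m -> T k b ->
        (b < m)%N -> (i < n)%N -> (m <= cut (F k) (rest (F k) E i))%N -> sm u b m.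
  case: k => [|k]; last exact: (fP' (k.+1, T k) (iT k)).
  exact: (fP' (0%N, [set: nat]) infinite_nat).
have Fspread k (A : set nat) q z0 (h : nat -> nat) :
    finite_set A -> block_fam P A -> A z0 -> (forall z, A z -> (z0 <= z)%N) ->
    (z0 <= q)%N -> (q < h z0)%N -> (forall z, A z -> (z <= h z)%N) ->
    (forall y z, A y -> A z -> (y < z)%N -> (h y < h z)%N) ->
    F k ([set q] `|` h @` A).
  move=> fA PA Az0 mz zq qh hge hh.
  rewrite /F /= image_setU image_set1 image_comp.
  apply: (@plus_one_spread _ _ (lam k q) z0) => //.
  - exact: leq_trans zq (lamge _ _).
  - exact: lam_lt.
  - by move=> z /hge zz; exact: leq_trans zz (lamge _ _).
  - by move=> y z Ay Az yz; apply: lam_lt; exact: hh.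
have [t [tge tP]] := @assembly R P U W F T sm WS F0 Fh Fe iT
  (fun k => (TP k.+1).1.1) (fun k => (TP k).2) Fspread.
exists (fun l j => lam l (t j l)); split.
  by move=> l j; exact: leq_trans (tge j l) (lamge _ _).
move=> k N iN; have [n [u [[a [v [w1 w2]]] smu]]] := tP k N iN.
exists n, (sval u), a, v; split=> //; first exact: (svalP u).
  by move=> i iN_; have [] := w2 i iN_.
move=> i j kin sj; have /andP[ki iN_] := kin; have [_ w3] := w2 i iN_; split.
  by apply: w3; rewrite ltnNge ki /=; exists j.
move=> l lj lk; have [b jb smb] := smu i j l kin sj lj lk.
have [s1 s2] := smb l (leq_trans lj jb).
apply: le_trans (dual_ball_scale _ _ (svalP u)) _; rewrite mulrC.
apply: ler_wpM2r; first exact: mag_ge0.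
have ij : (i <= b)%N by apply: leq_trans jb; exact: supp_ge sj.
by have := eps_dec ij; lra.
Qed.
End Transfer.

(** * Uniform domination *)

Section Conclusion.
Variables (R : realType) (cplx : bool).
Local Notation K := (scalar_field R cplx).
Variables (X G : completeNormedModType K) (g : nat -> G).
Hypothesis gb : schauder_basis g.
Hypothesis gs : seminormalized g.

(** The coordinates being bounded by [beta], the errors may be taken
    proportional to [2^-(i+1)]. *)
Lemma summable_errors (d : R) : 0 < d -> exists eps : nat -> R,
  [/\ forall i, 0 < eps i, forall i j, (i <= j)%N -> eps j <= eps i &
    forall (n : nat) (a : nat -> K),
      \sum_(i < n) eps i * mag (a i) <= d * nrm (\sum_(i < n) a i *: g i)].
Proof.
move=> d0; have [beta b0 hb] := coordinate_bound gb gs.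
have h0 : 0 < (2^-1 : R) by rewrite invr_gt0.
exists (fun i => d / beta * 2^-1 ^+ i.+1); split.
- by move=> i; rewrite mulr_gt0 ?divr_gt0 ?exprn_gt0.
- move=> i j ij; apply: ler_wpM2l; first by rewrite ltW // divr_gt0.
  by apply: ler_wiXn2l => //; rewrite invf_le1 // ler1n.
- move=> n a; set z := nrm _.
  have z0 : 0 <= z by exact: nrm_ge0.
  apply: (@le_trans _ _ (\sum_(i < n) d * z * 2^-1 ^+ i.+1)).
    apply: ler_sum => i _; have := hb n a i (ltn_ord i); rewrite -/z => h.
    have e0 : 0 <= (2^-1 : R) ^+ i.+1 by rewrite exprn_ge0 // ltW.
    have -> : d * z * 2^-1 ^+ i.+1 = d / beta * 2^-1 ^+ i.+1 * (beta * z).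
      by field; rewrite gt_eqF.
    apply: ler_wpM2l => //; rewrite mulr_ge0 //; apply: ltW; exact: divr_gt0.
  rewrite -mulr_sumr; apply: ler_piMr; first by rewrite mulr_ge0 // ltW.
  by have := half_sum R 0 n; rewrite big_mkord expr0.
Qed.

Lemma weakly_null_sub (x : nat -> X) (phi : nat -> nat) : weakly_null x ->
  (forall j, (j <= phi j)%N) -> weakly_null (x \o phi).
Proof.
move=> wx hphi f fc; apply/tendstoP => e e0; have /tendstoP/(_ e e0)[N hN] := wx f fc.
by exists N => n Nn; apply: hN; exact: leq_trans (hphi n).
Qed.

Lemma uniform_failure (Q : prob_block R) (C : R) : ~ uniformly_dominated Q X g C ->
  exists (x : nat -> X) (L : set nat), [/\ weakly_null x, forall n, nrm (x n) <= 1,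
    infinite_set L & forall N, inf_subsets L N -> ~ C_dominated C (block_avg Q N x) g].
Proof.
move=> h; apply: contrapT => nh; apply: h => x wx x1 L iL.
have [T LT [bad|good]] := open_Ramsey (@not_dominated_open R cplx X G Q C x g) iL.
  exfalso; apply: nh; exists x, T; split=> //; last exact: LT.2.
  by move=> n; rewrite -nrm_leE of_real1.
by exists T => // N TN; have /contrapT := good N TN.
Qed.

(** The case of [transfer] in which there is one row, repeated. *)
Lemma uniformly_dominated_block xi (P Q : prob_block R) (C D : R) :
  ord_lt OZero xi -> homogeneous xi P -> homogeneous xi Q -> C < D ->
  uniformly_dominated P X g C -> uniformly_dominated Q X g D.
Proof.
move=> xi0 hP hQ CD uP; apply: contrapT => /uniform_failure[x [L [wx x1 iL bad]]].
have d0 : 0 < D - C by rewrite subr_gt0.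
have [eps [eps0 epsd epss]] := summable_errors d0.
have [|phi [phige tr]] := @transfer R cplx xi P Q X G g xi0 hP hQ (D - C) eps
  eps0 epsd epss (fun=> x) (fun=> L) (fun=> C) (fun=> wx) (fun=> x1) (fun=> iL).
- by move=> _ N LN; rewrite addrCA subrr addr0; exact: bad.
have wy := weakly_null_sub wx (phige 0%N).
have y1 n : `|(x \o phi 0%N) n| <= 1 by rewrite -(of_real1 R cplx) nrm_leE; exact: x1.
have [M [_ iM] hM] := uP _ wy y1 _ infinite_nat.
have /C_dominatedP dom := hM M (inf_subsetsxx iM).
have [n [u [a [v [ub lt vm hv]]]]] := tr 0%N M iM.
have := dom n a; rewrite leNgt => /negP; apply.
apply: lt_le_trans lt _; have [_ _ un] := ub.
apply: le_trans (le_trans (ler_norm _) (un _)).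
rewrite (dual_ball_sum n (fun i => a i *: block_avg P M (x \o phi 0%N) i) ub).
apply: ler_sum => i _; apply: functional_avg_ge => // j sj.
by have [h _] := hv i j (ltn_ord i) sj.
Qed.

Definition superpose (x : nat -> nat -> X) (phi : nat -> nat -> nat) (j : nat) : X :=
  \sum_(l < j.+1) of_real cplx (2^-1 ^+ l.+1) *: x l (phi l j).

Lemma superpose_tail (x : nat -> nat -> X) phi m j : (forall l i, nrm (x l i) <= 1) ->
  nrm (\sum_(m <= l < j.+1) of_real cplx (2^-1 ^+ l.+1) *: x l (phi l j)) <= 2^-1 ^+ m.
Proof.
move=> x1; apply: le_trans (half_sum R m j.+1).
elim/big_rec2: _ => [|l y1 y2 _ IH]; first by rewrite nrm0.
apply: le_trans (nrmD _ _) _; apply: lerD => //.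
by rewrite nrmZ mag_real ger0_norm ?exprn_ge0 // ler_piMr ?exprn_ge0.
Qed.

Lemma superpose_le1 (x : nat -> nat -> X) phi j : (forall l i, nrm (x l i) <= 1) ->
  nrm (superpose x phi j) <= 1.
Proof.
by move=> x1; have := superpose_tail phi 0 j x1; rewrite big_mkord expr0.
Qed.

(** The tails are uniformly small in norm, and each row tends weakly to [0]. *)
Lemma superpose_weakly_null (x : nat -> nat -> X) phi : (forall l i, nrm (x l i) <= 1) ->
  (forall l, weakly_null (x l)) -> (forall l j, (j <= phi l j)%N) ->
  weakly_null (superpose x phi).
Proof.
move=> x1 xw phige f fc; apply/tendstoP => e e0.
have e2 : 0 < e / 2 by exact: divr_gt0.
have [d d0 hd] : exists2 d : R, 0 < d & forall z, nrm z <= d -> nrm (f z : K^o) <= e / 2.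
  have /cvgrPdist_le /(_ (of_real cplx (e / 2))) := fc 0.
  rewrite -{1}(of_real0 R cplx) of_real_lt => /(_ e2) /nbhs_ballP[d d0 hd].
  have d0' : 0 < re d by rewrite -(of_real_lt cplx) of_real0 re_ge0K // ltW.
  exists (re d / 2); first exact: divr_gt0.
  move=> z zd; have := hd z; rewrite linear0 sub0r normrN nrm_leE; apply.
  rewrite -ball_normE /= sub0r normrN -nrmK -(re_ge0K (ltW d0)) of_real_lt.
  by apply: le_lt_trans zd _; rewrite ltr_pdivrMr // ltr_pMr // ltr1n.
have [l0 hl0] := half_pow_small 1 d0.
pose h l j : K^o := f (of_real cplx (2^-1 ^+ l.+1) *: x l (phi l j)).
have h0 l (r : R) : 0 < r -> exists N, forall j, (N <= j)%N -> nrm (h l j) <= r.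
  move=> r0; have /tendstoP/(_ r r0)[N hN] := weakly_null_sub (xw l) (phige l) fc.
  exists N => j /hN; rewrite subr0 /h linearZ => hj; rewrite nrmZ mag_real.
  apply: le_trans hj; apply: ler_piMl (nrm_ge0 _) _.
  by rewrite ger0_norm ?exprn_ge0 // exprn_ile1 // invf_le1 // ler1n.
have [N hN] : exists N, forall j, (N <= j)%N -> nrm (\sum_(l < l0) h l j) <= e / 2.
  elim: l0 {hl0} (e / 2) e2 => [|m IH] r r0.
    by exists 0%N => j _; rewrite big_ord0 nrm0 ltW.
  have r2 : 0 < r / 2 by exact: divr_gt0.
  have [N1 hN1] := IH _ r2; have [N2 hN2] := h0 m _ r2.
  exists (maxn N1 N2) => j; rewrite geq_max => /andP[/hN1 a /hN2 b].
  by rewrite big_ord_recr /=; apply: le_trans (nrmD _ _) _; rewrite (splitr r) lerD.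
exists (maxn N l0) => j; rewrite geq_max => /andP[/hN a l0j]; rewrite subr0.
rewrite /superpose -(big_mkord xpredT (fun l => of_real cplx (2^-1 ^+ l.+1) *: x l (phi l j))).
rewrite (big_cat_nat (n := l0)) //= ?leqW // linearD big_mkord linear_sum.
apply: le_trans (nrmD _ _) _; rewrite (splitr e); apply: lerD; first exact: a.
apply: hd; apply: le_trans (superpose_tail phi l0 j x1) _.
by have := hl0 l0 (leqnn _); rewrite mul1r.
Qed.

(** The rows other than [k] contribute at most [r], as the weights add up to at
    most [1]. *)
Lemma superpose_ge (x : nat -> nat -> X) phi u (a : K) k j (v r : R) : dual_ball u ->
  (k <= j)%N -> v <= u (a *: x k (phi k j)) -> 0 <= r ->
  (forall l, (l <= j)%N -> l != k -> `|u (a *: x l (phi l j))| <= r) ->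
  2^-1 ^+ k.+1 * v - r <= u (a *: superpose x phi j).
Proof.
move=> ub kj hv r0 hr.
have uE (l : nat) z : u (a *: (of_real cplx (2^-1 ^+ l.+1) *: z)) = 2^-1 ^+ l.+1 * u (a *: z).
  by have [_ uZ _] := ub; rewrite scalerA mulrC -scalerA uZ.
rewrite /superpose scaler_sumr.
rewrite (dual_ball_sum j.+1 (fun l => a *: (of_real cplx (2^-1 ^+ l.+1) *: x l (phi l j))) ub).
have kj' : (k < j.+1)%N by [].
rewrite (bigD1 (Ordinal kj')) //= uE; apply: lerD.
  by apply: ler_wpM2l => //; rewrite exprn_ge0.
have s1 : \sum_(l < j.+1 | l != Ordinal kj') (2^-1 : R) ^+ l.+1 <= 1.
  rewrite -[leRHS](expr0 (2^-1)); apply: le_trans (half_sum R 0 j.+1); rewrite big_mkord.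
  by rewrite [leRHS](bigD1 (Ordinal kj')) //= lerDr exprn_ge0.
rewrite lerNl -sumrN; apply: (@le_trans _ _ (\sum_(l < j.+1 | l != Ordinal kj') 2^-1 ^+ l.+1 * r)).
  apply: ler_sum => l lk; rewrite uE -mulrN; apply: ler_wpM2l.
    by rewrite exprn_ge0.
  have := hr l; rewrite -ltnS ltn_ord => /(_ isT lk); rewrite ler_norml => /andP[]; lra.
by rewrite -mulr_suml ler_piMl.
Qed.

(** If no constant is uniform, choose for each [k] a failure of the constant
    [c k].  For the averages of the superposition, row [k] yields
    [w k * c k * nrm (\sum a i *: g i)], from which the other rows may take away
    twice this norm through the errors [eps], and the first [k] averages, where
    nothing is known, [2 k beta] times it.  The choice of [c k] leaves the
    constant [k], for arbitrary [k]. *)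
Lemma uniformly_dominated_ex xi (P : prob_block R) :
  ord_lt OZero xi -> homogeneous xi P ->
  (forall x : nat -> X, bounded_fun x -> weakly_null x ->
    exists2 M, infinite_set M & dominated (block_avg P M x) g) ->
  exists C : R, uniformly_dominated P X g C.
Proof.
move=> xi0 hP dom; apply: contrapT => /forallNP nu.
have [beta b0 hb] := coordinate_bound gb gs.
have [eps [eps0 epsd epss]] := summable_errors (ltr01 : 0 < (1 : R)).
pose w l : R := 2^-1 ^+ l.+1.
have w0 l : 0 < w l by rewrite exprn_gt0 // invr_gt0.
pose c k : R := (k%:R + 2 + 2 * (k%:R * beta)) / w k.
have /choice[x /choice[L xL]] : forall k, exists (x : nat -> X) (L : set nat),
    [/\ weakly_null x, forall n, nrm (x n) <= 1, infinite_set L &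
      forall N, inf_subsets L N -> ~ C_dominated (c k + 1) (block_avg P N x) g].
  by move=> k; apply: uniform_failure; exact: nu.
have xw l : weakly_null (x l) by have [] := xL l.
have x1 l j : nrm (x l j) <= 1 by have [] := xL l.
have [||phi [phige tr]] := @transfer R cplx xi P P X G g xi0 hP hP 1 eps eps0 epsd epss
  x L c xw x1.
- by move=> l; have [] := xL l.
- by move=> l N; have [_ _ _ h] := xL l; exact: h.
pose y := superpose x phi.
have yw : weakly_null y by exact: superpose_weakly_null x1 xw phige.
have y1 j : nrm (y j) <= 1 by exact: superpose_le1.
have [|M iM [D /C_dominatedP domD]] := dom y _ yw.
  exists 1; split; first exact: real1.
  move=> B B1 j _ /=; apply: le_trans (ltW B1).
  by rewrite -(of_real1 R cplx) nrm_leE; exact: y1.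
pose k := (Num.truncn D).+1.
have Dk : D < k%:R by exact: truncnS_gt.
have [n [u [a [v [ub lt vm hv]]]]] := tr k M iM.
have := domD n a; rewrite leNgt => /negP; apply.
set z := nrm (\sum_(i < n) a i *: g i) in lt *.
have z0 : 0 <= z by exact: nrm_ge0.
apply: le_lt_trans (ler_wpM2r z0 (ltW Dk)) _; have [_ _ un] := ub.
apply: lt_le_trans (le_trans (ler_norm _) (un _)).
rewrite (dual_ball_sum n (fun i => a i *: block_avg P M y i) ub).
(* for [i < k] only the bound [mag (a i) <= beta * z] is available, and it is
   used both for the value and for the missing [v i] *)
have lower (i : 'I_n) : w k * v i - 2 * (eps i * mag (a i))
    - (if (i < k)%N then 2 * (beta * z) else 0) <= u (a i *: block_avg P M y i).
  have e0 := eps0 i; have m0 := mag_ge0 (a i).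
  have em : 0 <= eps i * mag (a i) by rewrite mulr_ge0 // ltW.
  apply: functional_avg_ge => // j sj; case: ltnP => ik.
    have := functional_le (a i) ub (y1 j); rewrite ler_norml => /andP[h _].
    apply: le_trans h; have hbi := hb n a i (ltn_ord i); rewrite -/z in hbi.
    have : w k * v i <= mag (a i).
      apply: le_trans (ler_wpM2l (ltW (w0 k)) (vm i (ltn_ord i))) _.
      by apply: ler_piMl => //; rewrite exprn_ile1 // invf_le1 // ler1n.
    by lra.
  have [h1 h2] := hv i j (introT andP (conj ik (ltn_ord i))) sj.
  rewrite subr0 mulrA; apply: superpose_ge ub _ h1 _ h2.
    exact: leq_trans ik (supp_ge iM sj).
  by rewrite -mulrA mulr_ge0.
apply: lt_le_trans (ler_sum _ (fun i _ => lower i)).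
rewrite !sumrB -!mulr_sumr.
have few m (t : R) : 0 <= t -> \sum_(i < m) (if (i < k)%N then t else 0) <= k%:R * t.
  move=> t0; rewrite mulr_natl; apply: le_trans (_ : t *+ minn m k <= _).
    elim: m => [|m IH]; first by rewrite big_ord0 min0n mulr0n.
    rewrite big_ord_recr /=; case: ltnP => mk.
      by rewrite (minn_idPl mk) mulrSr lerD2r; rewrite (minn_idPl (ltnW mk)) in IH.
    by rewrite addr0 (minn_idPr (leqW mk)); rewrite (minn_idPr mk) in IH.
  by apply: ler_wpMn2l => //; exact: geq_minr.
have /= sm := epss n a; rewrite -/z mul1r in sm.
have ck : w k * (c k * z) < w k * \sum_(i < n) v i by rewrite ltr_pM2l.
have ckE : w k * (c k * z) = (k%:R + 2 + 2 * (k%:R * beta)) * z.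
  by rewrite /c; field; rewrite gt_eqF.
have := few n (2 * (beta * z)); rewrite !mulr_ge0 ?(ltW b0) // => /(_ isT) fw.
move: ck; rewrite ckE => ck.
have -> : k%:R * z = (k%:R + 2 + 2 * (k%:R * beta)) * z - 2 * z - k%:R * (2 * (beta * z)).
  by ring.
move: ck sm fw; lra.
Qed.

End Conclusion.

Theorem corollary1p7 (R : realType) (cplx : bool) (xi : ord)
    (P : prob_block R) (X G : completeNormedModType (scalar_field R cplx))
    (g : nat -> G) :
  ord_lt OZero xi ->
  homogeneous xi P ->
  schauder_basis g ->
  seminormalized g ->
  ((forall x : nat -> X, bounded_fun x -> weakly_null x ->
      exists2 M, infinite_set M & dominated (block_avg P M x) g) ->
    exists C : R, uniformly_dominated P X g C)
  /\
  (forall Q : prob_block R, homogeneous xi Q ->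
    (exists C : R, uniformly_dominated P X g C) ->
    (exists C : R, uniformly_dominated Q X g C) /\
    inf [set C : R | uniformly_dominated P X g C] =
    inf [set C : R | uniformly_dominated Q X g C]).
Proof.
move=> xi0 hP gb gs; split; first exact: (uniformly_dominated_ex gb gs xi0 hP).
move=> Q hQ [C uC].
have uQ : uniformly_dominated Q X g (C + 1).
  by apply: (uniformly_dominated_block gb gs xi0 hP hQ _ uC); rewrite ltrDl.
split; first by exists (C + 1).
(* zero averages are dominated, but the basis vectors do not vanish *)
have lb (B : prob_block R) D : uniformly_dominated B X g D -> 0 <= D.
  have wz : weakly_null (fun=> 0 : X).
    by move=> f fc; rewrite linear0; exact: cvg_cst.
  have z1 (n : nat) : `|0 : X| <= 1 by rewrite normr0.
  move=> /(_ _ wz z1 _ infinite_nat)[M [_ iM]] /(_ M (inf_subsetsxx iM)).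
  move=> /C_dominatedP/(_ 1%N (fun=> 1)); rewrite !big_ord1 !scale1r => h.
  have [c0 [c1 [c00 /(_ 0%N)[gc _]]]] := gs.
  have g0 : 0 < nrm (g 0%N).
    by apply: lt_le_trans c00 _; rewrite -(of_real_le cplx) nrmK.
  by rewrite -(pmulr_lge0 _ g0); apply: le_trans h; exact: nrm_ge0.
have inf_le (B B' : prob_block R) D : homogeneous xi B -> homogeneous xi B' ->
    uniformly_dominated B' X g D ->
    inf [set C : R | uniformly_dominated B X g C] <= inf [set C : R | uniformly_dominated B' X g C].
  move=> hB hB' uD; apply: lb_le_inf; first by exists D.
  move=> E uE; apply/ler_addgt0Pr => e e0; apply: inf_lbound.
    by exists 0 => F /lb.
  by apply: (uniformly_dominated_block gb gs xi0 hB' hB _ uE); rewrite ltrDl.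
by apply/eqP; rewrite eq_le (inf_le P Q (C + 1)) // (inf_le Q P C).
Qed.
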